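(* Let $\mathcal E$ be a quantum Dirichlet form on the tracial von Neumann algebra $(\mathcal M,\tau)$, let $\mathcal C=D(\mathcal E)\cap\mathcal M$, and let $(\partial,\mathcal H,L,R,J)$ be the first order differential calculus of $\mathcal E$. The following assertions are equivalent: (i) $L$ is $\sigma$-weakly continuous (on $\mathcal C$); (ii) $R$ is $\sigma$-weakly continuous (on $\mathcal C$); (iii) the functional $\boldsymbol\Gamma(a)\colon\mathcal C\to\mathbb C$ is $\sigma$-weakly continuous for all $a\in\mathcal C$; (iv) the functional $\boldsymbol\Gamma_{\mathcal H}(\xi)\colon\mathcal C\to\mathbb C$ is $\sigma$-weakly continuous for all $\xi\in\mathcal H$.
   Context: A tracial von Neumann algebra $(\mathcal M,\tau)$ is a von Neumann algebra with a normal semifinite faithful trace; $L^p(\mathcal M,\tau)$ are the noncommutative $L^p$ spaces ($L^\infty=\mathcal M$). The $\sigma$-weak topology on $\mathcal M$ is the weak$^*$ topology from $\mathcal M\cong L^1(\mathcal M,\tau)^*$; $\mathcal C\subset\mathcal M$ carries the induced topology and $B(\mathcal H)$ its own $\sigma$-weak topology. For self-adjoint $x$, $x\wedge\alpha$ is $\min\{\cdot,\alpha\}$ applied to $x$. A quantum Dirichlet form is a lower semicontinuous, densely defined quadratic form $\mathcal E\colon L^2(\mathcal M,\tau)\to[0,\infty]$ with $\mathcal E(a^* )=\mathcal E(a)$ such that for every $n$ the form $\mathcal E_n((a_{ij}))=\sum_{i,j}\mathcal E(a_{ij})$ on $L^2(M_n(\mathcal M),\tau\otimes\mathrm{tr}_n)$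 satisfies $\mathcal E_n(a\wedge1)\le\mathcal E_n(a)$ for self-adjoint $a$, and whose semigroup is conservative: if $\mathcal L$ is the positive self-adjoint operator associated with $\mathcal E$ and $P_t=e^{-t\mathcal L}$ (extended to $\mathcal M$), then $P_t1=1$. $D(\mathcal E)=\{\mathcal E<\infty\}$. First order differential calculus: $\mathcal C=D(\mathcal E)\cap\mathcal M$ is a $*$-algebra and there exist (uniquely up to unitary equivalence, by Cipriani--Sauvageot) a Hilbert space $\mathcal H$ (inner product linear in the first argument), commuting non-degenerate $*$-representations $L$ of $\mathcal C$ and $R$ of the opposite algebra $\mathcal C^\circ$ on $\mathcal H$, an anti-linear isometric involution $J$ on $\mathcal H$ and a closed operator $\partial\colon D(\mathcal E)\to\mathcal H$ such that the elements $L(a)\partial b$ ($a,b\in\mathcal C$) span a dense subspace of $\mathcal H$, $L(a)=JR(a)^*J$, $J\partial a=\partial(a^* )$, $\partial(ab)=L(a)\partial b+R(b)\partial a$ for $a,b\in\mathcal C$, and $\mathcal E(a)=\|\partial a\|_{\mathcal H}^2$ for $a\in D(\mathcal E)$. The carré du champ is $\boldsymbol\Gamma(a)(x)=\langle L(x)\partial a,\partial a\rangle_{\mathcal H}$ for $a,x\in\mathcal C$, and $\boldsymbol\Gamma_{\mathcal H}(\xi)(x)=\langle L(x)\xi,\xi\rangle_{\mathcal H}$ for $\xi\in\mathcal H$, $x\in\mathcal C$. *)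

(* Defs.v *)
From HB Require Import structures.
From mathcomp Require Import all_boot all_order all_algebra.
From mathcomp Require Import all_classical all_reals all_analysis.
From mathcomp Require Import complex.
Import Order.TTheory GRing.Theory Num.Theory numFieldNormedType.Exports.

Set Implicit Arguments.
Unset Strict Implicit.
Unset Printing Implicit Defensive.

Local Open Scope classical_set_scope.
Local Open Scope ring_scope.
Local Open Scope complex_scope.

HB.instance Definition _ (R : realType) :=
  PseudoPointedMetric.copy R[i] (R[i] : numFieldType)^o.
HB.instance Definition _ (R : realType) :=
  PseudoMetricNormedZmod.copy R[i] (R[i] : numFieldType)^o.
HB.instance Definition _ (R : realType) :=
  NormedModule.copy R[i] (R[i] : numFieldType)^o.

(* Complex Hilbert spaces; the inner product is linear in the first argument. *)
HB.mixin Record isHilbert (R : realType) H of CompleteNormedModule R[i] H := {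
  dotp : H -> H -> R[i];
  dotp_linear : forall y, scalar (dotp^~ y);
  dotp_conj : forall x y, dotp y x = (dotp x y)^*;
  dotp_norm : forall x, dotp x x = `|x| ^+ 2
}.

#[short(type="hilbertType")]
HB.structure Definition Hilbert (R : realType) :=
  {H of isHilbert R H & CompleteNormedModule R[i] H}.

Definition lspan (R : realType) (V : lmodType R[i]) (S : set V) : set V :=
  [set v | exists n (c : 'I_n -> R[i]) (s : 'I_n -> V),
    (forall i, S (s i)) /\ v = \sum_i c i *: s i].

Section Operators.
Context {R : realType} {H : hilbertType R}.
Implicit Types (S T : H -> H).

Definition bounded_op T := linear T /\ continuous T.

Definition is_adjoint T S := forall x y, dotp (T x) y = dotp x (S y).

(* Unique, and for bounded T existing, by the Riesz representation theorem. *)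
Definition adj T : H -> H := xget (0 : H -> H) [set S | is_adjoint T S].

Definition positive_op T := bounded_op T /\ forall x, 0 <= dotp (T x) x.

Definition op_le S T := positive_op (T - S).

(* |T|, the positive square root of T^* T *)
Definition op_abs T : H -> H :=
  xget (0 : H -> H) [set P | positive_op P /\ P \o P = adj T \o T].

Definition positive_part (A : set (H -> H)) : set (H -> H) :=
  [set T | A T /\ positive_op T].

Definition commutant (M : set (H -> H)) : set (H -> H) :=
  [set T | bounded_op T /\ forall S, M S -> T \o S = S \o T].

End Operators.

(* Stated with explicit topological types, since the carriers K -> K used below
   also bear other topologies. *)
Definition continuous_on (X Y : topologicalType) (A : set X) (f : X -> Y) :=
  {within A, continuous f}.

(* Initial topology of a family of complex functions on X. *)
Definition weak_top (R : realType) (X : choiceType) (I : Type)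
    (f : X -> I -> R[i]) : topologicalType :=
  initial_topology (f : X -> prod_topology (fun _ : I => R[i])).

(* The sigma-weak topology of B(H), given by the functionals
   T |-> sum_k <T xi_k, eta_k> with square summable (xi_k), (eta_k).  Its
   carrier is H -> H; only bounded operators are meaningful points. *)
Section SigmaWeakB.
Context {R : realType} (H : hilbertType R).

Definition square_summable (xi : nat -> H) :=
  cvgn (series (fun k => `|xi k| ^+ 2 : R[i])).

Definition sw_index :=
  {p : (nat -> H) * (nat -> H) | square_summable p.1 /\ square_summable p.2}.

Definition sw_functional (T : H -> H) (p : sw_index) : R[i] :=
  limn (series (fun k => dotp (T ((sval p).1 k)) ((sval p).2 k))).

Definition sigma_weak_B : topologicalType := weak_top sw_functional.

End SigmaWeakB.

(* A von Neumann algebra M on K together with a normal semifinite faithful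
   trace.  The values of vtrace outside the positive cone of M are
   irrelevant. *)
Record tracial_vNa (R : realType) (K : hilbertType R) := TracialVNA {
  valg : set (K -> K);
  vtrace : (K -> K) -> \bar R;
  valg_adj : forall x, valg x -> valg (adj x);
  valg_bicommutant : commutant (commutant valg) = valg;
  vtrace_ge0 : forall x, positive_part valg x -> (0 <= vtrace x)%E;
  vtraceD : forall x y, positive_part valg x -> positive_part valg y ->
    vtrace (x + y) = (vtrace x + vtrace y)%E;
  vtraceZ : forall (c : R) x, 0 <= c -> positive_part valg x ->
    vtrace (c%:C *: x) = (c%:E * vtrace x)%E;
  vtrace_tracial : forall x, valg x ->
    vtrace (adj x \o x) = vtrace (x \o adj x);
  vtrace_faithful : forall x, positive_part valg x -> vtrace x = 0%E -> x = 0;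
  vtrace_normal : forall (A : set (K -> K)) s,
    A `<=` positive_part valg -> A !=set0 ->
    (forall x y, A x -> A y -> exists2 z, A z & op_le x z /\ op_le y z) ->
    positive_part valg s -> (forall x, A x -> op_le x s) ->
    (forall u, positive_part valg u -> (forall x, A x -> op_le x u) -> op_le s u) ->
    vtrace s = ereal_sup (vtrace @` A);
  vtrace_semifinite : forall x, positive_part valg x -> x <> 0 ->
    exists y, [/\ positive_part valg y, op_le y x, y <> 0 & (vtrace y < +oo)%E]
}.

Section Lp.
Context {R : realType} {K : hilbertType R} (M : tracial_vNa K).
Implicit Types (x y : K -> K).

Definition fin_pos : set (K -> K) :=
  [set x | positive_part (valg M) x /\ (vtrace M x < +oo)%E].

(* The linear extension of the trace to the span of fin_pos. *)
Definition trace_lin x : R[i] := xget 0 [set w |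
  exists p1 p2 q1 q2,
    [/\ [/\ fin_pos p1, fin_pos p2, fin_pos q1 & fin_pos q2],
        x = p1 - p2 + 'i *: (q1 - q2) &
        w = (fine (vtrace M p1) - fine (vtrace M p2))
            +i* (fine (vtrace M q1) - fine (vtrace M q2))]].

(* Bounded elements of L^1 and of L^2. *)
Definition L1_bounded : set (K -> K) :=
  [set x | valg M x /\ (vtrace M (op_abs x) < +oo)%E].

Definition L2_bounded : set (K -> K) :=
  [set x | valg M x /\ (vtrace M (adj x \o x) < +oo)%E].

(* L^1(M, tau) is the completion of L1_bounded for the norm tau(|x|); its
   elements are represented by Cauchy sequences (y_n), and the element (y_n)
   acts on M by x |-> lim_n tau(x y_n). *)
Definition L1_cauchy (y : nat -> K -> K) :=
  (forall n, L1_bounded (y n)) /\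
  (forall eps : R, 0 < eps -> exists N, forall m n, (N <= m)%N -> (N <= n)%N ->
     (vtrace M (op_abs (y m - y n)%R) < eps%:E)%E).

Definition L1_pairing x (y : {y | L1_cauchy y}) : R[i] :=
  limn (fun n => trace_lin (x \o sval y n)).

(* The weak-* topology of M = L^1(M, tau)^*.  Its carrier is K -> K; only
   elements of M are meaningful points. *)
Definition sigma_weak : topologicalType := weak_top L1_pairing.

(* L^2(M, tau) as a Hilbert space completion of L2_bounded, with the isometric
   extension L2_star of the involution x |-> x^*. *)
Record L2_completion := L2Completion {
  L2_space :> hilbertType R;
  L2_emb : (K -> K) -> L2_space;
  L2_star : L2_space -> L2_space;
  L2_emb_linear : forall (c : R[i]) x y, L2_bounded x -> L2_bounded y ->
    L2_emb (c *: x + y) = c *: L2_emb x + L2_emb y;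
  L2_emb_dotp : forall x y, L2_bounded x -> L2_bounded y ->
    dotp (L2_emb x) (L2_emb y) = trace_lin (adj y \o x);
  L2_emb_dense : dense (L2_emb @` L2_bounded);
  L2_star_emb : forall x, L2_bounded x -> L2_star (L2_emb x) = L2_emb (adj x);
  L2_star_isometry : forall a b, `|L2_star a - L2_star b| = `|a - b|
}.

End Lp.

(* Functional calculus of self-adjoint elements of
   L^2(M_n(M), tau (x) tr_n) = M_n(L^2(M, tau)). *)
Section FunctionalCalculus.
Context {R : realType} {K : hilbertType R} {M : tracial_vNa K}.
Variables (V : L2_completion M) (n : nat).
Implicit Types (x y : 'M[K -> K]_n) (a b : 'M[V]_n).

Definition mx_in (A : set (K -> K)) x := forall i j, A (x i j).
Definition mx_mul x y : 'M[K -> K]_n :=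
  \matrix_(i, j) \sum_k (x i k \o y k j).
Definition mx_adj x : 'M[K -> K]_n := \matrix_(i, j) adj (x j i).
Definition mx_one : 'M[K -> K]_n :=
  \matrix_(i, j) (if i == j then id else (0 : K -> K)).

Definition mx_emb x : 'M[V]_n := map_mx (@L2_emb _ _ _ V) x.
Definition mx_star a : 'M[V]_n := \matrix_(i, j) L2_star (a j i).
Definition mx_dotp a b : R[i] := \sum_i \sum_j dotp (a i j) (b i j).

(* B |-> || e(B) y ||_2^2 *)
Definition spectral_distribution (e : set R -> 'M[K -> K]_n) y
    (mu : {measure set (measurableTypeR R) -> \bar R}) :=
  forall B : set (measurableTypeR R), measurable B ->
    (mu B) = (complex.Re (mx_dotp (mx_emb (mx_mul (e B) y))
                                  (mx_emb (mx_mul (e B) y))))%:E.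

(* Projection-valued Borel measures on the line with values in M_n(M).
   Countable additivity is tested on the vectors of the dense subspace
   M_n(L2_bounded) of L^2(M_n(M)), on which M_n(M) acts faithfully and normally
   by left multiplication. *)
Record spectral_measure (e : set R -> 'M[K -> K]_n) : Prop := {
  spectral_in : forall B : set (measurableTypeR R), measurable B ->
    mx_in (valg M) (e B);
  spectral_adj : forall B : set (measurableTypeR R), measurable B ->
    mx_adj (e B) = e B;
  spectral_setI : forall A B : set (measurableTypeR R),
    measurable A -> measurable B -> mx_mul (e A) (e B) = e (A `&` B);
  spectral_setT : e setT = mx_one;
  spectral_sigma_additive : forall y, mx_in (L2_bounded M) y ->
    exists mu, spectral_distribution e y mu
}.

(* a = \int f(t) de(t), tested on the vectors y of M_n(L2_bounded):
   <a y, y> = \int f(t) d<e(t) y, y>, where <a y, y> = tau(y^* a y) is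
   written as tau(a y y^* ) = <a, y y^*>. *)
Definition spectral_integral (e : set R -> 'M[K -> K]_n) (f : R -> R) a :=
  forall y mu, mx_in (L2_bounded M) y -> spectral_distribution e y mu ->
    mu.-integrable setT (EFin \o f) /\
    mx_dotp a (mx_emb (mx_mul y (mx_adj y))) = (\int[mu]_t f t)%:C.

(* b = f(a) *)
Definition functional_calculus (f : R -> R) a b :=
  exists e, [/\ spectral_measure e, spectral_integral e id a &
                spectral_integral e f b].

(* b is the truncation of a by alpha, for self-adjoint a *)
Definition is_meet (alpha : R) a b :=
  functional_calculus (fun t => Num.min t alpha) a b.

End FunctionalCalculus.

Section Forms.
Context {R : realType} {V : hilbertType R} (E : V -> \bar R).

Record quadratic_form : Prop := {
  qform_ge0 : forall a, (0 <= E a)%E;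
  qformZ : forall (c : R[i]) a,
    E (c *: a) = ((complex.Re (`|c| ^+ 2)%R)%:E * E a)%E;
  qform_parallelogram : forall a b,
    (E (a + b)%R + E (a - b)%R = 2%:E * (E a + E b))%E
}.

Definition form_domain : set V := [set a | (E a < +oo)%E].

(* The sesquilinear form E(a, b), linear in a, on form_domain. *)
Definition form_polar (a b : V) : R[i] :=
  4%:R^-1 * \sum_(k < 4) 'i ^+ k * (fine (E (a + 'i ^+ k *: b)))%:C.

(* The graph of the positive self-adjoint operator associated with E. *)
Definition form_operator (a b : V) :=
  form_domain a /\ forall c, form_domain c -> form_polar a c = dotp b c.

(* P_t = exp(- t A), the strongly continuous semigroup with generator - A, for
   the operator with graph A. *)
Record exp_semigroup (A : V -> V -> Prop) (P : R -> V -> V) : Prop := {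
  semigroup_bounded : forall t, 0 <= t -> bounded_op (P t);
  semigroup0 : P 0 = id;
  semigroupD : forall s t, 0 <= s -> 0 <= t -> P (s + t) = P s \o P t;
  semigroup_continuous : forall a, P t a @[t --> 0^'+] --> a;
  semigroup_generator : forall a b,
    A a b <-> (t^-1)%:C *: (a - P t a) @[t --> 0^'+] --> b
}.

End Forms.

Section DirichletForms.
Context {R : realType} {K : hilbertType R} {M : tracial_vNa K}.
Context {V : L2_completion M} (E : V -> \bar R).

Definition mx_form n (a : 'M[V]_n) : \bar R := (\sum_i \sum_j E (a i j))%E.

Definition markovian n := forall a b : 'M[V]_n,
  mx_star a = a -> is_meet 1 a b -> (mx_form b <= mx_form a)%E.

(* Q is the sigma-weakly continuous extension to M of P restricted to the
   bounded elements of L^2. *)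
Definition sigma_weak_extension (P : V -> V)
    (Q : (K -> K) -> (K -> K)) :=
  [/\ forall x, valg M x -> valg M (Q x),
      @continuous_on (sigma_weak M) (sigma_weak M) (valg M) Q &
      forall x, L2_bounded M x ->
        L2_bounded M (Q x) /\ L2_emb V (Q x) = P (L2_emb V x)].

Definition conservative :=
  exists P, exp_semigroup (form_operator E) P /\
    forall t, 0 <= t ->
      exists Q, sigma_weak_extension (P t) Q /\ Q id = id.

Record quantum_dirichlet_form : Prop := {
  qdf_quadratic : quadratic_form E;
  qdf_lsc : lower_semicontinuous E;
  qdf_dense : dense (form_domain E);
  qdf_star : forall a, E (L2_star a) = E a;
  qdf_markov : forall n, markovian n;
  qdf_conservative : conservative
}.

(* The Dirichlet algebra D(E) cap M *)
Definition dirichlet_algebra : set (K -> K) :=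
  [set x | L2_bounded M x /\ form_domain E (L2_emb V x)].

End DirichletForms.

Section Calculus.
Context {R : realType} {K : hilbertType R} {M : tracial_vNa K}.
Context {V : L2_completion M} (E : V -> \bar R) {H : hilbertType R}.
Implicit Types (L Rt : (K -> K) -> (H -> H)).
Local Notation C := (dirichlet_algebra E).

(* Non-degenerate *-representations on H of the *-algebra C, by bounded
   operators; only the values on C matter.  The flag op selects C (false) or
   the opposite algebra (true). *)
Record star_representation (op : bool) (pi : (K -> K) -> (H -> H)) : Prop := {
  rep_bounded : forall x, C x -> bounded_op (pi x);
  rep_linear : forall (c : R[i]) x y, C x -> C y ->
    pi (c *: x + y) = c *: pi x + pi y;
  rep_mul : forall x y, C x -> C y ->
    pi (x \o y) = if op then pi y \o pi x else pi x \o pi y;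
  rep_adj : forall x, C x -> pi (adj x) = adj (pi x);
  rep_nondegenerate :
    dense (lspan [set v | exists x xi, C x /\ v = pi x xi])
}.

Record first_order_calculus (d : V -> H) (L Rt : (K -> K) -> (H -> H))
    (J : H -> H) : Prop := {
  calc_algebra : forall x y, C x -> C y -> C (x \o y);
  calc_L : star_representation false L;
  calc_R : star_representation true Rt;
  calc_commute : forall x y, C x -> C y -> L x \o Rt y = Rt y \o L x;
  calc_J_antilinear : forall (c : R[i]) xi eta,
    J (c *: xi + eta) = c^* *: J xi + J eta;
  calc_J_isometry : forall xi, `|J xi| = `|xi|;
  calc_J_involution : forall xi, J (J xi) = xi;
  calc_d_linear : forall (c : R[i]) a b, form_domain E a -> form_domain E b ->
    d (c *: a + b) = c *: d a + d b;
  calc_d_closed :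
    closed [set p : V * H | form_domain E p.1 /\ p.2 = d p.1];
  calc_dense : dense (lspan [set v | exists x y,
    [/\ C x, C y & v = L x (d (L2_emb V y))]]);
  calc_LR : forall x, C x -> L x = J \o adj (Rt x) \o J;
  calc_J_d : forall x, C x ->
    J (d (L2_emb V x)) = d (L2_emb V (adj x));
  calc_leibniz : forall x y, C x -> C y ->
    d (L2_emb V (x \o y)) = L x (d (L2_emb V y)) + Rt y (d (L2_emb V x));
  calc_energy : forall a, form_domain E a ->
    E a = (complex.Re (`|d a| ^+ 2))%:E
}.

Definition carre_du_champ_H L (xi : H) (x : K -> K) : R[i] :=
  dotp (L x xi) xi.

Definition carre_du_champ (d : V -> H) L (a x : K -> K) : R[i] :=
  dotp (L x (d (L2_emb V a))) (d (L2_emb V a)).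

End Calculus.

(* Main.v *)
(* J exchanges L(a) and R(a)^*, so (i) and (ii) are equivalent, and evaluation
   on vectors gives (iii).  For the converse, the point is that sigma-weakly
   continuous functionals on C are closed under limits in the dual norm of C,
   for the operator norm on C.

   Such a functional is tau(. y) for some y in L^1.  Conservativity places P_t x
   in C for x in M cap L^2 and small t > 0, because E(P_t x) <= |x|^2 / 2t, so C
   is dense in L^2.  Kaplansky's argument with c (1 + c^* c / 4)^-1 then bounds
   the L^1 norm of y by a multiple of the norm of tau(. y) on C, and a
   norm-Cauchy sequence of functionals is represented by an L^1-Cauchy sequence.

   Given (iii), polarization and
   <L(x) L(a) db, L(a) db> = <L(a^* x a) db, db> make x |-> <L(x) xi, xi>
   sigma-weakly continuous for xi in a dense subspace.  In particular
   |<L(x) xi, xi>| <= c |x|, which by the C^*-identity improves to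
   |L(x) xi| <= |x| |xi|.  Hence all functionals <L(.) xi, eta>, and the square
   summable series of them, are norm limits of sigma-weakly continuous ones. *)

Require Import Defs.
From HB Require Import structures.
From mathcomp Require Import all_boot all_order all_algebra.
From mathcomp Require Import all_classical all_reals all_analysis.
From mathcomp Require Import complex.
From mathcomp Require Import ring lra.
Import Order.TTheory GRing.Theory Num.Theory numFieldNormedType.Exports.

Set Implicit Arguments.
Unset Strict Implicit.
Unset Printing Implicit Defensive.

Local Open Scope classical_set_scope.
Local Open Scope ring_scope.
Local Open Scope complex_scope.

(** * Norms and Hilbert spaces *)

(** Spectral arguments are reduced to square roots and resolvents. Both commute with whatever
    commutes with the given operator, so the bicommutant keeps them in M. The contraction
    [y (delta + |y|)^-1] takes the place of the partial isometry in the polar decomposition of y,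
    and normality of the trace lets delta tend to 0. Resolvents also give Kaplansky's transform;
    their Neumann iterates keep it within reach of C, which need not be norm closed.

    Since [trace_lin] rests on a chosen decomposition, tau(x z) is handled as the inner product of z
    with the adjoint of x in L^2, and the L^1 norm of z as a bound for this pairing on operator norm
    balls.

    The semigroup is known only through its law, its strong continuity at 0 and its generator. A
    bound for small times comes from Banach-Steinhaus, and the energy estimate from one-sided
    increments of the norm and of the energy along an orbit.

    Continuity at 0 on C is turned into membership in L^1 by linear algebra: a continuous functional
    vanishes on the common kernel of finitely many pairings, hence is a combination of them. *)

Section Norm.
Context {R : realType}.

(* The library norm of a complex normed space is R[i]-valued. *)
Definition nrm (V : normedModType R[i]) (x : V) : R := complex.Re `|x|.

Section NormTheory.
Context {V : normedModType R[i]}.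
Implicit Types (x y : V) (c : R[i]).

Lemma normr_nrm x : `|x| = (nrm x)%:C.
Proof. by rewrite /nrm RRe_real// normr_real. Qed.

Lemma nrm_ge0 x : 0 <= nrm x.
Proof. by rewrite -ler0c -normr_nrm. Qed.

Lemma nrmD x y : nrm (x + y) <= nrm x + nrm y.
Proof. by rewrite -lecR rmorphD/= -!normr_nrm ler_normD. Qed.

Lemma nrmN x : nrm (- x) = nrm x.
Proof. by rewrite /nrm normrN. Qed.

Lemma nrmBC x y : nrm (x - y) = nrm (y - x).
Proof. by rewrite -nrmN opprB. Qed.

Lemma nrm0 : nrm (0 : V) = 0.
Proof. by rewrite /nrm normr0. Qed.

Lemma nrm_eq0 x : nrm x = 0 -> x = 0.
Proof. by move=> h; apply/normr0_eq0; rewrite normr_nrm h. Qed.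

Lemma nrm_le0 x : nrm x <= 0 -> x = 0.
Proof. by move=> h; apply: nrm_eq0; apply/le_anti; rewrite h nrm_ge0. Qed.

Lemma nrmB_le x y z : nrm (x - y) <= nrm (x - z) + nrm (z - y).
Proof. by rewrite (_ : x - y = (x - z) + (z - y)) ?nrmD// addrA subrK. Qed.

Lemma nrmB x y : nrm (x - y) <= nrm x + nrm y.
Proof. by rewrite -(nrmN y) nrmD. Qed.

Lemma ler_nrmB x y : `|nrm x - nrm y| <= nrm (x - y).
Proof.
rewrite ler_norml; apply/andP; split.
  rewrite lerNl opprB lerBlDr nrmBC; have := nrmD (y - x) x.
  by rewrite subrK.
by rewrite lerBlDr; have := nrmD (x - y) y; rewrite subrK.
Qed.

Lemma nrmZ c x : nrm (c *: x) = nrm c * nrm x.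
Proof. by apply: complexI; rewrite rmorphM/= -!normr_nrm normrZ. Qed.

(** Moves a limit from the complex-valued metric to real numbers, where order arguments and [lra]
    apply. *)
Lemma cvg_nrmP {T : Type} {F : set_system T} {FF : Filter F} (f : T -> V) (l : V) :
  f @ F --> l <-> nrm (f x - l) @[x --> F] --> (0 : R).
Proof.
split.
- move=> /cvgrPdist_lt h; apply/cvgrPdist_lt => e e0.
  have e0' : 0 < e%:C :> R[i] by rewrite ltcR.
  near=> x; rewrite sub0r normrN ger0_norm ?nrm_ge0//.
  rewrite -ltcR -normr_nrm distrC; near: x; exact: h.
- move=> /cvgrPdist_lt h; apply/cvgrPdist_lt => e e0.
  have : e \is Num.real by exact: gtr0_real.
  move=> /RRe_real ee; rewrite -ee ltcR in e0.
  near=> x; rewrite distrC normr_nrm -ee ltcR -[X in X < _]ger0_norm ?nrm_ge0//.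
  rewrite -[X in `|X|]opprK normrN -sub0r; near: x; exact: h.
Unshelve. all: by end_near. Qed.

Lemma cvg_nrm {T : Type} {F : set_system T} {FF : Filter F} (f : T -> V) (l : V) :
  f @ F --> l -> nrm (f x) @[x --> F] --> nrm l.
Proof.
move=> /cvg_nrmP/cvgrPdist_lt h; apply/cvgrPdist_lt => e e0.
near=> x; rewrite distrC; apply: le_lt_trans (ler_nrmB _ _) _.
rewrite -[X in X < _]ger0_norm ?nrm_ge0// -[X in `|X|]opprK normrN -sub0r.
by near: x; exact: h.
Unshelve. all: by end_near. Qed.

Lemma cvg_squeeze {T : Type} {F : set_system T} {FF : Filter F}
    (f : T -> V) (l : V) (g : T -> R) :
  (\forall x \near F, nrm (f x - l) <= g x) -> g @ F --> (0 : R) -> f @ F --> l.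
Proof.
move=> h1 h2; apply/cvg_nrmP; apply: (@squeeze_cvgr _ _ _ _ (cst 0) g) => //.
  by near=> x; rewrite nrm_ge0/=; near: x.
exact: cvg_cst.
Unshelve. all: by end_near. Qed.

Lemma cvg_nrm_le {T : Type} {F : set_system T} {FF : ProperFilter F}
    (f : T -> V) (l : V) (c : R) :
  (\forall x \near F, nrm (f x) <= c) -> f @ F --> l -> nrm l <= c.
Proof.
move=> h1 /cvg_nrm h2; rewrite -(cvg_lim _ h2)//; apply: limr_le => //.
by apply/cvg_ex; exists (nrm l).
Qed.

Lemma cvg_uniq {T : Type} {F : set_system T} {FF : ProperFilter F}
    (f : T -> V) (l l' : V) : f @ F --> l -> f @ F --> l' -> l = l'.
Proof. by move=> h h'; rewrite -(cvg_lim _ h)//; exact: cvg_lim. Qed.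

End NormTheory.

Lemma realCD (x y : R) : (x + y)%:C = x%:C + y%:C.
Proof. exact: (rmorphD (real_complex R)). Qed.

Lemma realCB (x y : R) : (x - y)%:C = x%:C - y%:C.
Proof. exact: (rmorphB (real_complex R)). Qed.

Lemma realCM (x y : R) : (x * y)%:C = x%:C * y%:C.
Proof. exact: (rmorphM (real_complex R)). Qed.

Lemma realC_nat n : (n%:R)%:C = n%:R :> R[i].
Proof. exact: (rmorph_nat (real_complex R)). Qed.

Lemma nrm_real (x : R) : nrm (x%:C) = `|x|.
Proof. by rewrite /nrm normc_def/= expr0n/= addr0 sqrtr_sqr. Qed.

Lemma nrmM (x y : R[i]) : nrm (x * y) = nrm x * nrm y.
Proof. by apply: complexI; rewrite rmorphM/= -!normr_nrm normrM. Qed.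

Lemma nrm1 : nrm (1 : R[i]) = 1.
Proof. by rewrite /nrm normr1. Qed.

Lemma nrmi : nrm ('i%C : R[i]) = 1.
Proof. by rewrite /nrm normc_def/= expr0n/= add0r expr1n sqrtr1. Qed.

Lemma nrm2E (x : R[i]) : nrm x ^+ 2 = complex.Re x ^+ 2 + complex.Im x ^+ 2.
Proof.
rewrite /nrm normc_def/= sqr_sqrtr// addr_ge0// ?sqr_ge0//.
Qed.

Lemma Re_le_nrm (x : R[i]) : complex.Re x <= nrm x.
Proof.
have := normc_ge_Re x; rewrite normr_nrm lecR; apply: le_trans; exact: ler_norm.
Qed.

Lemma normr_Re_le (x : R[i]) : `|complex.Re x| <= nrm x.
Proof. by have := normc_ge_Re x; rewrite normr_nrm lecR. Qed.

Lemma normr_Im_le (x : R[i]) : `|complex.Im x| <= nrm x.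
Proof.
rewrite -(@ler_pXn2r _ 2)// ?nnegrE ?nrm_ge0// nrm2E real_normK ?num_real//.
by rewrite lerDr sqr_ge0.
Qed.

Lemma nrm_le_ReIm (x : R[i]) : nrm x <= `|complex.Re x| + `|complex.Im x|.
Proof.
rewrite -(@ler_pXn2r _ 2)// ?nnegrE ?nrm_ge0 ?addr_ge0// nrm2E sqrrD.
by rewrite !real_normK ?num_real// lerD2r lerDl mulrn_wge0// mulr_ge0.
Qed.

Lemma cauchy_real (u : nat -> R) :
  (forall e : R, 0 < e -> exists N, forall m n, (N <= m)%N -> (N <= n)%N ->
     `|u m - u n| < e) -> exists l : R, u @ \oo --> l.
Proof.
move=> h; suff /cvg_ex : cvgn u by [].
apply/cauchy_cvgP/cauchy_exP => e e0.
have [N hN] := h _ e0.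
exists (u N), N => // n /= Nn.
by rewrite -ball_normE/=; exact: hN.
Qed.

Lemma cauchy_complex (u : nat -> R[i]) :
  (forall e : R, 0 < e -> exists N, forall m n, (N <= m)%N -> (N <= n)%N ->
     nrm (u m - u n) < e) -> exists l : R[i], u @ \oo --> l.
Proof.
move=> hu.
have [a ha] : exists a : R, (fun n => complex.Re (u n)) @ \oo --> a.
  apply: cauchy_real => e /hu[N hN]; exists N => m n Nm Nn.
  by rewrite -raddfB; apply: le_lt_trans (normr_Re_le _) (hN m n Nm Nn).
have [b hb] : exists b : R, (fun n => complex.Im (u n)) @ \oo --> b.
  apply: cauchy_real => e /hu[N hN]; exists N => m n Nm Nn.
  by rewrite -raddfB; apply: le_lt_trans (normr_Im_le _) (hN m n Nm Nn).
exists (a +i* b); apply: (@cvg_squeeze _ _ _ _ _ _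
   (fun n => `|complex.Re (u n) - a| + `|complex.Im (u n) - b|)).
  by apply: nearW => n; have := nrm_le_ReIm (u n - (a +i* b)); rewrite !raddfB.
have h (v : nat -> R) (c : R) : v @ \oo --> c -> (fun n => `|v n - c|) @ \oo --> (0 : R).
  move=> hv; rewrite -(normr0 R) -(subrr c); apply: cvg_norm; apply: cvgB => //.
  exact: cvg_cst.
by rewrite -[0](addr0 0); apply: cvgD; exact: h.
Qed.

Lemma cauchy_nrm (V : completeNormedModType R[i]) (u : nat -> V) :
  (forall e : R, 0 < e -> exists N, forall m n, (N <= m)%N -> (N <= n)%N ->
     nrm (u m - u n) < e) -> exists l : V, u @ \oo --> l.
Proof.
move=> h; suff /cvg_ex : cvgn u by [].
apply/cauchy_cvgP/cauchy_exP => e e0.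
have : e \is Num.real by exact: gtr0_real.
move=> /RRe_real ee; rewrite -ee ltcR in e0.
have [N hN] := h _ e0.
exists (u N), N => // n /= Nn.
by rewrite -ball_normE/= normr_nrm -ee ltcR; exact: hN.
Qed.

Lemma cvg_succ (V : normedModType R[i]) (u : nat -> V) (l : V) :
  u @ \oo --> l -> (fun n => u n.+1) @ \oo --> l.
Proof. by rewrite -(cvg_shiftS u). Qed.

(** An explicit constant replaces the operator norm: no supremum has to be formed, and the bound
    makes sense for maps not yet known to be linear. *)
Definition obd (V W : normedModType R[i]) (T : V -> W) (c : R) :=
  forall v, nrm (T v) <= c * nrm v.

End Norm.

Section Hilbert.
Context {R : realType} {H : hilbertType R}.
Implicit Types (x y z : H) (c : R[i]).

Lemma dotpC x y : dotp y x = conjc (dotp x y).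
Proof. exact: dotp_conj. Qed.

Lemma dotpDl x y z : dotp (x + y) z = dotp x z + dotp y z.
Proof. by have := dotp_linear z 1 x y; rewrite scale1r mul1r. Qed.

Lemma dotp0l z : dotp 0 z = 0.
Proof.
have := dotpDl 0 0 z; rewrite addr0 => h.
by apply: (@addrI _ (dotp 0 z)); rewrite -h addr0.
Qed.

Lemma dotpZl c x z : dotp (c *: x) z = c * dotp x z.
Proof. by have := dotp_linear z c x 0; rewrite addr0 dotp0l addr0. Qed.

Lemma dotpNl x z : dotp (- x) z = - dotp x z.
Proof. by rewrite -scaleN1r dotpZl mulN1r. Qed.

Lemma dotpBl x y z : dotp (x - y) z = dotp x z - dotp y z.
Proof. by rewrite dotpDl dotpNl. Qed.

Lemma dotpDr x y z : dotp z (x + y) = dotp z x + dotp z y.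
Proof. by rewrite dotpC dotpDl rmorphD/= -!dotpC. Qed.

Lemma dotp0r z : dotp z 0 = 0.
Proof. by rewrite dotpC dotp0l rmorph0. Qed.

Lemma dotpZr c x z : dotp z (c *: x) = conjc c * dotp z x.
Proof. by rewrite dotpC dotpZl rmorphM/= -!dotpC. Qed.

Lemma dotpNr x z : dotp z (- x) = - dotp z x.
Proof. by rewrite dotpC dotpNl rmorphN/= -!dotpC. Qed.

Lemma dotpBr x y z : dotp z (x - y) = dotp z x - dotp z y.
Proof. by rewrite dotpDr dotpNr. Qed.

Definition dotpE := (dotpDl, dotpDr, dotpBl, dotpBr, dotpZl, dotpZr,
  dotpNl, dotpNr, dotp0l, dotp0r).

Lemma dotp_suml n (f : 'I_n -> H) y : dotp (\sum_i f i) y = \sum_i dotp (f i) y.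
Proof. by elim/big_ind2 : _ => [|a b u v <- <-|//]; rewrite dotpE. Qed.

Lemma dotp_sumr n (f : 'I_n -> H) y : dotp y (\sum_i f i) = \sum_i dotp y (f i).
Proof. by elim/big_ind2 : _ => [|a b u v <- <-|//]; rewrite dotpE. Qed.

Lemma dotpxx x : dotp x x = (nrm x ^+ 2)%:C.
Proof. by rewrite dotp_norm normr_nrm rmorphXn. Qed.

Lemma Re_dotpC x y : complex.Re (dotp y x) = complex.Re (dotp x y).
Proof. by rewrite dotpC; case: (dotp x y). Qed.

Lemma nrmD2 x y :
  nrm (x + y) ^+ 2 = nrm x ^+ 2 + nrm y ^+ 2 + 2 * complex.Re (dotp x y).
Proof.
apply: complexI; rewrite -dotpxx dotpDl !dotpDr !dotpxx (dotpC x y).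
by case: (dotp x y) => a b; apply/eqP; rewrite eq_complex/=; apply/andP;
  split; apply/eqP; ring.
Qed.

Lemma nrmB2 x y :
  nrm (x - y) ^+ 2 = nrm x ^+ 2 + nrm y ^+ 2 - 2 * complex.Re (dotp x y).
Proof. by rewrite nrmD2 nrmN dotpNr; case: (dotp x y) => a b /=; ring. Qed.

Lemma parallelogram x y :
  nrm (x + y) ^+ 2 + nrm (x - y) ^+ 2 = 2 * (nrm x ^+ 2 + nrm y ^+ 2).
Proof. by rewrite nrmD2 nrmB2; ring. Qed.

Lemma cauchy_schwarz x y : nrm (dotp x y) <= nrm x * nrm y.
Proof.
set a := dotp x y.
(* The square of [nrm (x - s a y)] as a polynomial in s. Its minimum is at s = |y|^-2, the value
   used below. *)
have h (s : R) : 0 <= nrm x ^+ 2 - 2 * s * nrm a ^+ 2 + s ^+ 2 * nrm a ^+ 2 * nrm y ^+ 2.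
  have := sqr_ge0 (nrm (x - (s%:C * a) *: y)); rewrite nrmB2 nrmZ nrmM nrm_real.
  rewrite dotpZr -/a => /le_trans; apply.
  rewrite exprMn exprMn real_normK ?num_real//.
  by case: a => u v; rewrite !nrm2E/=; lra.
have [y0|y0] := eqVneq (nrm y) 0.
  have -> : a = 0 by rewrite /a (nrm_eq0 y0) dotp0r.
  by rewrite nrm0 mulr_ge0 ?nrm_ge0.
have yp : 0 < nrm y by rewrite lt0r y0 nrm_ge0.
have h' := h (nrm y ^- 2).
move: yp h' y0; set n := nrm y => yp h' y0.
rewrite -(@ler_pXn2r _ 2)// ?nnegrE ?mulr_ge0 ?nrm_ge0//.
rewrite exprMn.
rewrite -ler_pdivrMr ?exprn_gt0//.
have e : (n ^- 2) ^+ 2 * nrm a ^+ 2 * n ^+ 2 = n ^- 2 * nrm a ^+ 2.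
  by field.
by move: h'; rewrite e; lra.
Qed.

Lemma dotp_inj x y : (forall z, dotp x z = dotp y z) -> x = y.
Proof.
move=> h; apply/eqP; rewrite -subr_eq0; apply/eqP.
apply/nrm_eq0/eqP; rewrite -sqrf_eq0; apply/eqP/complexI.
by rewrite -dotpxx dotpBl h subrr.
Qed.

Lemma dotp_injr x y : (forall z, dotp z x = dotp z y) -> x = y.
Proof. by move=> h; apply: dotp_inj => z; rewrite dotpC h -dotpC. Qed.

Lemma cvg_dotp {T : Type} {F : set_system T} {FF : Filter F}
    (f g : T -> H) (x y : H) : f @ F --> x -> g @ F --> y ->
  dotp (f t) (g t) @[t --> F] --> (dotp x y : R[i]).
Proof.
move=> hf hg.
apply: (@cvg_squeeze _ _ _ _ _ _ _ (fun t => nrm (f t - x) * (nrm (g t - y) + nrm y)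
   + nrm x * nrm (g t - y))).
  apply: nearW => t.
  rewrite (_ : _ - _ = dotp (f t - x) (g t) + dotp x (g t - y)); last first.
    by rewrite !dotpE; ring.
  apply: le_trans (nrmD _ _) _; apply: lerD; last exact: cauchy_schwarz.
  apply: le_trans (cauchy_schwarz _ _) _; rewrite ler_wpM2l ?nrm_ge0//.
  by rewrite -{1}(subrK y (g t)) nrmD.
move: hf hg => /cvg_nrmP hf /cvg_nrmP hg.
rewrite (_ : 0 = 0 * (0 + nrm y) + nrm x * 0 :> R); last by ring.
by apply: cvgD; [apply: cvgM => //; apply: cvgD => //|apply: cvgM => //]; apply: cvg_cst.
Qed.

End Hilbert.

(** * Minimising a quadratic functional over the domain of a closed operator *)

Section Minimisation.
Context {R : realType} {V H : hilbertType R}.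
Variables (D : set V) (T : V -> H) (f : V).
Hypothesis D0 : D 0.
Hypothesis DL : forall (c : R[i]) a b, D a -> D b -> D (c *: a + b).
Hypothesis TL : forall (c : R[i]) a b, D a -> D b -> T (c *: a + b) = c *: T a + T b.
Hypothesis Tclosed : forall (u : nat -> V) l w, (forall n, D (u n)) ->
  u @ \oo --> l -> (T \o u) @ \oo --> w -> D l /\ T l = w.

Let Phi u := nrm (T u) ^+ 2 + nrm (u - f) ^+ 2.

Let Phi_ge0 u : 0 <= Phi u.
Proof. by rewrite addr_ge0 ?sqr_ge0. Qed.

Let I := inf (Phi @` D).

Let I_le u : D u -> I <= Phi u.
Proof.
move=> Du; apply: ge_inf; last by exists u.
by exists 0 => _ [v _ <-].
Qed.

Let I_near n : exists u, D u /\ Phi u < I + n.+1%:R^-1.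
Proof.
have hi : has_inf (Phi @` D).
  by split; [exists (Phi 0); exists 0|exists 0 => _ [v _ <-]].
have e0 : 0 < n.+1%:R^-1 :> R by rewrite invr_gt0 ltr0n.
by have [_ [u Du <-] h] := inf_adherent e0 hi; exists u.
Qed.

Let TD a b : D a -> D b -> T (a + b) = T a + T b.
Proof. by move=> ha hb; rewrite -[a in LHS]scale1r TL// scale1r. Qed.

Let T0 : T 0 = 0.
Proof.
have := TD D0 D0; rewrite addr0 => h.
by apply: (@addrI _ (T 0)); rewrite -h addr0.
Qed.

Let TZ c a : D a -> T (c *: a) = c *: T a.
Proof. by move=> ha; rewrite -[_ *: _ in LHS]addr0 TL// T0 addr0. Qed.

Let DZ c a : D a -> D (c *: a).
Proof. by move=> ha; rewrite -[_ *: _]addr0; apply: DL. Qed.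

Let DD a b : D a -> D b -> D (a + b).
Proof. by move=> ha hb; rewrite -[a]scale1r; apply: DL. Qed.

(** The parallelogram identity in both spaces, with [I] as a lower bound for [Phi] at the midpoint
    of u and v. *)
Let Phi_dist u v : D u -> D v ->
  nrm (T u - T v) ^+ 2 + nrm (u - v) ^+ 2 <= 2 * (Phi u + Phi v) - 4 * I.
Proof.
move=> Du Dv.
have Dm : D (2^-1%:C *: (u + v)) by apply/DZ/DD.
have := I_le Dm; rewrite /Phi TZ ?TD//; last exact: DD.
have -> : 2^-1%:C *: (u + v) - f = 2^-1%:C *: ((u - f) + (v - f)).
  rewrite addrACA -opprD [in RHS]scalerDr scalerN; congr (_ - _).
  rewrite -[f + f]mulr2n -(scaler_nat 2 f) scalerA (_ : _ * _ = 1) ?scale1r//.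
  by rewrite -realC_nat -realCM mulVf ?pnatr_eq0.
rewrite !nrmZ nrm_real ger0_norm ?invr_ge0// !exprMn.
have := parallelogram (T u) (T v); have := parallelogram (u - f) (v - f).
rewrite (_ : u - f - (v - f) = u - v); last by rewrite opprB addrA subrK.
move: (nrm _ ^+ 2) (nrm _ ^+ 2) (nrm _ ^+ 2) (nrm _ ^+ 2) => a b c d.
move: (nrm _ ^+ 2) (nrm _ ^+ 2) (nrm _ ^+ 2) (nrm _ ^+ 2) => a' b' c' d'.
by lra.
Qed.

(** A minimising sequence is Cauchy in the graph norm, closedness provides the limit, and the
    equation is the Euler equation of [Phi]. With T = 0 on a kernel this is an orthogonal projection
    ([riesz]); with a multiple of the derivation it solves a resolvent equation for the operator of
    the form ([operator_dense]). *)
Lemma closed_minimiser :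
  exists u, D u /\ forall c, D c -> dotp (T u) (T c) + dotp (u - f) c = 0.
Proof.
have /choice[u hu] := I_near.
have cau (e : R) : 0 < e -> exists N, forall m n, (N <= m)%N -> (N <= n)%N ->
    nrm (T (u m) - T (u n)) ^+ 2 + nrm (u m - u n) ^+ 2 < e ^+ 2.
  move=> e0; have e20 : 0 < e ^+ 2 / 4 by rewrite divr_gt0// exprn_gt0.
  have [N _ hN] := near_infty_natSinv_lt (PosNum e20).
  exists N => m n Nm Nn; have [Dm hm] := hu m; have [Dn hn] := hu n.
  apply: le_lt_trans (Phi_dist Dm Dn) _.
  have := hN m Nm; have := hN n Nn => /=.
  move: hm hn; move: (Phi _) (Phi _) (_^-1) (_^-1) => a b c d; lra.
have lt2 (a b e : R) : 0 <= a -> 0 <= b -> 0 < e -> a ^+ 2 + b ^+ 2 < e ^+ 2 -> a < e /\ b < e.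
  move=> a0 b0 e0 h; split; rewrite -(@ltr_pXn2r _ 2)// ?nnegrE ?(ltW e0)//; nra.
have [l ul] : exists l : V, u @ \oo --> l.
  apply: cauchy_nrm => e e0; have [N hN] := cau e e0; exists N => m n Nm Nn.
  by have [] := lt2 _ _ _ (nrm_ge0 _) (nrm_ge0 _) e0 (hN m n Nm Nn).
have [w uw] : exists w : H, (T \o u) @ \oo --> w.
  apply: cauchy_nrm => e e0; have [N hN] := cau e e0; exists N => m n Nm Nn.
  by have [] := lt2 _ _ _ (nrm_ge0 _) (nrm_ge0 _) e0 (hN m n Nm Nn).
have [Dl Tl] := Tclosed (fun n => (hu n).1) ul uw.
have PI : Phi l <= I.
  have h1 : (fun n => Phi (u n)) @ \oo --> Phi l.
    rewrite /Phi Tl; apply: cvgD.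
      by rewrite expr2; under eq_fun do rewrite expr2; apply: cvgM; apply: (cvg_nrm uw).
    rewrite expr2; under eq_fun do rewrite expr2.
    by apply: cvgM; apply: cvg_nrm; apply: cvgB => //; apply: cvg_cst.
  have h2 : (fun n => I + n.+1%:R^-1) @ \oo --> I + 0.
    by apply: cvgD; [apply: cvg_cst|exact: cvg_harmonic].
  rewrite addr0 in h2; apply: (ler_cvg_to h1 h2).
  by apply: nearW => n; apply/ltW; have [] := hu n.
exists l; split => // c Dc.
set X := _ + _; set K := nrm (T c) ^+ 2 + nrm c ^+ 2.
have K0 : 0 <= K by rewrite addr_ge0 ?sqr_ge0.
(* Moving from l to l - s X c changes [Phi] by the expression on the right, which cannot be
   negative. For s = 1/(K + 1) it is at most -s |X|^2, so X = 0. *)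
have var (s : R) : 0 <= s ^+ 2 * nrm X ^+ 2 * K - 2 * s * nrm X ^+ 2.
  have Dz : D ((- s%:C * X) *: c + l) by apply: DL.
  have := le_trans PI (I_le Dz); rewrite /Phi TL// -addrA.
  rewrite [_ *: T c + _]addrC [_ *: c + _]addrC !nrmD2 !nrmZ !dotpZr !exprMn.
  rewrite (nrmN s%:C) nrm_real real_normK ?num_real//.
  move=> h.
  have e : complex.Re (conjc (- s%:C * X) * dotp (T l) (T c)) +
     complex.Re (conjc (- s%:C * X) * dotp (l - f) c) = - s * nrm X ^+ 2.
    rewrite -raddfD -mulrDr -/X nrm2E; case: (X) => a b /=; ring.
  move: h e; rewrite /K; move: (complex.Re _) (complex.Re _) => p q; lra.
have K1 : 0 < K + 1 by rewrite ltr_wpDl.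
have := var ((K + 1)^-1); set s := _^-1.
have s0 : 0 < s by rewrite invr_gt0.
have sK : s * K <= 1 by rewrite mulrC ler_pdivrMr// mul1r lerDl.
move=> h; apply/nrm_eq0/eqP; rewrite -sqrf_eq0 -[_ == _]orFb -(gt_eqF s0) -mulf_eq0.
rewrite eq_le mulr_ge0 ?sqr_ge0 ?(ltW s0)// andbT.
have := mulr_ge0 (ltW s0) (sqr_ge0 (nrm X)) => p0.
have : (s * nrm X ^+ 2) * (s * K) <= (s * nrm X ^+ 2) by rewrite ler_piMr.
by move: h; lra.
Qed.

End Minimisation.

(** * Bounded operators, adjoints and polarization *)

Section Operators.
Context {R : realType} {H : hilbertType R}.
Implicit Types (S T : H -> H) (x y v : H).

Lemma linear_obd_continuous T c : linear T -> obd T c -> continuous T.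
Proof.
move=> Tl Tc x; apply: (@cvg_squeeze _ _ _ _ _ _ _ (fun y => c * nrm (y - x))).
  apply: nearW => y.
  have -> : T y - T x = T (y - x).
    by rewrite [y - x]addrC -[- x]scaleN1r Tl scaleN1r addrC.
  exact: Tc.
rewrite (_ : 0 = c * 0 :> R); last by rewrite mulr0.
apply: cvgM; first exact: cvg_cst.
by apply/cvg_nrmP.
Qed.

Lemma opL T (c : R[i]) x y : bounded_op T -> T (c *: x + y) = c *: T x + T y.
Proof. by case=> h _; exact: h. Qed.

Lemma opD T x y : bounded_op T -> T (x + y) = T x + T y.
Proof. by move=> h; rewrite -[x in LHS]scale1r (opL _ _ _ h) scale1r. Qed.

Lemma op0 T : bounded_op T -> T 0 = 0.
Proof.
move=> h; have := opD 0 0 h; rewrite addr0 => e.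
by apply: (@addrI _ (T 0)); rewrite -e addr0.
Qed.

Lemma opZ T (c : R[i]) x : bounded_op T -> T (c *: x) = c *: T x.
Proof. by move=> h; rewrite -[_ *: _ in LHS]addr0 opL// (op0 h) addr0. Qed.

Lemma opN T x : bounded_op T -> T (- x) = - T x.
Proof. by move=> h; rewrite -scaleN1r opZ// scaleN1r. Qed.

Lemma opB T x y : bounded_op T -> T (x - y) = T x - T y.
Proof. by move=> h; rewrite opD// opN. Qed.

Definition opE T (h : bounded_op T) :=
  ((fun x y => opD x y h), (fun x y => opB x y h), (fun c x => opZ c x h),
   (fun x => opN x h), op0 h).

Lemma bounded_op_obd T : bounded_op T -> exists2 c, 0 <= c & obd T c.
Proof.
move=> h; have [_ /(_ 0)] := h.
move=> /cvg_nrmP/cvgrPdist_lt/(_ 1 ltr01); rewrite (op0 h) => hn.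
have [/= d d0 hd] := (nbhs_ballP _ _).1 hn.
have [dr d0'] : d = (complex.Re d)%:C /\ 0 < complex.Re d.
  by have e := RRe_real (gtr0_real d0); split=> //; rewrite -ltcR e.
exists (2 * (complex.Re d)^-1); first by rewrite mulr_ge0// invr_ge0 ltW.
move=> v; have [->|v0] := eqVneq v 0; first by rewrite (op0 h) !nrm0 mulr0.
have nv : 0 < nrm v.
  by rewrite lt0r nrm_ge0 andbT; apply: contra_neq v0 => /nrm_eq0.
set s := complex.Re d / 2 / nrm v.
have s0 : 0 < s by rewrite !divr_gt0.
have hs : ball 0 d (s%:C *: v).
  rewrite -ball_normE/= sub0r normrN normr_nrm nrmZ nrm_real (ger0_norm (ltW s0)).
  rewrite dr ltcR /s divfK; last by rewrite gt_eqF.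
  by rewrite ltr_pdivrMr// ltr_pMr// ltr1n.
have := hd _ hs; rewrite subr0 sub0r normrN ger0_norm ?nrm_ge0// opZ// nrmZ nrm_real.
rewrite ger0_norm ?(ltW s0)//.
move=> /ltW h1; have e : nrm (T v) = s * nrm (T v) * (2 * (complex.Re d)^-1 * nrm v).
  by rewrite /s; field; rewrite !gt_eqF.
rewrite [leLHS]e ler_piMl// !mulr_ge0 ?nrm_ge0// invr_ge0 ltW//.
Qed.

Lemma bounded_opI T c : linear T -> obd T c -> bounded_op T.
Proof. by move=> Tl Tc; split=> //; exact: linear_obd_continuous Tc. Qed.

Lemma obd_le T c c' : c <= c' -> obd T c -> obd T c'.
Proof. by move=> cc h v; apply: le_trans (h v) _; rewrite ler_wpM2r ?nrm_ge0. Qed.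

Lemma obd_comp S T c c' : 0 <= c -> obd S c -> obd T c' -> obd (S \o T) (c * c').
Proof.
move=> c0 h h' v /=; apply: le_trans (h _) _.
by rewrite -mulrA ler_wpM2l.
Qed.

Lemma obdD S T c c' : obd S c -> obd T c' -> obd (S + T) (c + c').
Proof.
by move=> h h' v; apply: le_trans (nrmD _ _) _; rewrite mulrDl lerD.
Qed.

Lemma obdB S T c c' : obd S c -> obd T c' -> obd (S - T) (c + c').
Proof.
by move=> h h' v; apply: le_trans (nrmB _ _) _; rewrite mulrDl lerD.
Qed.

Lemma obdZ (a : R[i]) T c : obd T c -> obd (a *: T) (nrm a * c).
Proof. by move=> h v; rewrite nrmZ -mulrA ler_wpM2l ?nrm_ge0. Qed.

Lemma obd_id : obd (id : H -> H) 1.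
Proof. by move=> v; rewrite mul1r. Qed.

Lemma bounded_op_comp S T : bounded_op S -> bounded_op T -> bounded_op (S \o T).
Proof.
move=> hS hT; have [c c0 hc] := bounded_op_obd hS.
have [d d0 hd] := bounded_op_obd hT.
apply: (bounded_opI (c := c * d)); last exact: obd_comp.
by move=> a u v /=; rewrite opL// opL.
Qed.

Lemma bounded_opD S T : bounded_op S -> bounded_op T -> bounded_op (S + T).
Proof.
move=> hS hT; have [c c0 hc] := bounded_op_obd hS.
have [d d0 hd] := bounded_op_obd hT.
apply: (bounded_opI (c := c + d)); last exact: obdD.
move=> a u v; rewrite !fctE/= (opL _ _ _ hS) (opL _ _ _ hT) scalerDr.
by rewrite addrACA.
Qed.

Lemma bounded_opZ (a : R[i]) T : bounded_op T -> bounded_op (a *: T).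
Proof.
move=> hT; have [d d0 hd] := bounded_op_obd hT.
apply: (bounded_opI (c := nrm a * d)); last exact: obdZ.
by move=> b u v; rewrite !fctE/= (opL _ _ _ hT) scalerDr !scalerA mulrC.
Qed.

Lemma bounded_opN T : bounded_op T -> bounded_op (- T).
Proof. by move=> h; rewrite -scaleN1r; exact: bounded_opZ. Qed.

Lemma bounded_opB S T : bounded_op S -> bounded_op T -> bounded_op (S - T).
Proof. by move=> h h'; apply: bounded_opD => //; exact: bounded_opN. Qed.

Lemma bounded_op_id : bounded_op (id : H -> H).
Proof. by apply: (bounded_opI (c := 1)) => //; exact: obd_id. Qed.

Lemma bounded_op0 : bounded_op (0 : H -> H).
Proof.
apply: (bounded_opI (c := 0)).
  by move=> a u v; rewrite ![(0 : H -> H) _]/(0 : H) scaler0 addr0.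
by move=> v; rewrite [(0 : H -> H) _]/(0 : H) nrm0 mul0r.
Qed.

Lemma is_adjoint_uniq T S S' : is_adjoint T S -> is_adjoint T S' -> S = S'.
Proof.
by move=> h h'; apply/funext => y; apply: dotp_injr => z; rewrite -h -h'.
Qed.

(** If phi f is not 0 and u is the point of the kernel closest to f, then f - u is orthogonal to the
    kernel, and phi is the pairing with a multiple of f - u. *)
Lemma riesz (phi : H -> R[i]) c :
  (forall a x y, phi (a *: x + y) = a * phi x + phi y) ->
  (forall x, nrm (phi x) <= c * nrm x) ->
  exists w, forall x, phi x = dotp x w.
Proof.
move=> phiL phic.
have phi0 : phi 0 = 0.
  by apply/nrm_le0; apply: le_trans (phic _) _; rewrite nrm0 mulr0.
have phiZ a x : phi (a *: x) = a * phi x by rewrite -[a *: x]addr0 phiL phi0 addr0.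
have [/existsNP[f f0]|/contrapT triv] := pselect (~ forall x, phi x = 0); last first.
  by exists 0 => x; rewrite dotp0r.
have [||u l w hu ul uw|u [Du hu]] := @closed_minimiser _ _ _
   [set x | phi x = 0] (0 : H -> H) f phi0.
- by move=> a x y /= hx hy; rewrite phiL hx hy mulr0 addr0.
- by move=> a x y _ _; rewrite ![(0 : H -> H) _]/(0 : H) scaler0 addr0.
- split; last by apply/esym; apply: cvg_uniq uw _ => /=; exact: cvg_cst.
  apply/nrm_le0; rewrite -[X in _ <= X]addr0.
  have hc : (fun n => phi (u n)) @ \oo --> (phi l : R[i]).
    apply: (@cvg_squeeze _ _ _ _ _ _ _ (fun n => c * nrm (u n - l))).
      apply: nearW => n; rewrite (_ : _ - _ = phi (u n - l))//.
      by rewrite [u n - l]addrC -[- l]scaleN1r phiL mulN1r addrC.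
    rewrite (_ : 0 = c * 0 :> R); last by rewrite mulr0.
    by apply: cvgM; [exact: cvg_cst|apply/cvg_nrmP].
  rewrite addr0; apply: cvg_nrm_le hc.
  by apply: nearW => n; rewrite hu nrm0.
set z := f - u.
have pz : phi z = phi f.
  by rewrite /z addrC -[- u]scaleN1r phiL Du mulr0 add0r.
have hz x : phi x = 0 -> dotp x z = 0.
  move=> /hu; rewrite dotp0l add0r -[u - f]opprB -/z dotpNl => /eqP.
  by rewrite oppr_eq0 => /eqP h; rewrite dotpC h rmorph0.
have z0 : dotp z z != 0.
  apply/eqP => /(congr1 (@complex.Re _)); rewrite dotpxx/= => /eqP.
  rewrite sqrf_eq0 => /eqP/nrm_eq0 zz; apply: f0.
  by rewrite -pz zz.
exists (conjc (phi f / dotp z z) *: z) => x.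
have := hz (x - (phi x / phi f) *: z).
rewrite addrC -scaleNr phiL pz mulNr divfK ?subrr; last exact/eqP.
rewrite addNr => /(_ erefl); rewrite dotpDl dotpZl => /eqP.
rewrite addrC mulNr subr_eq0 => /eqP e.
rewrite dotpZr conjcK e.
have pf : phi f != 0 by exact/eqP.
by field; rewrite pf z0.
Qed.

Lemma adjP T : bounded_op T -> is_adjoint T (adj T).
Proof.
move=> hT; suff [S hS] : exists S, is_adjoint T S.
  exact: (@xgetPex _ (0 : H -> H) [set S | is_adjoint T S] (ex_intro _ S hS)).
have [c c0 hc] := bounded_op_obd hT.
have /choice[S hS] y : exists w, forall x, dotp (T x) y = dotp x w.
  apply: (@riesz (fun x => dotp (T x) y) (c * nrm y)).
    by move=> a u v; rewrite opL// dotpE dotpE.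
  move=> x; apply: le_trans (cauchy_schwarz _ _) _.
  by rewrite mulrAC ler_wpM2r ?nrm_ge0.
by exists S => x y.
Qed.

Lemma adjE T S : bounded_op T -> is_adjoint T S -> adj T = S.
Proof. by move=> hT; apply: is_adjoint_uniq; exact: adjP. Qed.

Lemma dotp_adjl T x y : bounded_op T -> dotp (adj T x) y = dotp x (T y).
Proof. by move=> hT; rewrite dotpC -adjP// -dotpC. Qed.

Lemma dotp_adjr T x y : bounded_op T -> dotp x (adj T y) = dotp (T x) y.
Proof. by move=> hT; rewrite -adjP. Qed.

Lemma adj_linear T : bounded_op T -> linear (adj T).
Proof.
move=> hT a u v; apply: dotp_inj => z.
by rewrite dotp_adjl// !dotpE !dotp_adjl.
Qed.

Lemma obd_adj T c : 0 <= c -> bounded_op T -> obd T c -> obd (adj T) c.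
Proof.
move=> c0 hT hc v; have [e|e] := eqVneq (nrm (adj T v)) 0.
  by rewrite e mulr_ge0 ?nrm_ge0.
have p : 0 < nrm (adj T v) by rewrite lt0r e nrm_ge0.
rewrite -(ler_pM2l p).
have := dotp_adjl v (adj T v) hT; rewrite dotpxx => /(congr1 (fun z : R[i] => nrm z)).
rewrite nrm_real ger0_norm ?sqr_ge0// expr2 => ->.
apply: le_trans (cauchy_schwarz _ _) _; rewrite mulrC mulrCA mulrA.
by rewrite ler_wpM2r ?nrm_ge0.
Qed.

Lemma bounded_op_adj T : bounded_op T -> bounded_op (adj T).
Proof.
move=> hT; have [c c0 hc] := bounded_op_obd hT.
by apply: (bounded_opI (adj_linear hT)); exact: obd_adj hc.
Qed.

Lemma adjK T : bounded_op T -> adj (adj T) = T.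
Proof.
move=> hT; apply: adjE; first exact: bounded_op_adj.
by move=> x y; rewrite dotp_adjl.
Qed.

Lemma adj_comp S T : bounded_op S -> bounded_op T ->
  adj (S \o T) = adj T \o adj S.
Proof.
move=> hS hT; apply: adjE; first exact: bounded_op_comp.
by move=> x y /=; rewrite !dotp_adjr.
Qed.

Lemma adjD S T : bounded_op S -> bounded_op T -> adj (S + T) = adj S + adj T.
Proof.
move=> hS hT; apply: adjE; first exact: bounded_opD.
by move=> x y; rewrite !fctE dotpDl dotpDr !dotp_adjr.
Qed.

Lemma adjZ (c : R[i]) T : bounded_op T -> adj (c *: T) = conjc c *: adj T.
Proof.
move=> hT; apply: adjE; first exact: bounded_opZ.
by move=> x y; rewrite !fctE/= dotpZl dotpZr conjcK !dotp_adjr.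
Qed.

Lemma adjN T : bounded_op T -> adj (- T) = - adj T.
Proof. by move=> h; rewrite -scaleN1r adjZ// rmorphN rmorph1 scaleN1r. Qed.

Lemma adjB S T : bounded_op S -> bounded_op T -> adj (S - T) = adj S - adj T.
Proof. by move=> hS hT; rewrite adjD ?adjN//; exact: bounded_opN. Qed.

Lemma positive_op_Re T x : positive_op T ->
  dotp (T x) x = (complex.Re (dotp (T x) x))%:C.
Proof. by case=> _ /(_ x) h; rewrite RRe_real// ger0_real. Qed.

Lemma positive_op_Re_ge0 T x : positive_op T -> 0 <= complex.Re (dotp (T x) x).
Proof. by move=> h; rewrite -ler0c -positive_op_Re//; apply h.2. Qed.

Lemma polarization (B : H -> H -> R[i]) x y :
  (forall a u v w, B (a *: u + v) w = a * B u w + B v w) ->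
  (forall a u v w, B w (a *: u + v) = conjc a * B w u + B w v) ->
  B x y = 4^-1 * (B (x + y) (x + y) - B (x - y) (x - y) +
    'i%C * B (x + 'i%C *: y) (x + 'i%C *: y) - 'i%C * B (x - 'i%C *: y) (x - 'i%C *: y)).
Proof.
move=> hl hr.
have Dl u v w : B (u + v) w = B u w + B v w by rewrite -[u in LHS]scale1r hl mul1r.
have Dr u v w : B w (u + v) = B w u + B w v.
  by rewrite -[u in LHS]scale1r hr rmorph1 mul1r.
have B0l w : B 0 w = 0.
  by apply: (@addrI _ (B 0 w)); rewrite -Dl !addr0.
have B0r w : B w 0 = 0.
  by apply: (@addrI _ (B w 0)); rewrite -Dr !addr0.
have Zl a u w : B (a *: u) w = a * B u w by rewrite -[_ *: _]addr0 hl B0l addr0.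
have Zr a u w : B w (a *: u) = conjc a * B w u by rewrite -[_ *: _]addr0 hr B0r addr0.
rewrite -(scaleN1r y) -(scaleN1r ('i%C *: y)) !scalerA !(Dl, Dr, Zl, Zr).
apply: (@mulfI _ 4); first by rewrite pnatr_eq0.
rewrite mulrA mulfV ?pnatr_eq0// mul1r.
have ii : 'i%C * 'i%C = -1 :> R[i] by rewrite -expr2 sqr_i.
have -> : conjc (-1) = -1 :> R[i] by rewrite rmorphN rmorph1.
have -> : conjc (-1 * 'i%C) = 'i%C :> R[i] by simpc.
have -> : conjc 'i%C = - 'i%C :> R[i] by simpc.
ring: ii.
Qed.

(** A sesquilinear form with real diagonal is hermitian: polarization writes both sides through the
    same four real diagonal values, after rotating the arguments by powers of i. *)
Lemma positive_op_sym T x y : positive_op T -> dotp (T x) y = dotp x (T y).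
Proof.
move=> hT; have [bT _] := hT.
rewrite [RHS]dotpC (polarization (B := fun x y => dotp (T x) y) x y); last 2 first.
- by move=> a u v w; rewrite opL// !dotpE.
- by move=> a u v w; rewrite !dotpE.
rewrite (polarization (B := fun x y => dotp (T x) y) y x); last 2 first.
- by move=> a u v w; rewrite opL// !dotpE.
- by move=> a u v w; rewrite !dotpE.
have sc (c : R[i]) u : nrm c = 1 -> dotp (T (c *: u)) (c *: u) = dotp (T u) u.
  move=> c1; rewrite opZ// dotpZl dotpZr mulrA -sqr_normc normr_nrm c1.
  by rewrite expr1n mul1r.
have -> : y + 'i%C *: x = 'i%C *: (x - 'i%C *: y).
  by rewrite scalerBr scalerA -expr2 sqr_i scaleN1r opprK addrC.
have -> : y - 'i%C *: x = (- 'i%C) *: (x + 'i%C *: y).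
  by rewrite scalerDr scalerA mulNr -expr2 sqr_i opprK scale1r addrC scaleNr.
have -> : y - x = (-1) *: (x - y) by rewrite scaleN1r opprB.
rewrite ![dotp (T (_ *: (_ - _))) _]sc ?nrmN ?nrmi ?nrm1// sc ?nrmN ?nrmi// (addrC y).
have P u := positive_op_Re u hT.
rewrite (P (x + y)) (P (x - y)) (P (x + 'i%C *: y)) (P (x - 'i%C *: y)).
move: (complex.Re _) (complex.Re _) (complex.Re _) (complex.Re _) => p q r s.
rewrite (_ : 4^-1 = (4^-1)%:C :> R[i]); last first.
  by rewrite -(realC_nat 4); rewrite fmorphV.
by apply/eqP; rewrite eq_complex/=; apply/andP; split; apply/eqP; ring.
Qed.

Lemma positive_op_adj T : positive_op T -> adj T = T.
Proof. by move=> h; apply: adjE; [case: h|move=> x y; rewrite positive_op_sym]. Qed.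


Lemma dotp_polar (u v : H) : dotp u v =
  (4^-1)%:C * ((nrm (u + v) ^+ 2)%:C - (nrm (u - v) ^+ 2)%:C +
    'i%C * (nrm (u + 'i%C *: v) ^+ 2)%:C - 'i%C * (nrm (u - 'i%C *: v) ^+ 2)%:C).
Proof.
rewrite (polarization (B := dotp)); last 2 first.
- by move=> *; rewrite !dotpE.
- by move=> *; rewrite !dotpE.
by rewrite !dotpxx -(realC_nat 4) -fmorphV.
Qed.


End Operators.

(** An antilinear isometry reverses the inner product. Only the four norms that enter polarization
    are compared, so this applies to the adjoint on bounded elements of L^2 as well as to [J]. *)
Lemma dotp_antiunitary (R : realType) (H H' : hilbertType R) (u v : H) (u' v' : H') :
  nrm (u' + v') = nrm (u + v) -> nrm (u' - v') = nrm (u - v) ->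
  nrm (u' + 'i%C *: v') = nrm (u - 'i%C *: v) ->
  nrm (u' - 'i%C *: v') = nrm (u + 'i%C *: v) -> dotp u' v' = dotp v u.
Proof.
have rot (x y : H) : nrm (x - 'i%C *: y) = nrm (y + 'i%C *: x).
  have -> : y + 'i%C *: x = 'i%C *: (x - 'i%C *: y).
    by rewrite scalerBr scalerA -expr2 sqr_i scaleN1r opprK addrC.
  by rewrite nrmZ nrmi mul1r.
move=> e1 e2 e3 e4; rewrite [LHS]dotp_polar [RHS]dotp_polar e1 e2 e3 e4.
by rewrite (rot u v) -(rot v u) (addrC v u) (nrmBC v u).
Qed.

(** * Square roots and resolvents of positive operators *)

Section OperatorLimits.
Context {R : realType} {H : hilbertType R}.
Implicit Types (S T : H -> H) (x y v : H).

(** Majorant method: a convergent real sequence t dominates the increments of X, which yields the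
    limit and the rate in operator norm together. It serves both the square root and the resolvent
    iteration. *)
Lemma op_limit (X : nat -> H -> H) (t : nat -> R) tl :
  (forall n, bounded_op (X n)) ->
  (forall n, obd (X n.+1 - X n) (t n.+1 - t n)) -> t @ \oo --> tl ->
  exists2 Y, bounded_op Y & forall n, obd (Y - X n) (tl - t n).
Proof.
move=> bX dX tX.
have dXm m n v : (n <= m)%N -> nrm (X m v - X n v) <= (t m - t n) * nrm v.
  elim: m => [|m IH]; first by rewrite leqn0 => /eqP ->; rewrite !subrr nrm0 mul0r.
  rewrite leq_eqVlt => /orP[/eqP ->|]; first by rewrite !subrr nrm0 mul0r.
  rewrite ltnS => /IH h; apply: le_trans (nrmB_le _ _ (X m v)) _.
  by have := dX m v; rewrite !fctE; move: h; lra.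
have lim v : exists l : H, X ^~ v @ \oo --> l.
  apply: cauchy_nrm => e e0.
  have v1 : 0 < nrm v + 1 by rewrite ltr_wpDl ?nrm_ge0.
  have e1 : 0 < e / (nrm v + 1) / 2 by rewrite !divr_gt0.
  have [N _ hN] := (cvgrPdist_lt _ _).1 tX _ e1.
  have key m n : (N <= n)%N -> (n <= m)%N -> nrm (X m v - X n v) < e.
    move=> Nn nm; apply: le_lt_trans (dXm _ _ _ nm) _.
    have := hN n Nn; have := hN m (leq_trans Nn nm) => /= h1 h2.
    have h3 : t m - t n <= e / (nrm v + 1).
      by move: h1 h2; rewrite !ltr_norml => /andP[? ?] /andP[? ?]; lra.
    apply: le_lt_trans (ler_wpM2r (nrm_ge0 _) h3) _.
    by rewrite mulrAC ltr_pdivrMr// ltr_pM2l// ltrDl.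
  exists N => m n Nm Nn; case: (leqP n m) => [nm|/ltnW mn]; first exact: key.
  by rewrite nrmBC; exact: key.
have /choice[Y hY] := lim.
have Yn n v : nrm (Y v - X n v) <= (tl - t n) * nrm v.
  have h1 : (fun m => nrm (X m v - X n v)) @ \oo --> nrm (Y v - X n v).
    by apply: cvg_nrm; apply: cvgB => //; exact: cvg_cst.
  have h2 : (fun m => (t m - t n) * nrm v) @ \oo --> (tl - t n) * nrm v.
    by apply: cvgM; [apply: cvgB => //|]; exact: cvg_cst.
  apply: (ler_cvg_to h1 h2); exists n => // m /= nm; exact: dXm.
have Yl : linear Y.
  move=> a u v; apply: (cvg_uniq (hY _)).
  under eq_fun do rewrite (opL _ _ _ (bX _)).
  by apply: cvgD => //; apply: cvgZ => //; exact: cvg_cst.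
exists Y => //; have [c c0 hc] := bounded_op_obd (bX 0%N).
apply: (bounded_opI (c := (tl - t 0%N) + c)) => // v.
rewrite -[Y v](subrK (X 0%N v)); apply: le_trans (nrmD _ _) _.
by rewrite mulrDl lerD.
Qed.

Lemma op_limit_cvg (X : nat -> H -> H) (t : nat -> R) tl Y :
  t @ \oo --> tl -> (forall n, obd (Y - X n) (tl - t n)) ->
  forall v, X ^~ v @ \oo --> Y v.
Proof.
move=> tX hY v.
apply: (@cvg_squeeze _ _ _ _ _ _ _ (fun n => (tl - t n) * nrm v)).
  by apply: nearW => n; rewrite nrmBC; exact: hY.
rewrite (_ : 0 = (tl - tl) * nrm v); last by rewrite subrr mul0r.
by apply: cvgM; [apply: cvgB => //|]; exact: cvg_cst.
Qed.

Lemma cvg_op {I : Type} {F : set_system I} {FF : Filter F} T (u : I -> H) l :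
  bounded_op T -> u @ F --> l -> T \o u @ F --> T l.
Proof. by move=> [_ hT] hu; apply: cvg_comp hu _; exact: hT. Qed.

Lemma positive_op_comp_sym S T : positive_op T -> bounded_op S ->
  (forall x y, dotp (S x) y = dotp x (S y)) -> positive_op (S \o T \o S).
Proof.
move=> hT bS hS; split.
  by apply: bounded_op_comp => //; apply: bounded_op_comp => //; case: hT.
by move=> x /=; rewrite hS; apply hT.2.
Qed.

(** [1 - T^2] is the sum of the positive operators [T (1 - T) T], [(1 - T) T (1 - T)] and [1 - T];
    these are [h1], [h2] and [h3] below. *)
Lemma positive_op_le1_obd T : positive_op T -> positive_op (id - T) -> obd T 1.
Proof.
move=> hT hT' v; rewrite mul1r; have bT := hT.1.
rewrite -(@ler_pXn2r _ 2)// ?nnegrE ?nrm_ge0//.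
rewrite -lecR -!dotpxx.
have s x y : dotp (T x) y = dotp x (T y) by exact: positive_op_sym.
have h1 := hT'.2 (T v); have h2 := hT.2 (v - T v); have h3 := hT'.2 v.
move: h1 h2 h3; rewrite !fctE/= !dotpBl !dotpBr !(opB _ _ bT) !dotpBl -!s.
move=> h1 h2 h3; rewrite -subr_ge0.
have := addr_ge0 (addr_ge0 h1 h2) h3.
set a := dotp v v; set b := dotp (T v) v; set c := dotp (T (T v)) v.
by set d := dotp (T (T (T v))) v; rewrite (_ : a - c = c - d + (b - c - (c - d)) + (a - b)) //; ring.
Qed.

(** * Square roots by a quadratic iteration *)

Section SquareRoot.
Variable A : H -> H.
Hypothesis bA : bounded_op A.
Hypothesis A1 : obd A 1.
Hypothesis As : forall x y, dotp (A x) y = dotp x (A y).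

Let half : R[i] := (2^-1)%:C.

(** A fixed point Y of Y = (A + Y^2)/2 satisfies (1 - Y)^2 = 1 - A, so A = 1 - T leads to a root of
    T. [sqrt_bound] is the same iteration for the scalar 1 and serves as majorant. *)
Fixpoint sqrt_iter n : H -> H :=
  if n is m.+1 then half *: (A + (sqrt_iter m \o sqrt_iter m)) else 0.

Fixpoint sqrt_bound n : R :=
  if n is m.+1 then 2^-1 * (1 + sqrt_bound m ^+ 2) else 0.

Local Notation X := sqrt_iter.
Local Notation t := sqrt_bound.

Lemma sqrt_iterS n v : X n.+1 v = half *: (A v + X n (X n v)).
Proof. by []. Qed.

Lemma sqrt_iterSD n v : X n.+1 v + X n.+1 v = A v + X n (X n v).
Proof.
rewrite sqrt_iterS -scalerDl /half -realCD (_ : _ + _ = 1) ?scale1r//.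
by field.
Qed.

Lemma sqrt_bound01 n : 0 <= t n <= 1.
Proof. by elim: n => [|n /andP[h1 h2]] /=; [rewrite lexx ler01|apply/andP; split; nra]. Qed.

Lemma sqrt_bound_nd n : t n <= t n.+1.
Proof.
elim: n => [|n IH]; first by rewrite /= expr0n/= addr0 mulr1 invr_ge0.
have /andP[h1 h2] := sqrt_bound01 n; have /andP[h3 h4] := sqrt_bound01 n.+1.
rewrite [leLHS]/= [leRHS]/= -/(t n.+1); move: (t n) (t n.+1) IH h1 h2 h3 h4 => a b; nra.
Qed.

Lemma bounded_sqrt_iter n : bounded_op (X n).
Proof.
elim: n => [|n IH]; first exact: bounded_op0.
by apply: bounded_opZ; apply: bounded_opD => //; exact: bounded_op_comp.
Qed.

Lemma nrm_half : nrm half = 2^-1.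
Proof. by rewrite /half nrm_real ger0_norm ?invr_ge0. Qed.

Lemma obd_sqrt_iter n : obd (X n) (t n).
Proof.
elim: n => [|n IH]; first by move=> v; rewrite [X 0 v]/(0 : H) nrm0 mul0r.
rewrite /= -nrm_half; apply: obdZ; apply: obdD => //.
by rewrite expr2; apply: obd_comp => //; case/andP: (sqrt_bound01 n).
Qed.

Lemma sqrt_iter_comm B n v : bounded_op B -> (forall v, B (A v) = A (B v)) ->
  B (X n v) = X n (B v).
Proof.
move=> bB hB; elim: n v => [v|n IH v]; first by rewrite [X 0 v]/(0 : H) (op0 bB).
by rewrite !sqrt_iterS (opZ _ _ bB) (opD _ _ bB) hB !IH.
Qed.

Lemma sqrt_iter_commX m n v : X m (X n v) = X n (X m v).
Proof.
apply: sqrt_iter_comm; first exact: bounded_sqrt_iter.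
by move=> w; symmetry; apply: sqrt_iter_comm.
Qed.

Lemma sqrt_iter_sym n x y : dotp (X n x) y = dotp x (X n y).
Proof.
elim: n x y => [x y|n IH x y]; first by rewrite ![X 0 _]/(0 : H) dotp0l dotp0r.
by rewrite !sqrt_iterS dotpZl dotpZr !dotpDl !dotpDr As !IH conjc_real.
Qed.

(** The iterates commute, so a difference of squares factors into difference times sum, and each
    factor is bounded by its scalar counterpart. *)
Lemma obd_sqrt_iterB n : obd (X n.+1 - X n) (t n.+1 - t n).
Proof.
elim: n => [|n IH v].
  have -> : X 1 - X 0 = X 1 by apply/funext => v; rewrite !fctE [X 0 v]/(0 : H) subr0.
  by rewrite subr0; exact: obd_sqrt_iter.
have /andP[t0 _] := sqrt_bound01 n; have /andP[t1 _] := sqrt_bound01 n.+1.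
rewrite !fctE [X n.+2 v]sqrt_iterS [X n.+1 v]sqrt_iterS -scalerBr opprD addrACA subrr add0r.
have -> : X n.+1 (X n.+1 v) - X n (X n v) = (X n.+1 - X n) ((X n.+1 + X n) v).
  rewrite !fctE (opD _ _ (bounded_sqrt_iter n.+1)) (opD _ _ (bounded_sqrt_iter n)).
  by rewrite (sqrt_iter_commX n n.+1) [in RHS]opprD addrACA addrA subrK.
rewrite nrmZ nrm_half; have h1 := IH ((X n.+1 + X n) v).
have h2 := obdD (obd_sqrt_iter n.+1) (obd_sqrt_iter n) v.
rewrite (_ : t n.+2 - t n.+1 = 2^-1 * ((t n.+1 - t n) * (t n.+1 + t n))); last first.
  by rewrite [t n.+2]/= -/(t n.+1) [X in _ - X]/=; field.
rewrite -!mulrA ler_wpM2l ?invr_ge0//; apply: le_trans h1 _.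
by rewrite ler_wpM2l// subr_ge0 sqrt_bound_nd.
Qed.

(** The commutation clause is inherited from the polynomial iterates. It later puts roots into M and
    makes them unique. *)
Lemma sqrt_fixpoint : exists Y, [/\ bounded_op Y, obd Y 1,
  forall x y, dotp (Y x) y = dotp x (Y y),
  (forall v, Y v + Y v = A v + Y (Y v)) &
  forall B, bounded_op B -> (forall v, B (A v) = A (B v)) ->
     forall v, B (Y v) = Y (B v)].
Proof.
have tc : cvgn t.
  apply: nondecreasing_is_cvgn.
    by apply/nondecreasing_seqP => n; exact: sqrt_bound_nd.
  by exists 1 => _ [n _ <-]; case/andP: (sqrt_bound01 n).
have [Y bY hY] := op_limit bounded_sqrt_iter obd_sqrt_iterB tc.
have cY := op_limit_cvg tc hY.
exists Y; split=> //.
- move=> v; rewrite mul1r; apply: (@cvg_nrm_le _ _ _ _ _ (X ^~ v) (Y v) (nrm v) _ (cY v)); apply: nearW => n.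
  apply: le_trans (obd_sqrt_iter n v) _; rewrite ler_piMl ?nrm_ge0//.
  by case/andP: (sqrt_bound01 n).
- move=> x y; apply: (@cvg_uniq _ R[i] _ \oo _ (fun n => dotp (X n x) y)).
    by apply: (@cvg_dotp _ _ _ _ _ (X ^~ x) (cst y)); [exact: cY|exact: cvg_cst].
  under eq_fun do rewrite sqrt_iter_sym.
  by apply: (@cvg_dotp _ _ _ _ _ (cst x) (X ^~ y)); [exact: cvg_cst|exact: cY].
- move=> v.
  have h1 : (fun n => X n.+1 v + X n.+1 v) @ \oo --> Y v + Y v.
    have h : (fun n => X n.+1 v) @ \oo --> Y v by apply: (@cvg_succ _ _ (X ^~ v)); exact: cY.
    exact: cvgD.
  apply: (cvg_uniq h1).
  under eq_fun do rewrite sqrt_iterSD.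
  apply: cvgD; first exact: cvg_cst.
  apply: (@cvg_squeeze _ _ _ _ _ _ _
     (fun n => nrm (X n v - Y v) + nrm (X n (Y v) - Y (Y v)))).
    apply: nearW => n; apply: le_trans (nrmB_le _ _ (X n (Y v))) _.
    rewrite lerD// -(opB _ _ (bounded_sqrt_iter n)).
    apply: le_trans (obd_sqrt_iter n _) _; rewrite ler_piMl ?nrm_ge0//.
    by case/andP: (sqrt_bound01 n).
  rewrite -[0](addr0 0); apply: cvgD; apply/cvg_nrmP; exact: cY.
- move=> B bB hB v; apply: (cvg_uniq (cvg_op bB (cY v))).
  have -> : B \o X ^~ v = (fun n => X n (B v)).
    by apply/funext => n /=; exact: sqrt_iter_comm.
  exact: cY.
Qed.

End SquareRoot.

Lemma positive_opZ (c : R) T : 0 <= c -> positive_op T -> positive_op (c%:C *: T).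
Proof.
move=> c0 hT; split; first by apply: bounded_opZ; case: hT.
by move=> x; rewrite !fctE dotpZl mulr_ge0 ?ler0c//; apply hT.2.
Qed.

Lemma positive_op_idB T : positive_op T -> obd T 1 -> positive_op (id - T).
Proof.
move=> hT T1; split; first by apply: bounded_opB; [exact: bounded_op_id|case: hT].
move=> x; rewrite !fctE/= dotpBl dotpxx positive_op_Re// -realCB ler0c subr_ge0.
apply: le_trans (Re_le_nrm _) _; apply: le_trans (cauchy_schwarz _ _) _.
by rewrite expr2 ler_wpM2r ?nrm_ge0// -[leRHS]mul1r.
Qed.

Lemma positive_op_sqrt T : positive_op T -> exists S, [/\ positive_op S,
  S \o S = T & forall B, bounded_op B -> (forall v, B (T v) = T (B v)) ->
     forall v, B (S v) = S (B v)].
Proof.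
move=> hT; have bT := hT.1; have [c0 c00 hc0] := bounded_op_obd bT.
(* T is scaled to a contraction; the summand 1 keeps the factor invertible when T = 0. *)
set c := c0 + 1; have c_gt0 : 0 < c by rewrite ltr_wpDl.
have hc : obd T c by apply: obd_le hc0; rewrite lerDl.
have ci : 0 <= c^-1 by rewrite invr_ge0 ltW.
set T' := c^-1%:C *: T.
have hT' : positive_op T' by exact: positive_opZ.
have T'1 : obd T' 1.
  by rewrite -[1](@mulVf _ c) ?gt_eqF// -{1}[c^-1]ger0_norm// -nrm_real; exact: obdZ.
set A := id - T'.
have hA : positive_op A by exact: positive_op_idB.
have A1 : obd A 1.
  apply: positive_op_le1_obd => //; rewrite (_ : id - A = T')//.
  by apply/funext => v; rewrite /A !fctE opprB addrCA subrr addr0.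
have [Y [bY Y1 Ys Yeq Yc]] := sqrt_fixpoint hA.1 A1 (fun x y => positive_op_sym x y hA).
have pS : positive_op (id - Y).
  split; first by apply: bounded_opB => //; exact: bounded_op_id.
  move=> x; rewrite !fctE/= dotpBl.
  have e : dotp (Y x) x = (complex.Re (dotp (Y x) x))%:C.
    have := Ys x x; rewrite [RHS]dotpC; case: (dotp (Y x) x) => a b [h].
    by apply/eqP; rewrite eq_complex/= eqxx/=; apply/eqP; lra.
  rewrite dotpxx e -realCB ler0c subr_ge0.
  apply: le_trans (Re_le_nrm _) _; apply: le_trans (cauchy_schwarz _ _) _.
  by rewrite expr2 ler_wpM2r ?nrm_ge0// -[leRHS]mul1r.
have SS v : (id - Y) ((id - Y) v) = T' v.
  rewrite !fctE/= (opB _ _ bY) -[X in X = _]addrA -opprD [X in v - X]addrA.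
  by rewrite Yeq addrK /A !fctE opprB addrCA subrr addr0.
set s := Num.sqrt c; have s0 : 0 <= s by rewrite sqrtr_ge0.
have Sc B : bounded_op B -> (forall v, B (T v) = T (B v)) ->
    forall v, B ((id - Y) v) = (id - Y) (B v).
  move=> bB hB v; rewrite !fctE/= (opB _ _ bB) Yc//.
  by move=> w; rewrite /A /T' !fctE/= (opB _ _ bB) (opZ _ _ bB) hB.
move: pS SS Sc; set S := id - Y => pS SS Sc.
exists (s%:C *: S); split.
- exact: positive_opZ.
- apply/funext => v; rewrite /= !fctE (opZ _ _ pS.1) SS /T' !fctE !scalerA -!realCM.
  by rewrite -[s * s]expr2 sqr_sqrtr ?(ltW c_gt0)// mulfV ?gt_eqF// scale1r.
- by move=> B bB hB v; rewrite !fctE (opZ _ _ bB) Sc.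
Qed.

Lemma positive_op_ker T x : positive_op T -> dotp (T x) x = 0 -> T x = 0.
Proof.
move=> hT; have [S [pS <- _]] := positive_op_sqrt hT.
rewrite /= positive_op_sym// dotpxx => -[/eqP]; rewrite sqrf_eq0 => /eqP/nrm_eq0 ->.
exact: op0 pS.1.
Qed.

(** For commuting roots, (S + P)(S - P) = 0. With w = (S - P) v this forces <S w, w> = <P w, w> = 0,
    then S w = P w = 0 and w = 0. In general S and P are both compared with the root from
    [positive_op_sqrt], which commutes with everything that commutes with the common square. *)
Lemma positive_op_sqrt_uniq S P : positive_op S -> positive_op P ->
  S \o S = P \o P -> S = P.
Proof.
suff key S' P' : positive_op S' -> positive_op P' -> S' \o S' = P' \o P' ->
    (forall v, S' (P' v) = P' (S' v)) -> S' = P'.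
  move=> hS hP e.
  have hT : positive_op (P \o P).
    split; first by apply: bounded_op_comp; case: hP.
    by move=> x /=; rewrite positive_op_sym// dotpxx ler0c sqr_ge0.
  have [Q [pQ QQ Qc]] := positive_op_sqrt hT.
  have e' v : S (S v) = P (P v) by exact: (congr1 (fun f => f v) e).
  transitivity Q.
    apply: key => //; first by rewrite QQ e.
    by apply: Qc => [|v /=]; [exact: hS.1|rewrite -!e'].
  apply/esym/key => //.
  by apply: Qc => //; exact: hP.1.
move=> hS hP e c; apply/funext => v; apply/eqP; rewrite -subr_eq0; apply/eqP.
have e' u : S' (S' u) = P' (P' u) by exact: (congr1 (fun f => f u) e).
set w := S' v - P' v.
have z : dotp (S' w) w + dotp (P' w) w = 0.
  rewrite -dotpDl /w (opB _ _ hS.1) (opB _ _ hP.1) e' c.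
  by rewrite addrA subrK subrr dotp0l.
have a1 := hS.2 w; have a2 := hP.2 w.
have /andP[/eqP z1 /eqP z2] : (dotp (S' w) w == 0) && (dotp (P' w) w == 0).
  by rewrite -paddr_eq0// z.
have := positive_op_ker hS z1; have := positive_op_ker hP z2 => w2 w1.
apply/nrm_eq0/eqP; rewrite -sqrf_eq0; apply/eqP/complexI; rewrite -dotpxx {1}/w.
by rewrite dotpBl !positive_op_sym// w1 w2 subrr.
Qed.

(** * Resolvents by a Neumann series *)

Section Resolvent.
Variables (P : H -> H) (delta r : R).
Hypothesis hP : positive_op P.
Hypothesis delta_gt0 : 0 < delta.
Hypothesis r_gt0 : 0 < r.
Hypothesis Pr : obd P r.

(** Neumann iteration for the inverse of delta + P = (delta + r) - (r - P). As 0 <= P <= r gives |r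
    - P| <= r, its ratio is r/(delta + r) < 1. The iterates are polynomials in P, which matters
    later for staying inside the Dirichlet algebra. *)
Fixpoint resolvent_iter n : H -> H :=
  if n is m.+1 then
    (delta + r)^-1%:C *: (id + (r%:C *: resolvent_iter m - (P \o resolvent_iter m)))
  else 0.

Local Notation Y := resolvent_iter.

Lemma resolvent_iterS n v :
  Y n.+1 v = (delta + r)^-1%:C *: (v + (r%:C *: Y n v - P (Y n v))).
Proof. by []. Qed.

Lemma bounded_resolvent_iter n : bounded_op (Y n).
Proof.
elim: n => [|n IH]; first exact: bounded_op0.
apply: bounded_opZ; apply: bounded_opD; first exact: bounded_op_id.
apply: bounded_opB; first exact: bounded_opZ.
by apply: bounded_op_comp => //; exact: hP.1.
Qed.

Lemma obd_rB v : nrm (r%:C *: v - P v) <= r * nrm v.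
Proof.
set T := r^-1%:C *: P.
have T1 : obd T 1.
  rewrite -[1](@mulVf _ r) ?gt_eqF// -{1}[r^-1]ger0_norm ?invr_ge0 ?ltW//.
  by rewrite -nrm_real; exact: obdZ.
have pT : positive_op T by apply: positive_opZ; rewrite // invr_ge0 ltW.
have h := positive_op_idB pT T1.
have h1 : obd (id - T) 1.
  apply: positive_op_le1_obd => //; rewrite (_ : id - _ = T)//.
  by apply/funext => u; rewrite !fctE opprB addrCA subrr addr0.
have -> : r%:C *: v - P v = r%:C *: ((id - T) v).
  rewrite /T !fctE/= scalerBr scalerA -realCM.
  by rewrite mulfV ?gt_eqF// scale1r.
rewrite nrmZ nrm_real (ger0_norm (ltW r_gt0)) ler_wpM2l// ?(ltW r_gt0)//.
by have := h1 v; rewrite mul1r.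
Qed.

Lemma resolvent_iter_lim : exists2 Q, bounded_op Q &
  exists2 e : nat -> R, e @ \oo --> (0 : R) & forall n, obd (Q - Y n) (e n).
Proof.
have dr : 0 < delta + r by rewrite addr_gt0.
set q := (delta + r)^-1 * r.
have q0 : 0 <= q by rewrite mulr_ge0 ?invr_ge0 ?ltW.
have q1 : q < 1 by rewrite /q mulrC ltr_pdivrMr// mul1r ltrDr.
(* Partial sums of the geometric series with first term 1/(delta + r) and ratio q, whose total is
   1/delta. *)
pose t n := delta^-1 * (1 - q ^+ n).
have tS n : t n.+1 - t n = (delta + r)^-1 * q ^+ n.
  rewrite /t exprS.
  have -> : (delta + r)^-1 = delta^-1 * (1 - q) by rewrite /q; field; rewrite !gt_eqF.
  ring.
have dY n : obd (Y n.+1 - Y n) (t n.+1 - t n).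
  elim: n => [v|n IH v].
    have Y0 u : Y 0 u = 0 by [].
    rewrite tS expr0 mulr1 !fctE [Y 1 v]resolvent_iterS !Y0 subr0.
    rewrite scaler0 (op0 hP.1) subr0 addr0 nrmZ nrm_real.
    by rewrite ger0_norm// invr_ge0 (ltW dr).
  rewrite !fctE [Y n.+2 v]resolvent_iterS [Y n.+1 v]resolvent_iterS -scalerBr.
  rewrite opprD addrACA subrr add0r.
  have -> : r%:C *: Y n.+1 v - P (Y n.+1 v) - (r%:C *: Y n v - P (Y n v)) =
     r%:C *: (Y n.+1 v - Y n v) - P (Y n.+1 v - Y n v).
    by rewrite scalerBr (opB _ _ hP.1) opprB [- (P _ - _)]opprB addrACA [in RHS]addrACA
      [X in _ = _ + X]addrC.
  rewrite nrmZ nrm_real ger0_norm ?invr_ge0 ?(ltW dr)//.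
  have -> : t n.+2 - t n.+1 = (delta + r)^-1 * (r * (t n.+1 - t n)).
    by rewrite !tS exprS /q; field; rewrite gt_eqF.
  rewrite -mulrA ler_wpM2l ?invr_ge0 ?(ltW dr)//; apply: le_trans (obd_rB _) _.
  by rewrite -mulrA ler_wpM2l ?(ltW r_gt0)//; exact: IH.
have tl : t @ \oo --> delta^-1.
  rewrite -[delta^-1 in X in _ --> X]mulr1 -[1 in X in _ --> X]subr0.
  apply: cvgM; first exact: cvg_cst; apply: cvgB; first exact: cvg_cst.
  by apply: cvg_expr; rewrite ger0_norm.
have [Q bQ hQ] := op_limit bounded_resolvent_iter dY tl.
exists Q => //; exists (fun n => delta^-1 - t n) => //.
by rewrite -(subrr delta^-1); apply: cvgB => //; exact: cvg_cst.
Qed.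

Lemma resolvent_iter_comm B n v : bounded_op B -> (forall v, B (P v) = P (B v)) ->
  B (Y n v) = Y n (B v).
Proof.
move=> bB hB; elim: n v => [v|n IH v]; first by rewrite [Y 0 v]/(0 : H) (op0 bB).
by rewrite !resolvent_iterS !(opE bB) hB !IH.
Qed.

End Resolvent.

Lemma resolvent_approx P (delta r : R) : positive_op P -> 0 < delta -> 0 < r -> obd P r ->
  exists Q, [/\ bounded_op Q,
    forall v, delta%:C *: Q v + P (Q v) = v,
    forall v, Q (delta%:C *: v + P v) = v,
    forall B, bounded_op B -> (forall v, B (P v) = P (B v)) ->
      forall v, B (Q v) = Q (B v) &
    exists2 e : nat -> R, e @ \oo --> (0 : R) &
      forall n, obd (Q - resolvent_iter P delta r n) (e n)].
Proof.
move=> hP d0 r0 Pr; have [Q bQ [e e0 he]] := resolvent_iter_lim hP d0 r0 Pr.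
have bY := bounded_resolvent_iter delta r hP.
have cQ v : (fun n => resolvent_iter P delta r n v) @ \oo --> Q v.
  apply: (@cvg_squeeze _ _ _ _ _ _ _ (fun n => e n * nrm v)).
    by apply: nearW => n; rewrite nrmBC; exact: he.
  by rewrite -[0](mul0r (nrm v)); apply: cvgM => //; exact: cvg_cst.
have Qc B : bounded_op B -> (forall v, B (P v) = P (B v)) ->
    forall v, B (Q v) = Q (B v).
  move=> bB hB v; apply: (cvg_uniq (cvg_op bB (cQ v))).
  have -> : B \o (fun n => resolvent_iter P delta r n v) =
      (fun n => resolvent_iter P delta r n (B v)).
    by apply/funext => n /=; exact: resolvent_iter_comm.
  exact: cQ.
have dr : delta + r != 0 by rewrite gt_eqF// addr_gt0.
have Qeq v : delta%:C *: Q v + P (Q v) = v.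
  have h1 : (fun n => resolvent_iter P delta r n.+1 v) @ \oo --> Q v.
    by apply: (@cvg_succ _ _ (fun n => resolvent_iter P delta r n v)); exact: cQ.
  have h2 : (fun n => resolvent_iter P delta r n.+1 v) @ \oo -->
      (delta + r)^-1%:C *: (v + (r%:C *: Q v - P (Q v))).
    under eq_fun do rewrite resolvent_iterS.
    apply: cvgZ; first exact: cvg_cst.
    apply: cvgD; first exact: cvg_cst.
    apply: cvgB; first by apply: cvgZ => //; exact: cvg_cst.
    exact: cvg_op hP.1 (cQ v).
  have e1 := cvg_uniq h1 h2.
  have e2 : (delta + r)%:C *: Q v = v + (r%:C *: Q v - P (Q v)).
    by rewrite {1}e1 scalerA -realCM mulfV// scale1r.
  apply: (@addIr _ (r%:C *: Q v - P (Q v))).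
  by rewrite -e2 addrACA subrr addr0 realCD scalerDl.
exists Q; split=> //; last by exists e.
(* Q commutes with delta + P, hence the right inverse is also a left inverse. *)
move=> v; have bB : bounded_op (delta%:C *: (id : H -> H) + P).
  by apply: bounded_opD; [apply: bounded_opZ; exact: bounded_op_id|exact: hP.1].
have h w : (delta%:C *: (id : H -> H) + P) (P w) = P ((delta%:C *: (id : H -> H) + P) w).
  by rewrite !fctE/= (opD _ _ hP.1) (opZ _ _ hP.1).
by have := Qc _ bB h v; rewrite !fctE/= Qeq => <-.
Qed.

End OperatorLimits.

(** * The trace and the duality between L^1 and M *)

Section VonNeumann.
Context {R : realType} {K : hilbertType R} (M : tracial_vNa K).
Implicit Types (S T : K -> K) (x y a : K -> K).

Lemma valg_bounded x : valg M x -> bounded_op x.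
Proof. by rewrite -valg_bicommutant => -[]. Qed.

Lemma valg_commutantP x : bounded_op x ->
  (forall S, bounded_op S -> (forall y, valg M y -> forall v, S (y v) = y (S v)) ->
    forall v, x (S v) = S (x v)) -> valg M x.
Proof.
move=> bx hx; rewrite -valg_bicommutant; split=> // S [bS hS].
apply/funext => v /=; apply: hx => // y hy w.
exact: (congr1 (fun f => f w) (hS _ hy)).
Qed.

(** The form in which the bicommutant is used: roots and resolvents of an element of M come with
    exactly this commutation property. *)
Lemma valg_double_comm x T : valg M T -> bounded_op x ->
  (forall B, bounded_op B -> (forall v, B (T v) = T (B v)) ->
    forall v, B (x v) = x (B v)) -> valg M x.
Proof.
move=> hT bx hx; apply: valg_commutantP => // S bS hS v.
by rewrite hx// => w; exact: hS.
Qed.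

Lemma valg_comp x y : valg M x -> valg M y -> valg M (x \o y).
Proof.
move=> hx hy; apply: valg_commutantP.
  by apply: bounded_op_comp; exact: valg_bounded.
by move=> S bS hS v /=; rewrite (hS _ hx) (hS _ hy).
Qed.

Lemma valgL (c : R[i]) x y : valg M x -> valg M y -> valg M (c *: x + y).
Proof.
move=> hx hy; apply: valg_commutantP.
  by apply: bounded_opD; [apply: bounded_opZ|]; exact: valg_bounded.
by move=> S bS hS v; rewrite !fctE/= (opD _ _ bS) (opZ _ _ bS) (hS _ hx) (hS _ hy).
Qed.

Lemma valg0 : valg M 0.
Proof.
apply: valg_commutantP; first exact: bounded_op0.
by move=> S bS _ v; rewrite ![(0 : K -> K) _]/(0 : K) (op0 bS).
Qed.

Lemma valgD x y : valg M x -> valg M y -> valg M (x + y).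
Proof. by move=> hx hy; rewrite -[x]scale1r; exact: valgL. Qed.

Lemma valgZ (c : R[i]) x : valg M x -> valg M (c *: x).
Proof. by move=> hx; rewrite -[_ *: _]addr0; apply: valgL => //; exact: valg0. Qed.

Lemma valgN x : valg M x -> valg M (- x).
Proof. by move=> hx; rewrite -scaleN1r; exact: valgZ. Qed.

Lemma valgB x y : valg M x -> valg M y -> valg M (x - y).
Proof. by move=> hx hy; apply: valgD => //; exact: valgN. Qed.

Lemma positive_opD S T : positive_op S -> positive_op T -> positive_op (S + T).
Proof.
move=> hS hT; split; first by apply: bounded_opD; [case: hS|case: hT].
by move=> x; rewrite !fctE dotpDl addr_ge0//; [apply hS.2|apply hT.2].
Qed.

Lemma positive_adj_comp x : bounded_op x -> positive_op (adj x \o x).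
Proof.
move=> bx; split; first by apply: bounded_op_comp => //; exact: bounded_op_adj.
by move=> v /=; rewrite dotp_adjl// dotpxx ler0c sqr_ge0.
Qed.

Lemma positive_part_adj_comp x : valg M x -> positive_part (valg M) (adj x \o x).
Proof.
move=> hx; split; first by apply: valg_comp => //; exact: valg_adj.
by apply: positive_adj_comp; exact: valg_bounded.
Qed.

Lemma vtrace_le x y : positive_part (valg M) x -> positive_part (valg M) y ->
  op_le x y -> (vtrace M x <= vtrace M y)%E.
Proof.
move=> hx hy hxy; have hd : positive_part (valg M) (y - x).
  by split=> //; apply: valgB; [case: hy|case: hx].
have -> : y = x + (y - x) by rewrite addrC subrK.
by rewrite vtraceD// leeDl// vtrace_ge0.
Qed.

Lemma op_leP x y : bounded_op x -> bounded_op y ->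
  (forall v, dotp (x v) v <= dotp (y v) v) -> op_le x y.
Proof.
move=> bx by_ h; split; first exact: bounded_opB.
by move=> v; rewrite !fctE dotpBl subr_ge0.
Qed.

Lemma positive_partD x y : positive_part (valg M) x -> positive_part (valg M) y ->
  positive_part (valg M) (x + y).
Proof.
by move=> [hx px] [hy py]; split; [exact: valgD|exact: positive_opD].
Qed.

Lemma positive_partZ (c : R) x : 0 <= c -> positive_part (valg M) x ->
  positive_part (valg M) (c%:C *: x).
Proof. by move=> c0 [hx px]; split; [exact: valgZ|exact: positive_opZ]. Qed.

Lemma L2_boundedZ (c : R[i]) x : L2_bounded M x -> L2_bounded M (c *: x).
Proof.
move=> [hx fx]; have bx := valg_bounded hx; split; first exact: valgZ.
have -> : adj (c *: x) \o (c *: x) = (nrm c ^+ 2)%:C *: (adj x \o x).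
  apply/funext => v; rewrite /= adjZ// !fctE/= (opZ _ _ (bounded_op_adj bx)) scalerA.
  by rewrite mulrC -sqr_normc normr_nrm rmorphXn.
rewrite vtraceZ ?sqr_ge0//; last exact: positive_part_adj_comp.
have := vtrace_ge0 (positive_part_adj_comp hx).
by move: fx; case: (vtrace M _) => // r _ _; rewrite -EFinM ltry.
Qed.

Lemma L2_boundedD x y : L2_bounded M x -> L2_bounded M y -> L2_bounded M (x + y).
Proof.
move=> [hx fx] [hy fy]; have bx := valg_bounded hx; have by_ := valg_bounded hy.
split; first exact: valgD.
have px := positive_part_adj_comp hx; have py := positive_part_adj_comp hy.
apply: (@le_lt_trans _ _ (vtrace M (2%:C *: ((adj x \o x) + (adj y \o y))))).
  apply: vtrace_le.
  - exact: positive_part_adj_comp (valgD hx hy).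
  - by apply: positive_partZ => //; exact: positive_partD.
  - apply: op_leP; first by apply: bounded_op_comp; [apply: bounded_op_adj|];
      exact: bounded_opD.
      apply: bounded_opZ; apply: bounded_opD; apply: bounded_op_comp => //;
      exact: bounded_op_adj.
    move=> v; rewrite /= !fctE/= dotp_adjl; last exact: bounded_opD.
    rewrite dotpxx dotpZl dotpDl !dotp_adjl// !dotpxx -realCD -realCM lecR.
    have := parallelogram (x v) (y v); have := sqr_ge0 (nrm (x v - y v)); lra.
rewrite vtraceZ//; last exact: positive_partD.
rewrite vtraceD//; have := vtrace_ge0 px; have := vtrace_ge0 py.
by move: fx fy; case: (vtrace M _) => // r _; case: (vtrace M _) => // s _ _ _;
  rewrite -EFinD -EFinM ltry.
Qed.

Lemma L2_bounded_adj x : L2_bounded M x -> L2_bounded M (adj x).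
Proof.
move=> [hx fx]; split; first exact: valg_adj.
by rewrite (adjK (valg_bounded hx)) -vtrace_tracial.
Qed.

Lemma L2_bounded_compl_le a x c : valg M a -> valg M x -> 0 <= c -> obd a c ->
  (vtrace M (adj (a \o x) \o (a \o x)) <= (c ^+ 2)%:E * vtrace M (adj x \o x))%E.
Proof.
move=> ha hx c0 hc; have ba := valg_bounded ha; have bx := valg_bounded hx.
have bax := bounded_op_comp ba bx.
rewrite -vtraceZ ?sqr_ge0//; last exact: positive_part_adj_comp.
apply: vtrace_le.
- by apply: positive_part_adj_comp; exact: valg_comp.
- by apply: positive_partZ; [exact: sqr_ge0|exact: positive_part_adj_comp].
apply: op_leP; first by apply: bounded_op_comp => //; exact: bounded_op_adj.
  by apply: bounded_opZ; apply: bounded_op_comp => //; exact: bounded_op_adj.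
move=> v; rewrite /= !fctE/= dotp_adjl// dotpZl dotp_adjl// !dotpxx -realCM lecR -exprMn.
by rewrite ler_pXn2r// ?nnegrE ?mulr_ge0 ?nrm_ge0//=.
Qed.

Lemma L2_bounded_compl a x : valg M a -> L2_bounded M x -> L2_bounded M (a \o x).
Proof.
move=> ha [hx fx]; split; first exact: valg_comp.
have [c c0 hc] := bounded_op_obd (valg_bounded ha).
apply: le_lt_trans (L2_bounded_compl_le ha hx c0 hc) _.
have := vtrace_ge0 (positive_part_adj_comp hx).
by move: fx; case: (vtrace M _) => // r _ _; rewrite -EFinM ltry.
Qed.

Lemma L2_bounded_compr a x : valg M a -> L2_bounded M x -> L2_bounded M (x \o a).
Proof.
move=> ha hx; have ba := valg_bounded ha; have bx := valg_bounded hx.1.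
rewrite -(adjK (bounded_op_comp bx ba)) adj_comp//.
by apply/L2_bounded_adj/L2_bounded_compl; [exact: valg_adj|exact: L2_bounded_adj].
Qed.

Lemma L2_boundedN x : L2_bounded M x -> L2_bounded M (- x).
Proof. by move=> hx; rewrite -scaleN1r; exact: L2_boundedZ. Qed.

Lemma L2_boundedB x y : L2_bounded M x -> L2_bounded M y -> L2_bounded M (x - y).
Proof. by move=> hx hy; apply: L2_boundedD => //; exact: L2_boundedN. Qed.

Lemma positive_part0 : positive_part (valg M) 0.
Proof.
split; first exact: valg0.
split; first exact: bounded_op0.
by move=> v; rewrite [(0 : K -> K) v]/(0 : K) dotp0l.
Qed.

Lemma vtrace0 : vtrace M 0 = 0%E.
Proof. by have := vtraceZ (lexx 0) positive_part0; rewrite scaler0 mul0e. Qed.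

Lemma fin_pos0 : fin_pos M 0.
Proof. by split; [exact: positive_part0|rewrite vtrace0 ltry]. Qed.

Lemma fin_pos_fine p : fin_pos M p -> vtrace M p = (fine (vtrace M p))%:E.
Proof.
by move=> [pp fp]; rewrite fineK// ge0_fin_numE// vtrace_ge0.
Qed.

Lemma fin_posD p q : fin_pos M p -> fin_pos M q ->
  fine (vtrace M (p + q)) = fine (vtrace M p) + fine (vtrace M q).
Proof.
move=> hp hq; rewrite vtraceD//; [|by case: hp|by case: hq].
by rewrite (fin_pos_fine hp) (fin_pos_fine hq) -EFinD.
Qed.

(** The decomposition chosen by [trace_lin] is arbitrary. Comparing p with its adjoint gives q1 =
    q2, and then p + p2 = p1 fixes the value by additivity of the trace. *)
Lemma trace_lin_pos p : fin_pos M p -> trace_lin M p = (fine (vtrace M p))%:C.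
Proof.
move=> hp; rewrite /trace_lin; set Q := [set w | _].
have Qp : Q (fine (vtrace M p))%:C.
  exists p, 0, 0, 0; split; first by split => //; exact: fin_pos0.
    by rewrite !subr0 scaler0 addr0.
  by rewrite vtrace0 /= subr0 subrr.
have := @xgetPex _ (0 : R[i]) Q (ex_intro _ _ Qp).
move: (xget 0 Q) => w [p1 [p2 [q1 [q2 [[h1 h2 h3 h4] e ->]]]]].
have sa q : fin_pos M q -> adj q = q by move=> [[_ hq] _]; exact: positive_op_adj.
have bd q : fin_pos M q -> bounded_op q by move=> [[_ [hq _]] _].
have e' : p = p1 - p2 - 'i%C *: (q1 - q2).
  rewrite -(sa _ hp) e adjD; [|by apply: bounded_opB; exact: bd|
    by apply: bounded_opZ; apply: bounded_opB; exact: bd].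
  rewrite adjZ ?(adjB (bd _ h1) (bd _ h2)); last by apply: bounded_opB; exact: bd.
  rewrite (adjB (bd _ h3) (bd _ h4)) !sa// -complexiE.
  by rewrite (_ : conjc 'i%C = - 'i%C) ?scaleNr//; simpc.
have qe : q1 = q2.
  apply/eqP; rewrite -subr_eq0; apply/eqP.
  have : 'i%C *: (q1 - q2) + 'i%C *: (q1 - q2) = 0.
    have := e; rewrite {1}e' -complexiE => /addrI/esym h.
    by rewrite {1}h addNr.
  rewrite -mulr2n -(scaler_nat 2) scalerA => /eqP; rewrite scaler_eq0.
  have i0 : 'i%C != 0 :> R[i].
    by apply/eqP => /(congr1 (@complex.Im R))/= /eqP; rewrite oner_eq0.
  by rewrite mulf_eq0 pnatr_eq0 (negbTE i0)/= => /eqP.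
have pe : p + p2 = p1 by rewrite e qe subrr scaler0 addr0 subrK.
rewrite qe subrr; congr Complex.
by rewrite -pe fin_posD// addrK.
Qed.

Definition is_resolvent (P : K -> K) (delta : R) (Q : K -> K) :=
  [/\ positive_op Q, forall v, delta%:C *: Q v + P (Q v) = v,
    forall v, Q (delta%:C *: v + P v) = v &
    forall B : K -> K, bounded_op B -> (forall v, B (P v) = P (B v)) ->
      forall v, B (Q v) = Q (B v)].

(** Expand |v|^2 = |delta Q v + P Q v|^2: the cross term is nonnegative because P is positive, so
    each square is at most |v|^2. *)
Lemma resolvent_bounds (P : K -> K) delta (Q : K -> K) : positive_op P -> 0 < delta ->
  (forall v, delta%:C *: Q v + P (Q v) = v) ->
  forall v, nrm (P (Q v)) <= nrm v /\ delta * nrm (Q v) <= nrm v.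
Proof.
move=> pP d0 Q1 v; have p0 := mulr_ge0 (ltW d0) (positive_op_Re_ge0 (Q v) pP).
have e : nrm v ^+ 2 = (delta * nrm (Q v)) ^+ 2 + nrm (P (Q v)) ^+ 2 +
    2 * (delta * complex.Re (dotp (P (Q v)) (Q v))).
  rewrite -[in LHS](Q1 v) nrmD2 nrmZ nrm_real (ger0_norm (ltW d0)) dotpZl.
  by rewrite -(positive_op_sym (Q v) _ pP) {1}(positive_op_Re _ pP) -realCM.
have h1 := sqr_ge0 (delta * nrm (Q v)); have h2 := sqr_ge0 (nrm (P (Q v))).
split; rewrite -(@ler_pXn2r _ 2)// ?nnegrE ?mulr_ge0 ?nrm_ge0 ?(ltW d0)//; lra.
Qed.

Lemma resolvent_spec (P : K -> K) delta : positive_op P -> 0 < delta ->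
  exists Q, is_resolvent P delta Q.
Proof.
move=> pP d0; have [c c0 hc] := bounded_op_obd pP.1.
have c1 : 0 < c + 1 by rewrite ltr_wpDl.
have hc1 : obd P (c + 1) by apply: obd_le hc; rewrite lerDl.
have [Q [bQ Q1 Q2 Qc _]] := resolvent_approx pP d0 c1 hc1.
exists Q; split=> //; split=> // v.
rewrite -[v in dotp _ v]Q1 dotpDr dotpZr conjc_real dotpxx -(positive_op_sym _ _ pP).
by rewrite addr_ge0 ?mulr_ge0 ?ler0c ?(ltW d0) ?sqr_ge0//; exact: pP.2.
Qed.

(** * Bounded elements of L^2, and the L^1 norm by duality *)

Section L2.
Variable V : L2_completion M.
Local Notation emb := (L2_emb V).
Local Notation N := (L2_bounded M).

Lemma embL (c : R[i]) x y : N x -> N y -> emb (c *: x + y) = c *: emb x + emb y.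
Proof. exact: L2_emb_linear. Qed.

Lemma embD x y : N x -> N y -> emb (x + y) = emb x + emb y.
Proof. by move=> hx hy; rewrite -[x in LHS]scale1r embL// scale1r. Qed.

Lemma embN x : N x -> emb (- x) = - emb x.
Proof.
move=> hx; have := embL (-1) hx hx; rewrite !scaleN1r addNr => e0.
have := embL (-1) hx (L2_boundedD hx (L2_boundedN hx)).
by rewrite !scaleN1r subrr addr0 e0 addNr addr0.
Qed.

Lemma embB x y : N x -> N y -> emb (x - y) = emb x - emb y.
Proof. by move=> hx hy; rewrite embD ?embN//; exact: L2_boundedN. Qed.

Lemma embZ (c : R[i]) x : N x -> emb (c *: x) = c *: emb x.
Proof.
move=> hx; have h0 := L2_boundedD hx (L2_boundedN hx).
rewrite -[_ *: x]addr0 -(subrr x) embL// embD//; last exact: L2_boundedN.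
by rewrite embN// subrr addr0.
Qed.

Lemma nrm_emb x : N x -> nrm (emb x) ^+ 2 = fine (vtrace M (adj x \o x)).
Proof.
move=> hx; apply: complexI; rewrite -dotpxx L2_emb_dotp//.
by rewrite trace_lin_pos//; split; [apply: positive_part_adj_comp|]; case: hx.
Qed.

Lemma vtrace_emb x : N x -> vtrace M (adj x \o x) = (nrm (emb x) ^+ 2)%:E.
Proof.
move=> hx; rewrite nrm_emb// -fin_pos_fine//.
by split; [apply: positive_part_adj_comp|]; case: hx.
Qed.

Lemma nrm_emb_adj x : N x -> nrm (emb (adj x)) = nrm (emb x).
Proof.
move=> hx; apply/eqP; rewrite -(@eqrXn2 _ 2)// ?nrm_ge0//; apply/eqP.
rewrite !nrm_emb//; last exact: L2_bounded_adj.
by rewrite (adjK (valg_bounded hx.1)) (vtrace_tracial hx.1).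
Qed.

Lemma dotp_emb_adj x y : N x -> N y ->
  dotp (emb (adj x)) (emb (adj y)) = dotp (emb y) (emb x).
Proof.
move=> hx hy; have bx := valg_bounded hx.1; have by_ := valg_bounded hy.1.
have hx' := L2_bounded_adj hx; have hy' := L2_bounded_adj hy.
have iZ z : N z -> N ('i%C *: z) by exact: L2_boundedZ.
have ci : conjc 'i%C = - 'i%C :> R[i] by simpc.
apply: dotp_antiunitary.
- by rewrite -embD// -adjD// nrm_emb_adj ?embD//; exact: L2_boundedD.
- by rewrite -embB// -adjB// nrm_emb_adj ?embB//; exact: L2_boundedB.
- have -> : emb (adj x) + 'i%C *: emb (adj y) = emb (adj (x - 'i%C *: y)).
    rewrite (adjB bx (bounded_opZ _ by_)) (adjZ _ by_) ci scaleNr opprK.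
    by rewrite (embD hx' (iZ _ hy')) (embZ _ hy').
  by rewrite nrm_emb_adj ?(embB hx (iZ _ hy)) ?(embZ _ hy)//;
    apply: L2_boundedB => //; exact: iZ.
- have -> : emb (adj x) - 'i%C *: emb (adj y) = emb (adj (x + 'i%C *: y)).
    rewrite (adjD bx (bounded_opZ _ by_)) (adjZ _ by_) ci scaleNr.
    by rewrite (embB hx' (iZ _ hy')) (embZ _ hy').
  by rewrite nrm_emb_adj ?(embD hx (iZ _ hy)) ?(embZ _ hy)//;
    apply: L2_boundedD => //; exact: iZ.
Qed.

Lemma dotp_emb_compl a x y : valg M a -> N x -> N y ->
  dotp (emb (a \o x)) (emb y) = dotp (emb x) (emb (adj a \o y)).
Proof.
move=> ha hx hy; have ba := valg_bounded ha; have by_ := valg_bounded hy.1.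
rewrite !L2_emb_dotp//; first last.
- exact: L2_bounded_compl.
- by apply: L2_bounded_compl => //; exact: valg_adj.
by rewrite adj_comp ?adjK//; exact: bounded_op_adj.
Qed.

(** Traciality enters as the antiunitarity of the adjoint on L^2, which turns right multiplication
    into left multiplication. *)
Lemma dotp_emb_compr a x y : valg M a -> N x -> N y ->
  dotp (emb (x \o a)) (emb y) = dotp (emb x) (emb (y \o adj a)).
Proof.
move=> ha hx hy; have ba := valg_bounded ha.
have bx := valg_bounded hx.1; have by_ := valg_bounded hy.1.
have ha' := valg_adj ha.
have hx' := L2_bounded_adj hx; have hy' := L2_bounded_adj hy.
rewrite -dotp_emb_adj//; last exact: L2_bounded_compr.
rewrite adj_comp// dotpC dotp_emb_compl// adjK// -dotpC.
rewrite (_ : a \o adj y = adj (y \o adj a)); last first.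
  by rewrite adj_comp ?adjK//; exact: bounded_op_adj.
by rewrite dotp_emb_adj//; exact: L2_bounded_compr.
Qed.

Lemma nrm_emb_compl a x c : valg M a -> N x -> 0 <= c -> obd a c ->
  nrm (emb (a \o x)) <= c * nrm (emb x).
Proof.
move=> ha hx c0 hc; rewrite -(@ler_pXn2r _ 2)// ?nnegrE ?mulr_ge0 ?nrm_ge0//.
have := L2_bounded_compl_le ha hx.1 c0 hc.
rewrite vtrace_emb; last exact: L2_bounded_compl.
by rewrite vtrace_emb// -EFinM lee_fin exprMn.
Qed.

Lemma nrm_emb_compr a x c : valg M a -> N x -> 0 <= c -> obd a c ->
  nrm (emb (x \o a)) <= c * nrm (emb x).
Proof.
move=> ha hx c0 hc; have ba := valg_bounded ha; have bx := valg_bounded hx.1.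
rewrite -nrm_emb_adj; last exact: L2_bounded_compr.
rewrite adj_comp// -(nrm_emb_adj hx).
apply: nrm_emb_compl => //; [exact: valg_adj|exact: L2_bounded_adj|exact: obd_adj].
Qed.

Lemma op_abs_spec y : valg M y -> [/\ positive_op (op_abs y),
  op_abs y \o op_abs y = adj y \o y & valg M (op_abs y)].
Proof.
move=> hy; have hyy := positive_part_adj_comp hy.
have [S [pS SS Sc]] := positive_op_sqrt hyy.2.
have [p1 p2] : positive_op (op_abs y) /\ op_abs y \o op_abs y = adj y \o y.
  exact: (@xgetPex _ (0 : K -> K)
    [set P | positive_op P /\ P \o P = adj y \o y] (ex_intro _ S (conj pS SS))).
split => //; rewrite (_ : op_abs y = S).
  by apply: (valg_double_comm hyy.1 pS.1).
by apply: positive_op_sqrt_uniq => //; rewrite SS p2.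
Qed.

Lemma nrm_op_abs y v : valg M y -> nrm (y v) = nrm (op_abs y v).
Proof.
move=> hy; have by_ := valg_bounded hy; have [pP PP _] := op_abs_spec hy.
apply/eqP; rewrite -(@eqrXn2 _ 2)// ?nrm_ge0//; apply/eqP/complexI.
rewrite -!dotpxx -(dotp_adjl (y v) v by_) -(positive_op_sym (op_abs y v) v pP).
by congr dotp; rewrite -[RHS]/((op_abs y \o op_abs y) v) PP.
Qed.

(* By duality this means tau(|y|) <= e: see [op_abs_l1_bound] and
   [l1_bound_op_abs]. *)
Definition l1_bound y (e : R) := N y /\ forall x c, N x -> 0 <= c -> obd x c ->
  nrm (dotp (emb y) (emb x)) <= c * e.

(** With P = |y| and r its square root, w = y (delta + r)^-1 stands for u r, where y = u P would be
    the polar decomposition. Since |y v| = |P v|, it satisfies w^* w <= P, so |w|_2^2 <= e. In y =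
    delta w + w r, the pairing of w r with x is that of r with w^* x, at most d |r|_2 |w|_2 <= d e;
    the first summand vanishes with delta. *)
Lemma op_abs_l1_bound y e : valg M y -> (vtrace M (op_abs y) <= e%:E)%E -> l1_bound y e.
Proof.
move=> hy te; have by_ := valg_bounded hy; have [pP PP hP] := op_abs_spec hy.
set P := op_abs y in te pP PP hP.
have pPM : positive_part (valg M) P by [].
have [r [pr rr rc]] := positive_op_sqrt pP.
have hr : valg M r := valg_double_comm hP pr.1 rc.
have rr' v : r (r v) = P v by rewrite -rr.
have br := pr.1.
have Nr : N r.
  by split=> //; rewrite positive_op_adj// rr (le_lt_trans te)// ltry.
have er : nrm (emb r) ^+ 2 = fine (vtrace M P).
  by rewrite nrm_emb// positive_op_adj// rr.
have te' : nrm (emb r) ^+ 2 <= e.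
  rewrite er -lee_fin -fin_pos_fine//; split => //; exact: le_lt_trans te (ltry _).
have PPv v : P (P v) = adj y (y v) by exact: (congr1 (fun f => f v) PP).
have yP v : nrm (y v) = nrm (P v) := nrm_op_abs v hy.
have [c c0 hc] := bounded_op_obd br.
split.
  split => //; rewrite -PP.
  apply: (@le_lt_trans _ _ (vtrace M ((c ^+ 2)%:C *: P))).
    apply: vtrace_le; first by rewrite PP; exact: positive_part_adj_comp.
      by apply: positive_partZ => //; exact: sqr_ge0.
    apply: op_leP; [by apply: bounded_op_comp; case: pP|by apply: bounded_opZ; case: pP|].
    move=> v; rewrite /= !fctE dotpZl positive_op_sym// dotpxx -!rr' (positive_op_sym _ v pr).
    rewrite dotpxx -realCM lecR -exprMn ler_pXn2r ?nnegrE ?mulr_ge0 ?nrm_ge0//.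
  rewrite vtraceZ ?sqr_ge0// (fin_pos_fine (p := P)) -?EFinM ?ltry//.
  by split => //; exact: le_lt_trans te (ltry _).
have e0 : 0 <= e by apply: le_trans te'; exact: sqr_ge0.
move=> x d Nx d0 hd; apply/ler_addgt0Pr => eps eps0.
(* e + 1 bounds |w|_2, whose square is at most e; hence delta = eps/L makes the error from delta w
   at most eps. The last 1 keeps L positive. *)
set L := (e + 1) * nrm (emb x) + 1.
have L0 : 0 < L by rewrite ltr_wpDl// mulr_ge0 ?nrm_ge0// addr_ge0.
set delta := eps / L; have delta0 : 0 < delta by rewrite divr_gt0.
have [Q [pQ Q1 Q2 Qc]] := resolvent_spec pr delta0.
have hQ : valg M Q by apply: (valg_double_comm hr pQ.1).
set w := y \o Q; have hw : valg M w by exact: valg_comp.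
have bw := valg_bounded hw.
have wle v : nrm (w v) <= nrm (r v).
  rewrite /w /= yP -rr' (Qc _ br)//; have [+ _] := resolvent_bounds pr delta0 Q1 (r v).
  by [].
have wP : op_le (adj w \o w) P.
  apply: op_leP; [by apply: bounded_op_comp => //; exact: bounded_op_adj|by case: pP|].
  move=> v; rewrite /= dotp_adjl// -rr' (positive_op_sym _ _ pr) !dotpxx lecR.
  by rewrite ler_pXn2r ?nnegrE ?nrm_ge0.
have tw := vtrace_le (positive_part_adj_comp hw) pPM wP.
have Nw : N w by split=> //; apply: le_lt_trans tw _; exact: le_lt_trans te (ltry _).
have ew : nrm (emb w) ^+ 2 <= e.
  by rewrite -lee_fin -vtrace_emb//; exact: le_trans tw te.
have -> : y = delta%:C *: w + (w \o r).
  apply/funext => v; rewrite /w !fctE/= -(opZ _ _ by_) -(opD _ _ by_) -(opZ _ _ pQ.1).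
  by rewrite -(opD _ _ pQ.1) Q2.
rewrite embD; [|exact: L2_boundedZ|exact: L2_bounded_compr].
rewrite embZ// dotpDl addrC; apply: le_trans (nrmD _ _) _; apply: lerD.
  rewrite dotp_emb_compl//; apply: le_trans (cauchy_schwarz _ _) _.
  have h : nrm (emb (adj w \o x)) <= d * nrm (emb w).
    have bx := valg_bounded Nx.1.
    have hx' := valg_adj Nx.1.
    rewrite -nrm_emb_adj; last by apply: L2_bounded_compl => //; exact: valg_adj.
    rewrite adj_comp ?adjK//; last exact: bounded_op_adj.
    by apply: nrm_emb_compl => //; exact: obd_adj.
  apply: le_trans (ler_wpM2l (nrm_ge0 _) h) _; rewrite mulrCA ler_wpM2l//.
  have := sqr_ge0 (nrm (emb r) - nrm (emb w)); move: te' ew; nra.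
rewrite dotpZl nrmM nrm_real ger0_norm ?(ltW delta0)//.
apply: (@le_trans _ _ (delta * ((e + 1) * nrm (emb x)))).
  rewrite ler_wpM2l ?(ltW delta0)//; apply: le_trans (cauchy_schwarz _ _) _.
  rewrite ler_wpM2r ?nrm_ge0//; have := sqr_ge0 (nrm (emb w) - 1); move: ew; nra.
rewrite /delta mulrAC ler_pdivrMr// ler_wpM2l ?(ltW eps0)// /L lerDl//.
Qed.

(** With P = |y| and Q = (delta + P)^-1, the element x = y Q is a contraction and x^* y = P Q P, so
    the hypothesis bounds tau(P Q P) by e. These operators increase to P as delta decreases, because
    P - P Q P = delta P Q with 0 <= P Q <= 1, and normality of the trace passes to the supremum. *)
Lemma l1_bound_op_abs y e : l1_bound y e -> (vtrace M (op_abs y) <= e%:E)%E.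
Proof.
move=> [Ny hye]; have hy := Ny.1; have by_ := valg_bounded hy.
have [pP PP hP] := op_abs_spec hy.
set P := op_abs y in pP PP hP *.
have pPM : positive_part (valg M) P by [].
have PPv v : P (P v) = adj y (y v) by exact: (congr1 (fun f => f v) PP).
pose A := [set B | exists delta Q, [/\ 0 < delta, is_resolvent P delta Q, valg M Q &
  B = P \o Q \o P]].
have PQ delta Q v : is_resolvent P delta Q -> P (Q v) = Q (P v).
  by move=> [pQ _ _ Qc]; apply: Qc => //; exact: pP.1.
have dB delta Q v : is_resolvent P delta Q ->
    dotp ((P \o Q \o P) v) v = dotp (P v) v - delta%:C * dotp (P (Q v)) v.
  move=> hQ; have [pQ Q1 _ _] := hQ.
  have -> : (P \o Q \o P) v = P v - delta%:C *: P (Q v).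
    rewrite /= -(PQ _ _ _ hQ) -{2}(Q1 v) (opD _ _ pP.1) (opZ _ _ pP.1).
    by rewrite addrC addKr.
  by rewrite dotpBl dotpZl.
have dPQ delta Q v : 0 < delta -> is_resolvent P delta Q ->
    0 <= complex.Re (dotp (P (Q v)) v) <= nrm v ^+ 2 /\
    dotp (P (Q v)) v = (complex.Re (dotp (P (Q v)) v))%:C.
  move=> d0 [pQ Q1 _ _]; set w := Q v.
  have eqw : dotp (P w) v = (delta * complex.Re (dotp (P w) w) + nrm (P w) ^+ 2)%:C.
    rewrite -[v in LHS]Q1 dotpDr dotpZr conjc_real dotpxx (positive_op_Re _ pP).
    by rewrite realCD !realCM /=.
  rewrite eqw/=; split=> //; have := positive_op_Re_ge0 w pP => p0.
  have d1 := mulr_ge0 (ltW d0) p0.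
  rewrite addr_ge0 ?sqr_ge0//= -(Q1 v) nrmD2 nrmZ nrm_real exprMn dotpZl.
  rewrite (_ : complex.Re (delta%:C * dotp (Q v) (P (Q v))) =
     delta * complex.Re (dotp (P w) w)); last first.
    by rewrite -positive_op_sym// -/w (positive_op_Re _ pP) -realCM.
  by have := mulr_ge0 (sqr_ge0 `|delta|) (sqr_ge0 (nrm (Q v))); move: d1; lra.
have Apos B : A B -> positive_part (valg M) B.
  move=> [delta [Q [d0 [pQ _ _ _] hQ ->]]]; split.
    by apply: valg_comp => //; exact: valg_comp.
  apply: positive_op_comp_sym => //; first by case: pP.
  by move=> *; exact: positive_op_sym.
have AleP B : A B -> op_le B P.
  move=> AB; have [_ [bB _]] := Apos _ AB.
  apply: op_leP => //; first by case: pP.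
  case: AB => delta [Q [d0 hQ _ ->]] v; rewrite (dB _ _ v hQ).
  have [/andP[h _] ->] := dPQ _ _ v d0 hQ.
  by rewrite -realCM lerBlDr lerDl ler0c mulr_ge0 ?(ltW d0).
have bPQP Q : bounded_op Q -> bounded_op (P \o Q \o P).
  by move=> bQ; exact: bounded_op_comp (bounded_op_comp pP.1 bQ) pP.1.
have Amono d1 d2 Q1 Q2 : 0 < d1 -> d1 <= d2 -> is_resolvent P d1 Q1 ->
    is_resolvent P d2 Q2 -> op_le (P \o Q2 \o P) (P \o Q1 \o P).
  move=> d10 d12 [pQ1 e1 e1' c1] [pQ2 e2 e2' c2].
  apply: op_leP; [exact: bPQP pQ2.1|exact: bPQP pQ1.1|].
  move=> v; rewrite /= !(positive_op_sym (_ (P v)) v pP); set u := P v.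
  rewrite -subr_ge0 -dotpBl.
  set w := Q2 u; set a := Q1 w.
  (* Resolvent identity Q1 - Q2 = (d2 - d1) Q1 Q2. For a = Q1 Q2 u, writing u = (d2 + P)(d1 + P) a
     makes <a, u> a sum of nonnegative terms. *)
  have -> : Q1 u - w = (d2 - d1)%:C *: a.
    rewrite -{1}(e2 u) -/w.
    have -> : d2%:C *: w + P w = (d1%:C *: w + P w) + (d2 - d1)%:C *: w.
      by rewrite addrAC -scalerDl -realCD addrCA subrr addr0.
    by rewrite (opD _ _ pQ1.1) e1' (opZ _ _ pQ1.1) addrAC subrr add0r.
  rewrite dotpZl mulr_ge0 ?ler0c ?subr_ge0//.
  have d20 := lt_le_trans d10 d12.
  have qE := positive_op_Re a pP; have := positive_op_Re_ge0 a pP.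
  move: (complex.Re _) qE => q qE q0.
  have h1 : dotp a w = (d1 * nrm a ^+ 2 + q)%:C.
    rewrite -[w in LHS](e1 w) -/a dotpDr dotpZr conjc_real dotpxx.
    by rewrite -(positive_op_sym a a pP) qE realCD !realCM.
  have h2 : dotp (P a) w = (d1 * q + nrm (P a) ^+ 2)%:C.
    rewrite -[w in LHS](e1 w) -/a dotpDr dotpZr conjc_real dotpxx.
    by rewrite qE realCD !realCM.
  rewrite -(e2 u) -/w dotpDr dotpZr conjc_real -(positive_op_sym a w pP) h1 h2.
  rewrite -realCM -realCD ler0c.
  have n1 := sqr_ge0 (nrm a); have n2 := sqr_ge0 (nrm (P a)).
  apply: addr_ge0; last by apply: addr_ge0 => //; apply: mulr_ge0 => //; exact: ltW.
  apply: mulr_ge0; first exact: ltW.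
  by apply: addr_ge0 => //; apply: mulr_ge0 => //; exact: ltW.
rewrite (@vtrace_normal _ _ M A P)//.
- apply: ge_ereal_sup => _ [B AB <-].
  have [delta [Q [d0 hQ hQM eB]]] := AB; have [pQ e1 e2 Qc] := hQ.
  set x := y \o Q.
  have Nx : N x by exact: L2_bounded_compr.
  have bx := valg_bounded Nx.1.
  have x1 : obd x 1.
    move=> v; rewrite mul1r /x /= (nrm_op_abs _ hy).
    by have [] := resolvent_bounds pP d0 e1 v.
  have e3 : B = adj x \o y.
    apply/funext => v; rewrite eB /x adj_comp//=; last by case: pQ.
    by rewrite (positive_op_adj pQ) -PPv -(PQ _ _ _ hQ) (PQ _ _ _ hQ) (PQ _ _ _ hQ).
  have fB : fin_pos M B.
    split; first exact: Apos.
    (* delta Q <= 1 and P^2 = y^* y give a finite trace for each delta. This bound grows as delta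
       decreases, so it is used only to evaluate [trace_lin]. *)
    apply: (@le_lt_trans _ _ (vtrace M (delta^-1%:C *: (adj y \o y)))).
      apply: vtrace_le; first exact: Apos.
        apply: positive_partZ; first by rewrite invr_ge0 ltW.
        exact: positive_part_adj_comp.
      apply: op_leP; first by have [_ [+ _]] := Apos _ AB.
        by apply: bounded_opZ; apply: bounded_op_comp => //; exact: bounded_op_adj.
      move=> v; rewrite eB !fctE /= dotpZl dotp_adjl// dotpxx (positive_op_sym _ v pP).
      rewrite positive_op_Re// -realCM lecR; apply: le_trans (Re_le_nrm _) _.
      apply: le_trans (cauchy_schwarz _ _) _.
      have [_ h] := resolvent_bounds pP d0 e1 (P v).
      rewrite (nrm_op_abs _ hy) -/P expr2 mulrA ler_wpM2r ?nrm_ge0//.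
      by rewrite mulrC ler_pdivlMr// mulrC.
    rewrite vtraceZ ?invr_ge0 ?(ltW d0)//; last exact: positive_part_adj_comp.
    by rewrite vtrace_emb// -EFinM ltry.
  have := hye x 1 Nx ler01 x1; rewrite L2_emb_dotp// -e3 trace_lin_pos// nrm_real mul1r.
  move=> h; rewrite (fin_pos_fine fB) lee_fin; apply: le_trans h; exact: ler_norm.
- have [Q hQ] := resolvent_spec pP ltr01.
  exists (P \o Q \o P), 1, Q; split=> //; case: hQ => pQ _ _ Qc.
  exact: valg_double_comm hP pQ.1 Qc.
- move=> _ _ [d1 [Q1 [h1 r1 v1 ->]]] [d2 [Q2 [h2 r2 v2 ->]]].
  have [h|h] := leP d1 d2.
    exists (P \o Q1 \o P); first by exists d1, Q1.
    by split; [exact: (Amono d1 d1 Q1 Q1)|exact: (Amono d1 d2 Q1 Q2)].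
  exists (P \o Q2 \o P); first by exists d2, Q2.
  by split; [exact: (Amono d2 d1 Q2 Q1 h2 (ltW h))|exact: (Amono d2 d2 Q2 Q2)].
- move=> u hu hAu; apply: op_leP; [by case: pP|by case: hu => _ []|].
  move=> v; rewrite (positive_op_Re _ pP) (positive_op_Re _ hu.2) lecR.
  apply/ler_addgt0Pr => eps eps0.
  set delta := eps / (nrm v ^+ 2 + 1).
  have n1 : 0 < nrm v ^+ 2 + 1 by rewrite ltr_wpDl ?sqr_ge0.
  have d0 : 0 < delta by rewrite divr_gt0.
  have [Q hQ] := resolvent_spec pP d0.
  have hQM : valg M Q by case: hQ => pQ _ _ Qc; exact: valg_double_comm hP pQ.1 Qc.
  have AB : A (P \o Q \o P) by exists delta, Q.
  have := (hAu _ AB).2 v; rewrite !fctE dotpBl (dB _ _ v hQ).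
  have [/andP[h h'] ->] := dPQ _ _ v d0 hQ.
  rewrite (positive_op_Re _ pP) (positive_op_Re _ hu.2) -realCM -!realCB ler0c.
  have : delta * complex.Re (dotp (P (Q v)) v) <= eps.
    rewrite /delta mulrAC ler_pdivrMr// ler_wpM2l ?(ltW eps0)//.
    by apply: le_trans h' _; rewrite lerDl.
  by lra.
Qed.

End L2.
End VonNeumann.

(** * Density of the Dirichlet algebra in L^2 *)

Section Semigroups.
Context {R : realType}.

Lemma near_right0 (Q : R -> Prop) : (\forall h \near 0^'+, Q h) ->
  exists2 h0, 0 < h0 & forall h, 0 < h -> h < h0 -> Q h.
Proof.
move=> /nbhs_ballP[/= e e0 he]; exists e => // h h0 hh.
by apply: he => //; rewrite -ball_normE /ball_/= sub0r normrN gtr0_norm.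
Qed.

(* Only an upper bound on the right increments is needed, so no left
   derivatives have to be computed. *)
Lemma right_nonincreasing (G : R -> R) (t : R) : 0 <= t ->
  (forall s, 0 <= s <= t -> forall e, 0 < e -> exists2 r, 0 < r &
     forall s', 0 <= s' <= t -> `|s' - s| < r -> `|G s' - G s| < e) ->
  (forall s, 0 <= s < t -> forall e, 0 < e -> exists2 r, 0 < r &
     forall h, 0 < h -> h < r -> G (s + h) <= G s + e * h) ->
  G t <= G 0.
Proof.
move=> t0 Gc Gr; apply/ler_addgt0Pr => e0 e00.
set e := e0 / (t + 1).
have t1 : 0 < t + 1 by rewrite ltr_wpDl.
have e_gt0 : 0 < e by rewrite divr_gt0.
pose S := [set s | 0 <= s <= t /\ G s <= G 0 + e * s].
have S0 : S 0 by rewrite /S /= lexx t0 mulr0 addr0.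
have hS : has_sup S by split; [exists 0|exists t => s [/andP[]]].
set s := sup S.
have s0 : 0 <= s by apply: ub_le_sup; [exists t => u [/andP[]]|].
have st : s <= t by apply: ge_sup; [exists 0|move=> u [/andP[]]].
have Ss : G s <= G 0 + e * s.
  apply/ler_addgt0Pr => eps eps0.
  have [|r r0 hr] := Gc s _ _ (eps0 : 0 < eps); first by rewrite s0.
  have [u Su us] := sup_adherent r0 hS.
  have us' : u <= s by apply: ub_le_sup => //; exists t => w [/andP[]].
  have [/andP[u0 ut] Gu] := Su.
  have := hr u; rewrite u0 ut => /(_ isT).
  rewrite ler0_norm ?subr_le0// opprB ltrBlDl -ltrBlDr => /(_ us).
  have := ler_wpM2l (ltW e_gt0) us'; rewrite ltr_norml => h /andP[_ h2].
  have := hr u; rewrite u0 ut => /(_ isT); rewrite ler0_norm ?subr_le0// opprB.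
  rewrite ltrBlDl -ltrBlDr => /(_ us); rewrite ltr_norml => /andP[h3 _].
  by move: Gu h h3; lra.
suff -> : t = s.
  apply: le_trans Ss _; rewrite lerD2l /e mulrAC ler_pdivrMr// ler_wpM2l ?(ltW e00)//.
  by apply: (le_trans st); rewrite lerDl.
apply/eqP; rewrite eq_le st andbT leNgt; apply/negP => lt_st.
have [|r r0 hr] := Gr s _ _ e_gt0; first by rewrite s0.
set h := Num.min r (t - s) / 2.
have m0 : 0 < Num.min r (t - s) by rewrite lt_min r0 subr_gt0.
have h0 : 0 < h by rewrite divr_gt0.
have hr' : h < Num.min r (t - s) by rewrite /h ltr_pdivrMr// ltr_pMr// ltr1n.
move: hr'; rewrite lt_min => /andP[hr1 hr2].
have : S (s + h).
  split; first by rewrite addr_ge0 ?(ltW h0)//= -lerBrDl ltW.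
  by apply: le_trans (hr _ h0 hr1) _; move: Ss; lra.
move=> /(ub_le_sup _) => /(_ (ex_intro _ t (fun w '(conj p _) => proj2 (andP p)))).
by rewrite -/s gerDl leNgt h0.
Qed.

Context {V : hilbertType R}.

(** c replaces the operator norm: some bound is multiplied by 3/4 until it fails, and the last valid
    one is attained up to that factor. That it stays above c0 follows from the failure of c0. *)
Lemma near_optimal (T : V -> V) (c0 : R) : bounded_op T -> 0 < c0 -> ~ obd T c0 ->
  exists c, [/\ c0 <= c, obd T c & exists v, nrm v = 1 /\ 3 / 4 * c <= nrm (T v)].
Proof.
move=> bT c00 nT; have [c1 c10 hc1] := bounded_op_obd bT.
have [k [hk nk]] : exists k, obd T ((3 / 4) ^+ k * c1) /\ ~ obd T ((3 / 4) ^+ k.+1 * c1).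
  apply: contrapT => /forallNP h; apply: nT.
  have all k : obd T ((3 / 4) ^+ k * c1).
    elim: k => [|k IH]; first by rewrite expr0 mul1r.
    by apply: contrapT => n; apply: (h k).
  move=> v; have h0 : nrm (T v) <= 0.
    have c : (fun k => (3 / 4) ^+ k * c1 * nrm v) @ \oo --> (0 * c1 * nrm v : R).
      do 2?[apply: cvgM; last exact: cvg_cst].
      by apply: cvg_expr; rewrite ger0_norm//; lra.
    rewrite !mul0r in c; apply: (ler_cvg_to (cvg_cst (nrm (T v))) c).
    by apply: nearW => k; exact: all.
  by apply: le_trans h0 _; rewrite mulr_ge0 ?nrm_ge0 ?ltW.
set c := _ * c1 in hk; exists c.
have c0c : c0 <= c.
  by rewrite leNgt; apply/negP => /ltW cc; apply: nT; exact: obd_le hk.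
split=> //; move: nk => /existsNP[v /negP]; rewrite -ltNge exprS -mulrA -/c => hv.
have v0 : nrm v != 0.
  by apply: contraTneq hv => /nrm_eq0 ->; rewrite (op0 bT) !nrm0 mulr0 ltxx.
have v1 : 0 < nrm v by rewrite lt0r v0 nrm_ge0.
exists ((nrm v)^-1%:C *: v).
rewrite (opZ _ _ bT) !nrmZ nrm_real ger0_norm ?invr_ge0 ?nrm_ge0// mulVf//.
by split=> //; rewrite [leRHS]mulrC ler_pdivlMr// ltW.
Qed.

(* Banach-Steinhaus, by the gliding hump. *)
Lemma uniform_boundedness (T : nat -> V -> V) : (forall n, bounded_op (T n)) ->
  (forall v, exists c, forall n, nrm (T n v) <= c) -> exists n, obd (T n) (4 ^+ n).
Proof.
move=> bT pT; apply: contrapT => /forallNP nT.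
have h4 n : 0 < 4 ^+ n :> R by rewrite exprn_gt0.
have /choice[c] n := near_optimal (bT n) (h4 n) (nT n).
move=> /all_and3[c4 Tc /choice[v hv]].
pose s n : R := 3^-1 ^+ n.
have s0 n : 0 < s n by rewrite exprn_gt0// invr_gt0.
(* By the triangle inequality, one of x + s v and x - s v has an image under T of norm at least s |T
   v|; the sign is chosen accordingly. *)
pose x := fix x n := if n is m.+1 then
   (if nrm (T m (x m + (s m)%:C *: v m)) < nrm (T m (x m - (s m)%:C *: v m))
    then x m - (s m)%:C *: v m else x m + (s m)%:C *: v m) else 0 : V.
have xS n : nrm (x n.+1 - x n) <= s n.
  have e : nrm ((s n)%:C *: v n) = s n.
    by rewrite nrmZ nrm_real (hv n).1 mulr1 gtr0_norm.
  by rewrite /=; case: ifP => _; rewrite addrAC subrr add0r ?nrmN e.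
have Tx n : 3 / 4 * c n * s n <= nrm (T n (x n.+1)).
  have h : nrm (T n ((s n)%:C *: v n)) <=
      (nrm (T n (x n + (s n)%:C *: v n)) + nrm (T n (x n - (s n)%:C *: v n))) / 2.
    rewrite ler_pdivlMr// mulr_natr mulr2n.
    have := nrmB (T n (x n + (s n)%:C *: v n)) (T n (x n - (s n)%:C *: v n)).
    rewrite (opD _ _ (bT n)) (opB _ _ (bT n)) opprB addrC addrA subrK.
    set z := T n ((s n)%:C *: v n).
    rewrite -[z + z]mulr2n -(scaler_nat 2) nrmZ -realC_nat nrm_real ger0_norm//.
    by rewrite mulr_natl mulr2n.
  apply: (@le_trans _ _ (nrm (T n ((s n)%:C *: v n)))).
    rewrite (opZ _ _ (bT n)) nrmZ nrm_real gtr0_norm// mulrC ler_wpM2l ?(ltW (s0 n))//.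
    exact: (hv n).2.
  by apply: le_trans h _; rewrite /=; case: ltP; lra.
have xmn m n : (n <= m)%N -> nrm (x m - x n) <= 3 / 2 * (s n - s m).
  elim: m => [|m IH]; first by rewrite leqn0 => /eqP ->; rewrite !subrr nrm0 mulr0.
  rewrite leq_eqVlt => /orP[/eqP ->|]; first by rewrite !subrr nrm0 mulr0.
  rewrite ltnS => /IH h; apply: le_trans (nrmB_le _ _ (x m)) _.
  have := xS m; have : s m.+1 = 3^-1 * s m by rewrite /s exprS.
  by move: h; lra.
have s_cvg : s @ \oo --> (0 : R).
  by apply: cvg_expr; rewrite ger0_norm; lra.
have [l xl] : exists l : V, x @ \oo --> l.
  apply: cauchy_nrm => e e0.
  have e3 : 0 < e / 3 by rewrite divr_gt0.
  have [N _ hN] := (cvgrPdist_lt _ _).1 s_cvg _ e3.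
  have sm n : (N <= n)%N -> s n < e / 3.
    by move=> /hN /=; rewrite sub0r normrN gtr0_norm.
  have key m n : (N <= n)%N -> (n <= m)%N -> nrm (x m - x n) < e.
    move=> Nn nm; apply: le_lt_trans (xmn _ _ nm) _.
    by have := sm _ Nn; have := s0 m; lra.
  exists N => m n Nm Nn; case: (leqP n m) => [nm|/ltnW mn]; first exact: key.
  by rewrite nrmBC; exact: key.
have xn n : nrm (l - x n) <= 3 / 2 * s n.
  apply: (@cvg_nrm_le _ _ _ \oo _ (fun m => x m - x n)).
    exists n => // m /= nm; apply: le_trans (xmn _ _ nm) _.
    by have := s0 m; lra.
  by apply: cvgB => //; exact: cvg_cst.
have [b hb] := pT l.
(* The step contributes 3/4 c 3^-n, and the later steps move l by at most 3/2 3^-(n+1) = 1/2 3^-n.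
   Hence |T_n l| >= c 3^-n / 4, and c >= 4^n contradicts boundedness at l. *)
have grow n : (4 / 3) ^+ n <= 4 * b.
  have h1 := Tx n; have h2 := Tc n (l - x n.+1); have h3 := xn n.+1.
  have : s n.+1 = 3^-1 * s n by rewrite /s exprS.
  have tri : nrm (T n (x n.+1)) <= nrm (T n l) + nrm (T n (l - x n.+1)).
    rewrite (opB _ _ (bT n)); have := nrmB (T n l) (T n l - T n (x n.+1)).
    by rewrite opprB addrC subrK.
  have c0 : 0 <= c n by exact: le_trans (ltW (h4 n)) (c4 n).
  have := ler_wpM2l c0 h3; have := hb n; move: tri.
  have -> : (4 / 3) ^+ n = 4 ^+ n * s n by rewrite exprMn.
  have := ler_wpM2r (ltW (s0 n)) (c4 n).
  move: h1 h2; move: (s n.+1) (s n) (4 ^+ n) (c n) => s' s1 f cn.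
  move=> h1 h2 h4' h5 h6 h7 e; subst s'; move: h1 h2 h4' h5 h6 h7; nra.
have lim0 : (fun n => 4 * b * (3 / 4) ^+ n) @ \oo --> 4 * b * 0.
  by apply: cvgM; [exact: cvg_cst|apply: cvg_expr; rewrite ger0_norm; lra].
suff : (1 : R) <= 0 by rewrite ler10.
rewrite mulr0 in lim0; apply: (ler_cvg_to (cvg_cst (1 : R)) lim0); apply: nearW => n.
rewrite -[leLHS](_ : (4 / 3) ^+ n * (3 / 4) ^+ n = 1).
  by rewrite ler_wpM2r ?exprn_ge0//; exact: grow.
by rewrite -exprMn (_ : 4 / 3 * (3 / 4) = 1) ?expr1n//; field.
Qed.

Section LocalBound.
Variables (A : V -> V -> Prop) (P : R -> V -> V).
Hypothesis hP : exp_semigroup A P.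

Lemma semigroup_comm s t x : 0 <= s -> 0 <= t -> P s (P t x) = P t (P s x).
Proof.
move=> s0 t0; have := semigroupD hP s0 t0; have := semigroupD hP t0 s0.
by rewrite addrC => -> /(congr1 (fun f => f x)) /= ->.
Qed.

Lemma semigroup_domain a b s : 0 <= s -> A a b -> A (P s a) (P s b).
Proof.
move=> s0 /(semigroup_generator hP) h; apply/(semigroup_generator hP).
have bP := semigroup_bounded hP s0.
apply: (cvg_trans _ (cvg_op bP h)); apply: near_eq_cvg; near=> t.
rewrite /= (opZ _ _ bP) (opB _ _ bP) semigroup_comm//.
Unshelve. all: by end_near. Qed.

Lemma semigroup_near0 x e : 0 < e -> exists2 r, 0 < r &
  forall h, 0 <= h -> h < r -> nrm (P h x - x) < e.
Proof.
move=> e0; have /cvg_nrmP/cvgrPdist_lt/(_ e e0)/near_right0[r r0 hr] :=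
  @semigroup_continuous _ _ _ _ hP x.
exists r => // h; rewrite le_eqVlt => /orP[/eqP <- _|h0 hh].
  by rewrite (semigroup0 hP) subrr nrm0.
by have := hr h h0 hh; rewrite sub0r normrN ger0_norm ?nrm_ge0.
Qed.

(** [exp_semigroup] provides no bound uniform in t. If none existed near 0, there would be times t_n
    <= 1/(n + 1) at which 4^n is not a bound, while each sequence P(t_n) v is bounded by continuity
    at 0: a contradiction to [uniform_boundedness]. *)
Lemma semigroup_local_bound : exists delta C, [/\ 0 < delta, 0 < C &
  forall t, 0 <= t <= delta -> obd (P t) C].
Proof.
apply: contrapT => nb.
have /choice[t ht] n : exists t, 0 <= t <= n.+1%:R^-1 /\ ~ obd (P t) (4 ^+ n).
  apply: contrapT => /forallNP h; apply: nb.
  exists n.+1%:R^-1, (4 ^+ n); split; rewrite ?invr_gt0 ?exprn_gt0// => t t1.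
  by apply: contrapT => ob; apply: (h t).
have bT n : bounded_op (P (t n)).
  by apply: (semigroup_bounded hP); case: (ht n) => /andP[].
have [|n] := @uniform_boundedness (fun n => P (t n)) bT; last by case: (ht n).
move=> v; have [r r0 hr] := semigroup_near0 v ltr01.
have [N _ hN] := near_infty_natSinv_lt (PosNum r0).
exists (\sum_(i < N) nrm (P (t i) v) + (nrm v + 1)) => n.
have [nN|Nn] := ltnP n N.
  rewrite (bigD1 (Ordinal nN))//= -addrA lerDl addr_ge0//.
    by rewrite sumr_ge0// => i _; exact: nrm_ge0.
  by rewrite addr_ge0 ?nrm_ge0.
apply: (@le_trans _ _ (nrm v + 1)); last first.
  by rewrite lerDr sumr_ge0// => i _; exact: nrm_ge0.
rewrite -(subrK v (P (t n) v)); apply: le_trans (nrmD _ _) _.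
rewrite addrC lerD2l ltW//; have [/andP[t0 t1] _] := ht n.
by apply: hr => //; apply: le_lt_trans t1 (hN _ Nn).
Qed.

(** For u <= v the difference is P u applied to P (v - u) x - x. The local bound on P u thus gives
    continuity from both sides out of continuity at 0. *)
Lemma semigroup_uniform_continuity delta C x s : 0 < C ->
  (forall t, 0 <= t <= delta -> obd (P t) C) -> 0 <= s <= delta ->
  forall e, 0 < e -> exists2 r, 0 < r & forall s', 0 <= s' <= delta ->
    `|s' - s| < r -> nrm (P s' x - P s x) < e.
Proof.
move=> C0 hC /andP[s0 sd] e e0.
have eC : 0 < e / C by rewrite divr_gt0.
have [r r0 hr] := semigroup_near0 x eC.
have key u v : 0 <= u -> u <= v -> v <= delta -> v - u < r -> nrm (P v x - P u x) < e.
  move=> u0 uv vd vu.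
  have -> : P v x - P u x = P u (P (v - u) x - x).
    rewrite (opB _ _ (semigroup_bounded hP u0)); congr (_ - _).
    rewrite -[P u (P _ x)]/((P u \o P (v - u)) x) -(semigroupD hP) ?subr_ge0//.
    by rewrite addrC subrK.
  apply: le_lt_trans (hC u _ _) _; first by rewrite u0 (le_trans uv vd).
  by rewrite mulrC -ltr_pdivlMr// hr// subr_ge0.
exists r => // s' /andP[s'0 s'd]; have [ss|ss] := leP s s'.
  by rewrite ger0_norm ?subr_ge0// => h; exact: key.
rewrite ler0_norm ?subr_le0 ?(ltW ss)// opprB nrmBC => h.
by apply: key => //; exact: ltW.
Qed.

End LocalBound.

End Semigroups.

Section Density.
Context {R : realType} {K : hilbertType R} {M : tracial_vNa K}.
Context {V : L2_completion M} (E : V -> \bar R) {H : hilbertType R}.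
Variables (d : V -> H) (L Rt : (K -> K) -> H -> H) (J : H -> H).
Hypothesis hE : quantum_dirichlet_form E.
Hypothesis hd : first_order_calculus E d L Rt J.
Local Notation D := (form_domain E).
Local Notation A := (form_operator E).
Implicit Types a b c x : V.

Lemma form_domain0 : D 0.
Proof.
rewrite /form_domain /=; have := qformZ (qdf_quadratic hE) 0 0.
rewrite scale0r => ->; rewrite normr0 expr0n/= mul0e; exact: ltry.
Qed.

Lemma form_domainZ (c : R[i]) a : D a -> D (c *: a).
Proof.
rewrite /form_domain /= (qformZ (qdf_quadratic hE)) => h.
have := qform_ge0 (qdf_quadratic hE) a.
by move: h; case: (E a) => // r _ _; rewrite -EFinM ltry.
Qed.

Lemma form_domainD a b : D a -> D b -> D (a + b).
Proof.
rewrite /form_domain /= => ha hb.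
have q0 := qform_ge0 (qdf_quadratic hE).
have p := qform_parallelogram (qdf_quadratic hE) a b.
apply: (@le_lt_trans _ _ (E (a + b)%R + E (a - b)%R)%E); first by rewrite leeDl.
rewrite p; have := q0 a; have := q0 b.
by move: ha hb; case: (E a) => // r _; case: (E b) => // s _ _ _; rewrite -EFinD -EFinM ltry.
Qed.

Lemma form_domainL (c : R[i]) a b : D a -> D b -> D (c *: a + b).
Proof. by move=> ha hb; apply: form_domainD => //; exact: form_domainZ. Qed.

Lemma derivL (c : R[i]) a b : D a -> D b -> d (c *: a + b) = c *: d a + d b.
Proof. exact: calc_d_linear hd _ _ _. Qed.

Lemma derivD a b : D a -> D b -> d (a + b) = d a + d b.
Proof. by move=> ha hb; rewrite -[a in LHS]scale1r derivL// scale1r. Qed.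

Lemma deriv0 : d 0 = 0.
Proof.
have := derivD form_domain0 form_domain0; rewrite addr0 => h.
by apply: (@addrI _ (d 0)); rewrite -h addr0.
Qed.

Lemma derivZ (c : R[i]) a : D a -> d (c *: a) = c *: d a.
Proof. by move=> ha; rewrite -[_ *: _ in LHS]addr0 derivL ?deriv0 ?addr0//; exact: form_domain0. Qed.

Lemma derivN a : D a -> d (- a) = - d a.
Proof. by move=> ha; rewrite -scaleN1r derivZ// scaleN1r. Qed.

Lemma form_domainN a : D a -> D (- a).
Proof. by move=> ha; rewrite -scaleN1r; exact: form_domainZ. Qed.

Lemma form_domainB a b : D a -> D b -> D (a - b).
Proof. by move=> ha hb; apply: form_domainD => //; exact: form_domainN. Qed.

Lemma derivB a b : D a -> D b -> d (a - b) = d a - d b.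
Proof. by move=> ha hb; rewrite derivD ?derivN//; exact: form_domainN. Qed.

Lemma energyE a : D a -> E a = (nrm (d a) ^+ 2)%:E.
Proof. by move=> ha; rewrite (calc_energy hd)// normr_nrm -rmorphXn. Qed.

Lemma form_polarE a b : D a -> D b -> form_polar E a b = dotp (d a) (d b).
Proof.
move=> ha hb; rewrite dotp_polar /form_polar.
rewrite -(realC_nat 4) fmorphV; congr (_ * _).
have e (c : R[i]) : fine (E (a + c *: b)) = nrm (d a + c *: d b) ^+ 2.
  rewrite energyE ?derivD ?derivZ//; first exact: form_domainZ.
  by apply: form_domainD => //; exact: form_domainZ.
rewrite 4!big_ord_recl big_ord0 /= !e -complexiE.
rewrite !expr0 scale1r mul1r expr1 /bump/=.
rewrite (_ : (1 + (1 + 0))%N = 2)// (_ : (1 + (1 + (1 + 0)))%N = 3)//.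
rewrite [_ ^+ 3]exprS !sqr_i mulrN1 scaleN1r scaleNr mulN1r mulNr addr0.
ring.
Qed.

Lemma form_operatorP a b : A a b <-> D a /\ forall c, D c -> dotp (d a) (d c) = dotp b c.
Proof.
split=> -[ha h]; split=> // c hc; first by rewrite -form_polarE// h.
by rewrite form_polarE// h.
Qed.

Lemma deriv_closed (u : nat -> V) l w : (forall n, D (u n)) ->
  u @ \oo --> l -> (d \o u) @ \oo --> w -> D l /\ d l = w.
Proof.
move=> Du ul dw.
have h : (fun n => (u n, d (u n))) @ \oo --> (l, w) by exact: cvg_pair.
have cl := calc_d_closed hd.
have : [set p : V * H | D p.1 /\ p.2 = d p.1] (l, w).
  by apply: (closed_cvg _ cl _ _ h); apply: nearW => n; split; [exact: Du|].
by case=> /= h1 ->.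
Qed.

(** For f in the form domain, the minimiser of mu^2 |d u|^2 + |u - f|^2 solves u + mu^2 A u = f, so
    it lies in the domain of A, and |u - f| <= mu |d f|. The choice of mu makes this at most e/2. *)
Lemma operator_dense x e : 0 < e -> exists a b, A a b /\ nrm (a - x) < e.
Proof.
move=> e0; have e2 : 0 < e / 2 by rewrite divr_gt0.
have [f [Df fx]] : exists f, D f /\ nrm (f - x) < e / 2.
  have dn : dense D := qdf_dense hE.
  have e2C : 0 < (e / 2)%:C :> R[i] by rewrite ltcR.
  have [||f [fx Df]] := dn (ball x (e / 2)%:C).
  - by exists x; apply: ballxx.
  - exact: ball_open.
  exists f; split=> //.
  by move: fx; rewrite -ball_normE/= distrC normr_nrm ltcR.
set mu := e / (2 * (nrm (d f) + 1)).
have n1 : 0 < nrm (d f) + 1 by rewrite ltr_wpDl ?nrm_ge0.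
have mu0 : 0 < mu by rewrite divr_gt0// mulr_gt0.
have [||| u l w hu ul uw|u [Du hu]] := @closed_minimiser _ _ _ D
   (fun a => mu%:C *: d a) f.
- exact: form_domain0.
- exact: form_domainL.
- move=> c a b ha hb; rewrite derivL// scalerDr !scalerA.
  by rewrite mulrC.
- have m0 : mu%:C != 0 :> R[i] by rewrite -(rmorph0 (real_complex R)) (inj_eq (@complexI R)) gt_eqF.
  have h : (d \o u) @ \oo --> (mu%:C)^-1 *: w.
    have -> : d \o u = (fun n => (mu%:C)^-1 *: (mu%:C *: d (u n))).
      by apply/funext => n /=; rewrite scalerA mulVf// scale1r.
    by apply: cvgZ; [exact: cvg_cst|exact: uw].
  have [Dl dl] := deriv_closed hu ul h.
  by split=> //; rewrite dl scalerA mulfV// scale1r.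
exists u, ((mu ^- 2)%:C *: (f - u)); split.
  apply/form_operatorP; split=> // c Dc.
  have := hu c Dc; rewrite dotpZl dotpZr conjc_real mulrA -realCM -expr2 => /eqP.
  rewrite addr_eq0 -dotpNl opprB dotpZl => /eqP <-.
  by rewrite mulrA -realCM mulVf ?mul1r// expf_neq0// gt_eqF.
have [uf|uf] := eqVneq (nrm (u - f)) 0.
  by rewrite (_ : u = f) ?(lt_trans fx)//; [lra|apply/eqP; rewrite -subr_eq0; apply/eqP/nrm_eq0].
have uf0 : 0 < nrm (u - f) by rewrite lt0r uf nrm_ge0.
(* The Euler equation tested on u - f. *)
have h : nrm (u - f) ^+ 2 <= mu ^+ 2 * nrm (d f) ^+ 2.
  have := hu _ (form_domainB Du Df); rewrite dotpxx dotpZl dotpZr conjc_real.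
  rewrite mulrA -realCM -expr2 derivB// dotpBr dotpxx => /(congr1 (@complex.Re R)).
  rewrite raddfD/= (_ : complex.Re (_ * _) = mu ^+ 2 * (nrm (d u) ^+ 2 - complex.Re (dotp (d u) (d f)))); last first.
    by case: (dotp _ _) => p q /=; ring.
  have := Re_le_nrm (dotp (d u) (d f)); have := cauchy_schwarz (d u) (d f).
  have m2 := sqr_ge0 mu => h1 h2 h3.
  have : mu ^+ 2 * (complex.Re (dotp (d u) (d f)) - nrm (d u) ^+ 2) <= mu ^+ 2 * nrm (d f) ^+ 2.
    rewrite ler_wpM2l//; move: h1 h2; have := sqr_ge0 (nrm (d u) - nrm (d f)).
    have := sqr_ge0 (nrm (d u)); have := sqr_ge0 (nrm (d f)); nra.
  by move: h3; lra.
have h' : nrm (u - f) <= mu * nrm (d f).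
  by rewrite -(@ler_pXn2r _ 2)// ?nnegrE ?nrm_ge0 ?(mulr_ge0 (ltW mu0) (nrm_ge0 _))// exprMn.
apply: le_lt_trans (nrmB_le _ _ f) _.
have : mu * nrm (d f) <= e / 2.
  rewrite /mu mulrAC ler_pdivrMr ?mulr_gt0//.
  have -> : e / 2 * (2 * (nrm (d f) + 1)) = e * (nrm (d f) + 1) by field.
  by rewrite ler_wpM2l ?(ltW e0)// lerDl.
by move: h' fx; lra.
Qed.

(** * Decay of norm and energy along the semigroup *)

Section Smoothing.
Variable P : R -> V -> V.
Hypothesis hP : exp_semigroup A P.

Lemma operator_energy a b : A a b -> complex.Re (dotp b a) = nrm (d a) ^+ 2.
Proof. by move=> /form_operatorP[Da h]; rewrite -h// dotpxx. Qed.

(** For v = P h a, the term Re <d v, d a - d v> equals Re <P h b, a - P h a>, which is h |b|^2 up to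
    o(h), hence at least -(e/2) h. Expanding |d a|^2 around d v then gives the claim. *)
Lemma energy_decrement a b : A a b -> forall e, 0 < e -> exists2 r, 0 < r &
  forall h, 0 < h -> h < r -> nrm (d (P h a)) ^+ 2 <= nrm (d a) ^+ 2 + e * h.
Proof.
move=> Aab e e0.
have h1 : (fun h => complex.Re (dotp (P h b) ((h^-1)%:C *: (a - P h a)))) @ 0^'+
    --> complex.Re (dotp b b).
  have c : dotp (P h b) ((h^-1)%:C *: (a - P h a)) @[h --> 0^'+] --> (dotp b b : R[i]).
    exact: (cvg_dotp (@semigroup_continuous _ _ _ _ hP b)
      ((semigroup_generator hP a b).1 Aab)).
  apply/cvgrPdist_lt => eps eps0; move/cvg_nrmP/cvgrPdist_lt/(_ eps eps0): c => c.
  near=> h; rewrite -raddfB/=.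
  have : `|0 - nrm (dotp (P h b) ((h^-1)%:C *: (a - P h a)) - dotp b b)| < eps.
    by near: h; exact: c.
  rewrite sub0r normrN ger0_norm ?nrm_ge0//; apply: le_lt_trans.
  by rewrite nrmBC -lecR -normr_nrm normc_ge_Re.
have b0 : 0 <= complex.Re (dotp b b) by rewrite dotpxx/= sqr_ge0.
have e2 : 0 < e / 2 by rewrite divr_gt0.
move/cvgrPdist_lt/(_ _ e2)/near_right0: h1 => [r r0 hr].
exists r => // h h0 hh; have := hr h h0 hh; rewrite ltr_norml => /andP[_].
rewrite dotpZr conjc_real.
have A' := semigroup_domain hP (ltW h0) Aab.
have [Da _] := (form_operatorP _ _).1 Aab.
have [Dh hh'] := (form_operatorP _ _).1 A'.
rewrite -hh' ?derivB//; last exact: form_domainB.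
rewrite (_ : complex.Re (h^-1%:C * _) = h^-1 * complex.Re (dotp (d (P h a)) (d a - d (P h a)))); last first.
  by case: (dotp _ _) => p q /=; ring.
move: (d a) (d (P h a)) => u v => k.
have : - (e / 2) * h <= complex.Re (dotp v (u - v)).
  rewrite -ler_pdivlMr// [leRHS]mulrC; move: k b0; set q := h^-1 * _; lra.
have := nrmD2 v (u - v); rewrite addrC subrK.
by have := sqr_ge0 (nrm (u - v)); lra.
Unshelve. all: by end_near. Qed.

(** The right derivative of |P h a|^2 at 0 is -2 Re <b, a> = -2 |d a|^2. *)
Lemma norm_decrement a b m : A a b -> m <= nrm (d a) ^+ 2 ->
  forall e, 0 < e -> exists2 r, 0 < r &
  forall h, 0 < h -> h < r -> nrm (P h a) ^+ 2 + 2 * m * h <= nrm a ^+ 2 + e * h.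
Proof.
move=> Aab ma e e0.
pose w h : V := (h^-1)%:C *: (a - P h a).
have wb : w h @[h --> 0^'+] --> b by exact/(semigroup_generator hP).
have h1 : (fun h => complex.Re (dotp a (w h))) @ 0^'+ --> complex.Re (dotp a b).
  have c : dotp a (w h) @[h --> 0^'+] --> (dotp a b : R[i]).
    exact: (cvg_dotp (cvg_cst a) wb).
  apply/cvgrPdist_lt => eps eps0; move/cvg_nrmP/cvgrPdist_lt/(_ eps eps0): c => c.
  near=> h; rewrite -raddfB/=.
  have : `|0 - nrm (dotp a (w h) - dotp a b)| < eps by near: h; exact: c.
  rewrite sub0r normrN ger0_norm ?nrm_ge0//; apply: le_lt_trans.
  by rewrite nrmBC -lecR -normr_nrm normc_ge_Re.
have e4 : 0 < e / 4 by rewrite divr_gt0.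
move/cvgrPdist_lt/(_ _ e4)/near_right0: h1 => [r1 r10 hr1].
move/cvg_nrmP/cvgrPdist_lt/(_ _ ltr01)/near_right0: wb => [r2 r20 hr2].
set B := (nrm b + 1) ^+ 2; have B0 : 0 < B by rewrite exprn_gt0// ltr_wpDl ?nrm_ge0.
exists (Num.min r1 (Num.min r2 (e / 2 / B))).
  by rewrite !lt_min r10 r20 !divr_gt0.
move=> h h0; rewrite !lt_min => /and3P[k1 k2 k3].
have := hr1 h h0 k1; rewrite ltr_norml => /andP[_].
have := hr2 h h0 k2; rewrite sub0r normrN ger0_norm ?nrm_ge0// => k4.
have wB : nrm (w h) ^+ 2 <= B.
  rewrite ler_pXn2r ?nnegrE ?addr_ge0 ?nrm_ge0//.
  by have := nrmD (w h - b) b; rewrite subrK; move: k4; lra.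
have aw : a - P h a = h%:C *: w h.
  by rewrite /w scalerA -realCM mulfV ?gt_eqF// scale1r.
rewrite Re_dotpC (operator_energy Aab) => k.
have := nrmB2 a (a - P h a).
rewrite opprB addrC subrK aw nrmZ nrm_real gtr0_norm// dotpZr conjc_real exprMn.
have -> : complex.Re (h%:C * dotp a (w h)) = h * complex.Re (dotp a (w h)).
  by case: (dotp _ _) => p q /=; ring.
move=> ->; move: k; set q := complex.Re _ => k.
have k5 : h * (m - e / 4) <= h * q by rewrite ler_wpM2l ?(ltW h0)//; move: k ma; lra.
have k6 : h * (h * nrm (w h) ^+ 2) <= h * (e / 2).
  rewrite ler_wpM2l ?(ltW h0)//; apply: le_trans (ler_wpM2l (ltW h0) wB) _.
  by rewrite -ler_pdivlMr// ltW.
by move: k5 k6; rewrite expr2; lra.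
Unshelve. all: by end_near. Qed.

Lemma Re_dotp_near (w z : V) e : 0 < e -> exists2 r, 0 < r & forall y x : V,
  nrm (y - w) < r -> nrm (x - z) < r ->
  `|complex.Re (dotp y x) - complex.Re (dotp w z)| < e.
Proof.
move=> e0; set N := nrm z + nrm w + 2.
have N0 : 0 < N by rewrite ltr_wpDl ?addr_ge0 ?nrm_ge0.
exists (Num.min 1 (e / N)); first by rewrite lt_min ltr01 divr_gt0.
move=> y x k1 k2; rewrite -raddfB/=.
apply: (@le_lt_trans _ _ (nrm (dotp y x - dotp w z))).
  by rewrite -lecR -normr_nrm normc_ge_Re.
have -> : dotp y x - dotp w z = dotp (y - w) (x - z) + dotp (y - w) z + dotp w (x - z).
  by rewrite !dotpE; ring.
apply: le_lt_trans (nrmD _ _) _.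
apply: (@le_lt_trans _ _ (nrm (y - w) * nrm (x - z) + nrm (y - w) * nrm z + nrm w * nrm (x - z))).
  apply: lerD; last exact: cauchy_schwarz.
  by apply: le_trans (nrmD _ _) _; apply: lerD; exact: cauchy_schwarz.
move: k1 k2; rewrite !lt_min => /andP[k1 k1'] /andP[k2 k2'].
move: k1' k2'; rewrite !ltr_pdivlMr// /N => k1' k2'.
have := nrm_ge0 (x - z); have := nrm_ge0 (y - w); have := nrm_ge0 z; have := nrm_ge0 w.
move: k1 k1' k2 k2' e0.
move: (nrm (x - z)) (nrm (y - w)) (nrm z) (nrm w) => p q k l.
move=> k1 k1' k2 k2' e0 l0 k0 q0 p0.
have qp1 : q * p <= q by rewrite ler_piMr// ltW.
have qp2 : q * p <= p by rewrite ler_piMl// ltW.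
have [pq|/ltW pq] := leP p q.
  have : l * p <= l * q by rewrite ler_wpM2l.
  by lra.
have : q * k <= p * k by rewrite ler_wpM2r.
by lra.
Qed.

(** The energy decreases along the orbit, so up to time t it is at least its final value m.
    Therefore |P u a|^2 + 2 m u is nonincreasing on [0, t]. This replaces the spectral estimate of s
    exp(-2ts). *)
Lemma smoothing_core delta C a b t : 0 < C ->
  (forall t, 0 <= t <= delta -> obd (P t) C) -> A a b -> 0 <= t <= delta ->
  2 * t * nrm (d (P t a)) ^+ 2 <= nrm a ^+ 2.
Proof.
move=> C0 hC Aab /andP[t0 td].
have Pc x s : 0 <= s <= t -> forall e, 0 < e -> exists2 r, 0 < r &
    forall s', 0 <= s' <= t -> `|s' - s| < r -> nrm (P s' x - P s x) < e.
  move=> /andP[s0 st] e e0; have sd : 0 <= s <= delta by rewrite s0 (le_trans st td).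
  have [r r0 hr] := semigroup_uniform_continuity hP x C0 hC sd e0.
  by exists r => // s' /andP[s'0 s't]; apply: hr; rewrite s'0 (le_trans s't td).
have PS s h : 0 <= s -> 0 < h -> P (s + h) a = P h (P s a).
  by move=> s0 h0; rewrite addrC (semigroupD hP)// ltW.
have As s : 0 <= s -> A (P s a) (P s b) by move=> s0; exact: (semigroup_domain hP s0 Aab).
have mono s : 0 <= s <= t -> nrm (d (P t a)) ^+ 2 <= nrm (d (P s a)) ^+ 2.
  move=> /andP[s0 st]; pose G u := nrm (d (P (s + u) a)) ^+ 2.
  have st' : s + (t - s) = t by rewrite addrC subrK.
  suff : G (t - s) <= G 0 by rewrite /G st' addr0.
  apply: right_nonincreasing; rewrite /G.
  - by rewrite subr_ge0.
  - move=> u /andP[u0 us] e e0.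
    have su : 0 <= s + u <= t by rewrite addr_ge0//= -lerBrDl.
    (* The derivation is only closed; continuity of the energy in time comes from writing it as an
       inner product of two orbits. *)
    have h1 v : 0 <= v -> nrm (d (P (s + v) a)) ^+ 2 =
        complex.Re (dotp (P (s + v) b) (P (s + v) a)).
      by move=> v0; rewrite (operator_energy (As _ _))// addr_ge0.
    have [r r0 hr] := Re_dotp_near (P (s + u) b) (P (s + u) a) e0.
    have [r1 r10 hr1] := Pc a _ su _ r0; have [r2 r20 hr2] := Pc b _ su _ r0.
    exists (Num.min r1 r2); first by rewrite lt_min r10.
    move=> v /andP[v0 vs]; rewrite lt_min => /andP[v1 v2].
    have sv : 0 <= s + v <= t by rewrite addr_ge0//= -lerBrDl.
    have ev : s + v - (s + u) = v - u by ring.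
    rewrite !h1//; apply: hr; first by apply: hr2 => //; rewrite ev.
    by apply: hr1 => //; rewrite ev.
  - move=> u /andP[u0 us] e e0.
    have su : 0 <= s + u by rewrite addr_ge0.
    have [r r0 hr] := energy_decrement (As _ su) e0.
    exists r => // h h0 hh; rewrite addrA (PS _ _ su h0); exact: hr.
pose m := nrm (d (P t a)) ^+ 2.
pose G u := nrm (P u a) ^+ 2 + 2 * m * u.
have : nrm (P t a) ^+ 2 + 2 * m * t <= nrm a ^+ 2.
  suff : G t <= G 0 by rewrite /G mulr0 addr0 (semigroup0 hP).
  apply: right_nonincreasing => //; rewrite /G.
  - move=> u su e e0; have [r r0 hr] := Re_dotp_near (P u a) (P u a)
      (divr_gt0 e0 (ltr0n _ 2)).
    have [r1 r10 hr1] := Pc a _ su _ r0.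
    have m00 : 0 <= 2 * m by apply: mulr_ge0 => //; exact: sqr_ge0.
    have m1 : 0 < 2 * m + 1 by rewrite ltr_wpDl.
    exists (Num.min r1 (e / 2 / (2 * m + 1))); first by rewrite lt_min r10 !divr_gt0.
    move=> v vt; rewrite lt_min => /andP[v1 v2].
    have k := hr _ _ (hr1 _ vt v1) (hr1 _ vt v1); rewrite !dotpxx/= in k.
    have -> : nrm (P v a) ^+ 2 + 2 * m * v - (nrm (P u a) ^+ 2 + 2 * m * u) =
       nrm (P v a) ^+ 2 - nrm (P u a) ^+ 2 + 2 * m * (v - u) by ring.
    apply: le_lt_trans (ler_normD _ _) _.
    have : `|2 * m * (v - u)| <= e / 2.
      rewrite normrM (ger0_norm m00).
      move: v2; rewrite ltr_pdivlMr// => v2; have := normr_ge0 (v - u).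
      by move: v2; lra.
    by move: k; lra.
  - move=> s /andP[s0 st] e e0.
    have ms : m <= nrm (d (P s a)) ^+ 2 by apply: mono; rewrite s0 ltW.
    have [r r0 hr] := norm_decrement (As _ s0) ms e0.
    exists r => // h' h0 hh; rewrite (PS _ _ s0 h0) mulrDr addrA.
    by have := hr h' h0 hh; lra.
move=> h; have h1 := sqr_ge0 (nrm (P t a)).
by rewrite mulrAC -/m; lra.
Qed.

Lemma smoothing delta C x t : 0 < C ->
  (forall t, 0 <= t <= delta -> obd (P t) C) -> 0 < t -> t <= delta -> D (P t x).
Proof.
move=> C0 hC t0 td; have tt : 0 <= t <= delta by rewrite (ltW t0).
(* The summand 1 leaves room for approximants a in the operator domain with |a - x| < 1. Their
   energies at time t are at most m, and lower semicontinuity carries the bound over to x. *)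
set m := (nrm x + 1) ^+ 2 / (2 * t).
suff Em : (E (P t x) <= m%:E)%E by apply: le_lt_trans Em (ltry _).
rewrite leNgt; apply/negP => lt_m.
have [W /nbhs_ballP[/= eps eps0 hW] hE'] := qdf_lsc hE lt_m.
have [er er0] : eps = (complex.Re eps)%:C /\ 0 < complex.Re eps.
  by have e := RRe_real (gtr0_real eps0); split=> //; rewrite -ltcR e.
have r0 : 0 < Num.min 1 (complex.Re eps / C) by rewrite lt_min ltr01 divr_gt0.
have [a [b [Aab]]] := operator_dense x r0; rewrite lt_min => /andP[a1 a2].
have Da : D (P t a) by have [] := (form_operatorP _ _).1 (semigroup_domain hP (ltW t0) Aab).
have /hE' : W (P t a).
  apply: hW; rewrite -ball_normE/= -(opB _ _ (semigroup_bounded hP (ltW t0))).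
  rewrite normr_nrm er ltcR; apply: le_lt_trans (hC t tt _) _.
  by rewrite mulrC -ltr_pdivlMr// nrmBC.
rewrite energyE// lte_fin /m ltr_pdivrMr ?mulr_gt0//.
have := smoothing_core C0 hC Aab tt.
have : nrm a ^+ 2 <= (nrm x + 1) ^+ 2.
  rewrite ler_pXn2r ?nnegrE ?addr_ge0 ?nrm_ge0//.
  by have := nrmD (a - x) x; rewrite subrK; move: a1; lra.
by rewrite mulrC; lra.
Qed.

End Smoothing.

Lemma dirichlet_algebra_dense (x : K -> K) e : L2_bounded M x -> 0 < e ->
  exists2 c, dirichlet_algebra E c & nrm (L2_emb V c - L2_emb V x) < e.
Proof.
move=> Nx e0; have [P [hP hQ]] := qdf_conservative hE.
have [delta [C [d0 C0 hC]]] := semigroup_local_bound hP.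
have [r r0 hr] := semigroup_near0 hP (L2_emb V x) e0.
set t := Num.min r delta / 2.
have m0 : 0 < Num.min r delta by rewrite lt_min r0.
have t0 : 0 < t by rewrite divr_gt0.
have : t < Num.min r delta by rewrite /t ltr_pdivrMr// ltr_pMr// ltr1n.
rewrite lt_min => /andP[tr td].
have [Q [[_ _ hQt] _]] := hQ t (ltW t0).
have [NQ eQ] := hQt x Nx.
exists (Q x); last by rewrite eQ; exact: hr (ltW t0) tr.
split=> //; rewrite eQ; exact: (smoothing hP (L2_emb V x) C0 hC t0 (ltW td)).
Qed.

End Density.

(** * Kaplansky density *)

Section Kaplansky.
Context {R : realType} {K : hilbertType R} {M : tracial_vNa K}.
Context {V : L2_completion M}.
Implicit Types x y a c z : K -> K.
Local Notation emb := (L2_emb V).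
Local Notation N := (L2_bounded M).

Definition quarter_square x := (4^-1)%:C *: (adj x \o x).

Lemma positive_quarter_square x : bounded_op x -> positive_op (quarter_square x).
Proof. by move=> bx; apply: positive_opZ; [rewrite invr_ge0|exact: positive_adj_comp]. Qed.

Lemma quarter_squareE x v : quarter_square x v = (4^-1)%:C *: adj x (x v).
Proof. by []. Qed.

Lemma bounded_transform_exists x : valg M x ->
  exists2 Q, is_resolvent (quarter_square x) 1 Q & valg M Q.
Proof.
move=> hx; have bx := valg_bounded hx.
have pP := positive_quarter_square bx.
have [Q hQ] := resolvent_spec pP ltr01; exists Q => //.
case: hQ => pQ _ _ Qc; apply: (valg_double_comm _ pQ.1 Qc).
by apply: valgZ; apply: valg_comp => //; exact: valg_adj.
Qed.

(* The maximum of t/(1 + t^2/4) is 1, attained at t = 2. *)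
Lemma bounded_transform_obd x Q : bounded_op x ->
  is_resolvent (quarter_square x) 1 Q -> obd (x \o Q) 1.
Proof.
move=> bx [pQ Q1 _ _] v; have pP := positive_quarter_square bx.
rewrite mul1r /=; set w := Q v.
have e : nrm (x w) ^+ 2 = 4 * complex.Re (dotp (quarter_square x w) w).
  by rewrite quarter_squareE dotpZl dotp_adjl// dotpxx -realCM /=; field.
have h : nrm v ^+ 2 = nrm w ^+ 2 + nrm (quarter_square x w) ^+ 2 +
    2 * complex.Re (dotp (quarter_square x w) w).
  by rewrite -[in LHS](Q1 v) -/w scale1r nrmD2 -(positive_op_sym _ _ pP).
have cs := le_trans (Re_le_nrm _) (cauchy_schwarz (quarter_square x w) w).
rewrite -(@ler_pXn2r _ 2)// ?nnegrE ?nrm_ge0// e h.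
have := sqr_ge0 (nrm w - nrm (quarter_square x w)); move: cs; nra.
Qed.

(** x - x Q = x P Q with P = x^* x / 4, where |P| <= 1/4 and |Q| <= 1. This 1/4 is the contraction
    factor of the iteration in [kaplansky]. *)
Lemma bounded_transform_defect x Q : bounded_op x -> obd x 1 ->
  is_resolvent (quarter_square x) 1 Q -> obd (x - (x \o Q)) (4^-1).
Proof.
move=> bx x1 hQ v; have [pQ Q1 _ _] := hQ; have pP := positive_quarter_square bx.
have [_ Q2] := resolvent_bounds pP ltr01 Q1 v.
rewrite !fctE/= -(opB _ _ bx) -{1}(Q1 v) scale1r addrAC subrr add0r.
apply: le_trans (x1 _) _; rewrite mul1r quarter_squareE nrmZ nrm_real ger0_norm ?invr_ge0//.
rewrite ler_wpM2l ?invr_ge0//; apply: le_trans (obd_adj ler01 bx x1 _) _.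
by rewrite mul1r; apply: le_trans (x1 _) _; rewrite mul1r; move: Q2; rewrite mul1r.
Qed.

Lemma bounded_transform_comm x Q Q' v : bounded_op x ->
  is_resolvent (quarter_square x) 1 Q ->
  is_resolvent (quarter_square (adj x)) 1 Q' -> x (Q v) = Q' (x v).
Proof.
move=> bx [pQ Q1 _ _] [pQ' _ Q2' _].
rewrite -{2}(Q1 v) scale1r -(Q2' (x (Q v))) scale1r; congr Q'.
by rewrite (opD _ _ bx) !quarter_squareE (opZ _ _ bx) adjK.
Qed.

(** With F(x) = x Q and Q' the resolvent for the adjoint of c, the difference F(c) - F(x) equals Q'
    (c - x) Q - 1/4 F(c) (c - x)^* F(x). All factors except c - x are contractions, so the constant
    in L^2 norm is 1 + 1/4. *)
Lemma bounded_transform_lipschitz x c Q Qc : N x -> N c ->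
  valg M Q -> valg M Qc ->
  is_resolvent (quarter_square x) 1 Q -> is_resolvent (quarter_square c) 1 Qc ->
  nrm (emb ((c \o Qc) - (x \o Q))) <= 5 / 4 * nrm (emb (c - x)).
Proof.
move=> Nx Nc hQ hQc rQ rQc; have bx := valg_bounded Nx.1; have bc := valg_bounded Nc.1.
have [Q' rQ' hQ'] := bounded_transform_exists (valg_adj Nc.1).
have bQ := valg_bounded hQ; have bQ' := valg_bounded hQ'; have bQc := valg_bounded hQc.
have [pQ' _ Q2' _] := rQ'; have [pQ Q1 _ _] := rQ.
have Ncx := L2_boundedB Nc Nx.
have hcQ := valg_comp Nc.1 hQc; have hxQ := valg_comp Nx.1 hQ.
have e : (c \o Qc) - (x \o Q) = (Q' \o (c - x) \o Q) -
    (4^-1)%:C *: ((c \o Qc) \o adj (c - x) \o (x \o Q)).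
  apply/funext => v; rewrite !fctE/= adjB// !fctE/=.
  rewrite !(bounded_transform_comm _ bc rQc rQ').
  rewrite -{1}(Q1 v) scale1r -{1}(Q2' (x (Q v))) scale1r.
  rewrite !(opB _ _ bQ') !quarter_squareE adjK// !(opB _ _ bc) !(opB _ _ bQ').
  rewrite (opD _ _ bc) (opZ _ _ bc) (opD _ _ bQ') (opZ _ _ bQ').
  rewrite (opD _ _ bQ') (opZ _ _ bQ') scalerBr.
  by rewrite [in RHS]opprB [in LHS]opprD [LHS]addrACA.
have N1 : N (Q' \o (c - x) \o Q).
  by apply: L2_bounded_compr => //; exact: L2_bounded_compl.
have N2 : N ((c \o Qc) \o adj (c - x) \o (x \o Q)).
  by apply: L2_bounded_compr => //; apply: L2_bounded_compl => //; exact: L2_bounded_adj.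
have obdQ' : obd Q' 1.
  move=> v; rewrite mul1r.
  have [_] := resolvent_bounds (positive_quarter_square (bounded_op_adj bc)) ltr01
    (let: And4 _ h _ _ := rQ' in h) v.
  by rewrite mul1r.
have obdQ : obd Q 1.
  move=> v; rewrite mul1r.
  by have [_] := resolvent_bounds (positive_quarter_square bx) ltr01 Q1 v; rewrite mul1r.
rewrite e (embB V N1 (L2_boundedZ _ N2)).
rewrite (embZ V _ N2); apply: le_trans (nrmB _ _) _; rewrite nrmZ nrm_real ger0_norm ?invr_ge0//.
have h1 : nrm (emb (Q' \o (c - x) \o Q)) <= nrm (emb (c - x)).
  have := nrm_emb_compr V hQ (L2_bounded_compl hQ' Ncx) ler01 obdQ; rewrite mul1r.
  move/le_trans; apply; have := nrm_emb_compl V hQ' Ncx ler01 obdQ'; by rewrite mul1r.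
have h2 : nrm (emb ((c \o Qc) \o adj (c - x) \o (x \o Q))) <= nrm (emb (c - x)).
  have Na := L2_bounded_adj Ncx.
  have := nrm_emb_compr V hxQ (L2_bounded_compl hcQ Na) ler01 (bounded_transform_obd bx rQ).
  rewrite mul1r; move/le_trans; apply.
  have := nrm_emb_compl V hcQ Na ler01 (bounded_transform_obd bc rQc).
  by rewrite mul1r nrm_emb_adj.
by move: h1 h2; lra.
Qed.

Section Algebra.
Variable C : set (K -> K).
Hypothesis CN : C `<=` N.
Hypothesis CL : forall (k : R[i]) x y, C x -> C y -> C (k *: x + y).
Hypothesis CM : forall x y, C x -> C y -> C (x \o y).
Hypothesis CA : forall x, C x -> C (adj x).
Hypothesis Cdense : forall x e, N x -> 0 < e -> exists2 c, C c & nrm (emb c - emb x) < e.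

(** This is tau(x z). As an inner product it is linear in x by construction and continuous for the
    L^2 norm by Cauchy-Schwarz. *)
Definition L2_functional z x : R[i] := dotp (emb z) (emb (adj x)).

Lemma L2_functionalL z (k : R[i]) x y : N x -> N y ->
  L2_functional z (k *: x + y) = k * L2_functional z x + L2_functional z y.
Proof.
move=> Nx Ny; have bx := valg_bounded Nx.1; have by_ := valg_bounded Ny.1.
rewrite /L2_functional adjD ?adjZ//; last exact: bounded_opZ.
rewrite embL; [|exact: L2_bounded_adj..].
by rewrite dotpDr dotpZr conjcK.
Qed.

Lemma L2_functionalB z x y : N x -> N y ->
  L2_functional z (x - y) = L2_functional z x - L2_functional z y.
Proof. by move=> Nx Ny; rewrite addrC -scaleN1r L2_functionalL// mulN1r addrC. Qed.

Lemma l1_boundP z e : l1_bound V z e <-> N z /\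
  forall x k, N x -> 0 <= k -> obd x k -> nrm (L2_functional z x) <= k * e.
Proof.
split=> -[Nz h]; split=> // x k Nx k0 hx.
  by apply: h => //; [exact: L2_bounded_adj|apply: obd_adj => //; exact: valg_bounded Nx.1].
rewrite -[x](adjK (valg_bounded Nx.1)); apply: h => //; first exact: L2_bounded_adj.
by apply: obd_adj => //; exact: valg_bounded Nx.1.
Qed.

Lemma subalgebraZ (k : R[i]) x : C x -> C (k *: x).
Proof.
move=> Cx; have := CL (-1) Cx Cx; rewrite scaleN1r addNr => C0.
by rewrite -[_ *: _]addr0; exact: CL.
Qed.

Lemma subalgebraB x y : C x -> C y -> C (x - y).
Proof. by move=> Cx Cy; rewrite addrC -scaleN1r; exact: CL. Qed.

Variables (z : K -> K) (eps B : R).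
Hypothesis eps0 : 0 <= eps.
Hypothesis B0 : 0 <= B.
Hypothesis zB : l1_bound V z B.
Hypothesis zC : forall x k, C x -> 0 <= k -> obd x k ->
  nrm (L2_functional z x) <= k * eps.

(** c Q may lie outside C, but c Y_n, with Y_n the Neumann iterate, is a polynomial in c and its
    adjoint without constant term, hence in C. Its norm is at most 1 + k |e n|, and the crude bound
    B controls the remainder, which vanishes in the limit. *)
Lemma bounded_transform_functional c Q : C c -> valg M Q ->
  is_resolvent (quarter_square c) 1 Q -> nrm (L2_functional z (c \o Q)) <= eps.
Proof.
move=> Cc hQ rQ; have Nc := CN Cc; have bc := valg_bounded Nc.1.
have pP := positive_quarter_square bc.
have [k k0 hk] := bounded_op_obd bc.
have [r r0 hr] := bounded_op_obd pP.1.
have r1 : 0 < r + 1 by rewrite ltr_wpDl.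
have hr1 : obd (quarter_square c) (r + 1) by apply: obd_le hr; rewrite lerDl.
have [Q' [bQ' Q1' Q2' _ [e e_cvg he]]] := resolvent_approx pP ltr01 r1 hr1.
(* Resolvents are unique, so the given Q inherits the approximation in operator norm. *)
have QQ : Q' = Q.
  apply/funext => v; have [_ q1 _ _] := rQ.
  by rewrite -[v in LHS](q1 v) Q2'.
rewrite QQ in he; pose Y := resolvent_iter (quarter_square c) 1 (r + 1).
have CY n : C (c \o Y n).
  elim: n => [|n IH].
    rewrite (_ : c \o Y 0 = 0 *: c); first exact: subalgebraZ.
    by apply/funext => v; rewrite scale0r; exact: (op0 bc).
  rewrite (_ : c \o Y n.+1 = (1 + (r + 1))^-1%:C *:
    (c + ((r + 1)%:C *: (c \o Y n) - (4^-1)%:C *: (c \o (adj c \o (c \o Y n)))))).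
    apply: subalgebraZ; rewrite -[c in c + _]scale1r; apply: CL => //; apply: subalgebraB; apply: subalgebraZ => //.
    by apply: CM => //; apply: CM => //; exact: CA.
  apply/funext => v.
  rewrite -[LHS]/(c (resolvent_iter (quarter_square c) 1 (r + 1) n.+1 v)) resolvent_iterS.
  rewrite quarter_squareE.
  by rewrite (opZ _ _ bc) (opD _ _ bc) (opB _ _ bc) !(opZ _ _ bc).
have bd n : obd ((c \o Q) - (c \o Y n)) (k * `|e n|).
  move=> v; rewrite !fctE/= -(opB _ _ bc); apply: le_trans (hk _) _.
  rewrite -mulrA ler_wpM2l//; apply: le_trans (he n v) _.
  by rewrite ler_wpM2r ?nrm_ge0// ler_norm.
have NcQ : N (c \o Q) by exact: L2_bounded_compr.
have step n : nrm (L2_functional z (c \o Q)) <= (1 + k * `|e n|) * eps + k * `|e n| * B.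
  have NY := CN (CY n).
  have kn0 : 0 <= k * `|e n| by rewrite mulr_ge0.
  have -> : L2_functional z (c \o Q) = L2_functional z (c \o Y n) +
      L2_functional z ((c \o Q) - (c \o Y n)).
    by rewrite L2_functionalB// addrC subrK.
  apply: le_trans (nrmD _ _) _; apply: lerD.
    apply: zC => //; first by rewrite addr_ge0.
    have -> : c \o Y n = (c \o Q) - ((c \o Q) - (c \o Y n)) by rewrite opprB addrC subrK.
    by apply: obdB => //; exact: bounded_transform_obd.
  have [_ h] := (l1_boundP _ _).1 zB; apply: h => //.
  exact: L2_boundedB.
have norm_e : (fun n => `|e n|) @ \oo --> (0 : R).
  by rewrite -(normr0 R); exact: cvg_norm e_cvg.
have lim : (fun n => eps + k * (eps + B) * `|e n|) @ \oo --> eps + k * (eps + B) * 0.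
  apply: cvgD; first exact: cvg_cst.
  by apply: cvgM => //; exact: cvg_cst.
rewrite mulr0 addr0 in lim.
apply: (ler_cvg_to (cvg_cst _) lim); apply: nearW => n.
by apply: le_trans (step n) _; lra.
Qed.

(** Split x into F(x) = x Q and the defect, of norm at most 1/4. F(x) is an L^2 limit of elements
    F(c) with c in C, on which the functional is at most eps, and the functional is L^2
    continuous. *)
Lemma kaplansky_step B' x : 0 <= B' -> l1_bound V z B' -> N x -> obd x 1 ->
  nrm (L2_functional z x) <= eps + B' / 4.
Proof.
move=> B'0 zB' Nx x1; have bx := valg_bounded Nx.1.
have [Q rQ hQ] := bounded_transform_exists Nx.1.
have NxQ : N (x \o Q) by exact: L2_bounded_compr.
have -> : L2_functional z x = L2_functional z (x \o Q) + L2_functional z (x - (x \o Q)).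
  by rewrite L2_functionalB// addrC subrK.
apply: le_trans (nrmD _ _) _; apply: lerD; last first.
  have [_ h] := (l1_boundP _ _).1 zB'; rewrite mulrC; apply: h => //.
  - exact: L2_boundedB.
  - exact: bounded_transform_defect.
apply/ler_addgt0Pr => e e0.
have n1 : 0 < nrm (emb z) * (5 / 4) + 1 by rewrite ltr_wpDl// mulr_ge0 ?nrm_ge0// divr_ge0.
have e1 : 0 < e / (nrm (emb z) * (5 / 4) + 1) by rewrite divr_gt0.
have [c Cc hc] := Cdense Nx e1; have Nc := CN Cc.
have [Qc rQc hQc] := bounded_transform_exists Nc.1.
have NcQ : N (c \o Qc) by exact: L2_bounded_compr.
have -> : L2_functional z (x \o Q) = L2_functional z (c \o Qc) -
    L2_functional z ((c \o Qc) - (x \o Q)).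
  by rewrite L2_functionalB// opprB addrC subrK.
apply: le_trans (nrmB _ _) _; apply: lerD; first exact: bounded_transform_functional.
apply: le_trans (cauchy_schwarz _ _) _; rewrite nrm_emb_adj; last exact: L2_boundedB.
have h := bounded_transform_lipschitz Nx Nc hQ hQc rQ rQc.
apply: le_trans (ler_wpM2l (nrm_ge0 _) h) _; rewrite embB// mulrA.
apply: le_trans (ler_wpM2l _ (ltW hc)) _; first by rewrite mulr_ge0 ?nrm_ge0// divr_ge0.
move: n1; set q := _ * (5 / 4) => n1.
by rewrite mulrA ler_pdivrMr// mulrC ler_wpM2l ?(ltW e0)// lerDl.
Qed.

(** By homogeneity [kaplansky_step] improves any bound B' to eps + B'/4, whose fixed point is 4/3
    eps. The looser 2 eps + B / 4^n is preserved by the step, and its limit is free of the a priori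
    bound B. *)
Lemma kaplansky : l1_bound V z (2 * eps).
Proof.
have Nz := zB.1.
have iter n : l1_bound V z (2 * eps + B * (4^-1) ^+ n).
  elim: n => [|n IH].
    apply/l1_boundP; split=> // x k Nx k0 hx; have [_ h] := (l1_boundP _ _).1 zB.
    apply: le_trans (h _ _ Nx k0 hx) _; rewrite ler_wpM2l// expr0 mulr1 lerDr.
    by rewrite mulr_ge0.
  apply/l1_boundP; split=> // x k Nx k0 hx.
  have b0 : 0 <= 2 * eps + B * 4^-1 ^+ n.
    by rewrite addr_ge0 ?mulr_ge0// exprn_ge0// invr_ge0.
  have [k0'|kn0] := eqVneq k 0.
    have -> : x = 0.
      by apply/funext => v; apply/nrm_le0; apply: le_trans (hx v) _; rewrite k0' mul0r.
    rewrite (_ : L2_functional z 0 = 0) ?nrm0 ?k0' ?mul0r//.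
    have := L2_functionalB z Nz Nz; rewrite !subrr => ->//.
  have kp : 0 < k by rewrite lt0r kn0.
  have Nkx : N (k^-1%:C *: x) by exact: L2_boundedZ.
  have kx1 : obd (k^-1%:C *: x) 1.
    by have := obdZ k^-1%:C hx; rewrite nrm_real ger0_norm ?invr_ge0// mulVf.
  have := kaplansky_step b0 IH Nkx kx1.
  have -> : L2_functional z (k^-1%:C *: x) = k^-1%:C * L2_functional z x.
    have h0 := L2_functionalB z Nx Nx; rewrite !subrr in h0.
    have N0 : N 0 by have := L2_boundedB Nx Nx; rewrite subrr.
    by have := L2_functionalL z (k^-1%:C) Nx N0; rewrite addr0 h0 addr0.
  rewrite nrmM nrm_real ger0_norm ?invr_ge0// mulrC ler_pdivrMr// mulrC.
  move/le_trans; apply; rewrite ler_wpM2l// exprS; move: eps0.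
  by move: (_ ^+ n) => q; lra.
apply/l1_boundP; split=> // x k Nx k0 hx.
have lim : (fun n => k * (2 * eps + B * 4^-1 ^+ n)) @ \oo --> k * (2 * eps + B * 0).
  apply: cvgM; first exact: cvg_cst; apply: cvgD; first exact: cvg_cst.
  apply: cvgM; first exact: cvg_cst.
  by apply: cvg_expr; rewrite ger0_norm ?invr_ge0// invf_lt1 ?ltr1n.
rewrite mulr0 addr0 in lim; apply: (ler_cvg_to (cvg_cst _) lim); apply: nearW => n.
by have [_ h] := (l1_boundP _ _).1 (iter n); exact: h.
Qed.

End Algebra.
End Kaplansky.

(** * Sigma-weakly continuous functionals *)

Section WeakTopology.
Context {R : realType}.

Lemma cvg_initial (S : choiceType) (T : topologicalType) (f : S -> T)
    (F : set_system S) (s : S) : Filter F ->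
  f @ F --> f s -> F --> (s : initial_topology f).
Proof.
move=> FF h A /= [_ [[B Bop <-] Bfs sBA]].
have /h FB : nbhs (f s) B by rewrite nbhsE; exists B.
by rewrite nbhs_filterE; exact: (@filterS _ F _ _ _ sBA FB).
Qed.

Lemma cvg_weak_top (X : choiceType) (I : Type) (f : X -> I -> R[i])
    (F : set_system X) (x : X) : Filter F ->
  (forall i, (fun z => f z i) @ F --> f x i) -> F --> (x : weak_top f).
Proof.
move=> FF h; apply: cvg_initial; apply/cvg_sup => i.
by apply: cvg_initial; exact: h.
Qed.

Lemma weak_top_continuous (X : choiceType) (I : Type) (f : X -> I -> R[i]) (i : I) :
  continuous ((fun x => f x i) : weak_top f -> R[i]).
Proof.
move=> x; apply: (@continuous_comp (weak_top f) (prod_topology (fun _ : I => R[i])) R[i]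
   (f : weak_top f -> prod_topology (fun _ : I => R[i])) (fun g => g i)).
  exact: initial_continuous.
set P := prod_topology _; move: (f x) => g.
have h : nbhs (g : P) --> (g : P) by [].
(* The product topology is the supremum of the initial topologies of the coordinates, so its
   neighbourhood filter contains each of theirs. *)
have hs := @cvg_sup (I -> R[i]) I
  (fun i => Topological.class (initial_topology (fun f : I -> R[i] => f i))) (nbhs (g : P)) g (nbhs_filter (g : P)).
move=> A hA.
have h' : nbhs (g : initial_topology (fun f : I -> R[i] => f i)) `<=` nbhs (g : P) := hs.1 h i.
apply: h'; exact: (@initial_continuous _ _ (fun f : I -> R[i] => f i) g A hA).
Qed.

Lemma continuous_onP (X Y : topologicalType) (A : set X) (f : X -> Y) :
  continuous_on A f <-> forall x, A x -> f @ within A (nbhs x) --> f x.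
Proof. exact: subspace_continuousP. Qed.

Lemma continuous_on_weak_top (X : topologicalType) (Y : choiceType) (I : Type)
    (f : Y -> I -> R[i]) (A : set X) (g : X -> Y) :
  @continuous_on X (weak_top f) A g <->
  forall i, @continuous_on X R[i] A (fun x => f (g x) i).
Proof.
split.
- move=> /continuous_onP h i; apply/continuous_onP => x Ax.
  exact: (cvg_comp _ _ (h x Ax) (@weak_top_continuous _ _ f i (g x))).
- move=> h; apply/continuous_onP => x Ax; apply: cvg_weak_top => i.
  by have /continuous_onP := h i; exact.
Qed.

Lemma continuous_on_eq (X Y : topologicalType) (A : set X) (f g : X -> Y) :
  (forall x, A x -> f x = g x) -> continuous_on A f -> continuous_on A g.
Proof.
move=> fg /continuous_onP h; apply/continuous_onP => x Ax; rewrite -fg//.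
apply: cvg_trans (h x Ax); apply: near_eq_cvg.
by rewrite near_withinE; apply: nearW => y Ay; rewrite fg.
Qed.

End WeakTopology.

(** * Functionals on a dense subalgebra and their representation in L^1 *)

Section Functionals.
Context {R : realType} {K : hilbertType R} {M : tracial_vNa K}.
Context {V : L2_completion M}.
Implicit Types (x y a z : K -> K) (psi : (K -> K) -> R[i]).
Local Notation emb := (L2_emb V).
Local Notation N := (L2_bounded M).
Local Notation lf := (@L2_functional _ _ _ V).

Lemma l1_boundL (k : R[i]) z z' B B' : l1_bound V z B -> l1_bound V z' B' ->
  l1_bound V (k *: z + z') (nrm k * B + B').
Proof.
move=> [Nz hz] [Nz' hz']; split; first by apply: L2_boundedD => //; exact: L2_boundedZ.
move=> x c Nx c0 hx; rewrite embL// dotpDl dotpZl; apply: le_trans (nrmD _ _) _.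
rewrite mulrDr; apply: lerD; last exact: hz'.
by rewrite nrmM mulrCA ler_wpM2l ?nrm_ge0//; exact: hz.
Qed.

Lemma L2_functionalDl (k : R[i]) z z' x : N z -> N z' ->
  lf (k *: z + z') x = k * lf z x + lf z' x.
Proof. by move=> Nz Nz'; rewrite /L2_functional embL// dotpDl dotpZl. Qed.

Lemma L1_bounded_l1_bound z : L1_bounded M z -> exists2 B, 0 <= B & l1_bound V z B.
Proof.
move=> [hz fz]; have [pP _ hP] := op_abs_spec hz.
have fP : fin_pos M (op_abs z) by [].
exists (fine (vtrace M (op_abs z))); first by rewrite fine_ge0// vtrace_ge0.
by apply: op_abs_l1_bound => //; rewrite -fin_pos_fine.
Qed.

Lemma trace_lin_functional z x : N z -> N x -> trace_lin M (x \o z) = lf z x.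
Proof.
move=> Nz Nx; rewrite /L2_functional L2_emb_dotp//; last exact: L2_bounded_adj.
by rewrite (adjK (valg_bounded Nx.1)).
Qed.

(** By [op_abs_l1_bound], an L^1-Cauchy sequence is Cauchy in the dual norm. The index n depends on
    e alone, so the estimate is uniform in x. *)
Lemma L1_pairing_approx (y : {y | L1_cauchy M y}) e : 0 < e -> exists n,
  forall x k, N x -> 0 <= k -> obd x k ->
    nrm (L1_pairing x y - lf (sval y n) x) <= k * e.
Proof.
case: y => y [yb yc] /= e0.
have Ny n : N (y n) by have [B _ []] := L1_bounded_l1_bound (yb n).
have [n hn] := yc e e0; exists n => x k Nx k0 hx.
have cau e' : 0 < e' -> exists n', forall m p, (n' <= m)%N -> (n' <= p)%N ->
    nrm (lf (y m) x - lf (y p) x) <= k * e'.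
  move=> e'0; have [n' hn'] := yc e' e'0; exists n' => m p nm np.
  have := hn' m p nm np => /ltW /(op_abs_l1_bound V _) h.
  have [|_ {}h] := (l1_boundP _ _).1 (h _); first by apply: valgB; case: (Ny m); case: (Ny p).
  rewrite (_ : lf (y m) x - _ = lf (y m - y p) x); first exact: h.
  by rewrite /L2_functional embB// dotpBl.
have [l hl] : exists l : R[i], (fun m => lf (y m) x) @ \oo --> l.
  apply: cauchy_complex => e' e'0.
  have k1 : 0 < k + 1 by rewrite ltr_wpDl.
  have [n' hn'] := cau (e' / (k + 1)) (divr_gt0 e'0 k1); exists n' => m p nm np.
  apply: le_lt_trans (hn' m p nm np) _.
  by rewrite mulrCA gtr_pMr// ltr_pdivrMr// mul1r ltrDl.
rewrite /L1_pairing /=.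
have -> : (fun m => trace_lin M (x \o y m)) = (fun m => lf (y m) x).
  by apply/funext => m; exact: trace_lin_functional.
rewrite (cvg_lim _ hl)//.
have hl' : (fun m => lf (y m) x - lf (y n) x) @ \oo --> (l - lf (y n) x : R[i]).
  by apply: (@cvgB _ R[i]); [exact: hl|exact: cvg_cst].
apply: cvg_nrm_le hl'; exists n => // m /= nm.
have := hn m n nm (leqnn n) => /ltW /(op_abs_l1_bound V _) h.
have [|_ {}h] := (l1_boundP _ _).1 (h _); first by apply: valgB; case: (Ny m); case: (Ny n).
rewrite (_ : lf (y m) x - _ = lf (y m - y n) x); first exact: h.
by rewrite /L2_functional embB// dotpBl.
Qed.

Variable C : set (K -> K).
Hypothesis CN : C `<=` N.
Hypothesis CL : forall (k : R[i]) x y, C x -> C y -> C (k *: x + y).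
Hypothesis CM : forall x y, C x -> C y -> C (x \o y).
Hypothesis CA : forall x, C x -> C (adj x).
Hypothesis C0 : C 0.
Hypothesis Cdense : forall x e, N x -> 0 < e -> exists2 c, C c & nrm (emb c - emb x) < e.

(* [psi] belongs to the closure of the functionals [x |-> tau (x z)], with [z]
   bounded and integrable, in the dual norm of [C]. *)
Definition approximable psi := forall e, 0 < e -> exists z B,
  [/\ 0 <= B, l1_bound V z B & forall x k, C x -> 0 <= k -> obd x k ->
      nrm (psi x - lf z x) <= k * e].

Lemma approximableL (k : R[i]) psi psi' : approximable psi -> approximable psi' ->
  approximable (fun x => k * psi x + psi' x).
Proof.
move=> h h' e e0.
have k1 : 0 < nrm k + 1 by rewrite ltr_wpDl ?nrm_ge0.
have [z [B [B0 zB hz]]] := h (e / 2 / (nrm k + 1)) (divr_gt0 (divr_gt0 e0 (ltr0n _ 2)) k1).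
have [z' [B' [B'0 zB' hz']]] := h' (e / 2) (divr_gt0 e0 (ltr0n _ 2)).
exists (k *: z + z'), (nrm k * B + B'); split; [|exact: l1_boundL|].
  by rewrite addr_ge0 ?mulr_ge0 ?nrm_ge0.
move=> x c Cx c0 hx; rewrite L2_functionalDl; [|by case: zB|by case: zB'].
rewrite (_ : _ - _ = k * (psi x - lf z x) + (psi' x - lf z' x)); last by ring.
apply: le_trans (nrmD _ _) _; rewrite nrmM.
have h1 := hz x c Cx c0 hx; have h2 := hz' x c Cx c0 hx.
have h3 : nrm k * nrm (psi x - lf z x) <= c * (e / 2).
  apply: le_trans (ler_wpM2l (nrm_ge0 _) h1) _; rewrite mulrCA ler_wpM2l//.
  rewrite mulrA ler_pdivrMr// mulrC ler_wpM2l ?lerDl// divr_ge0// ltW//.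
by move: h2 h3; lra.
Qed.

Lemma approximable_eq psi psi' : (forall x, C x -> psi x = psi' x) ->
  approximable psi -> approximable psi'.
Proof.
move=> pp h e e0; have [z [B [B0 zB hz]]] := h e e0.
by exists z, B; split=> // x k Cx k0 hx; rewrite -pp//; exact: hz.
Qed.

Lemma approximable0 : approximable (fun=> 0).
Proof.
have N0 : N 0 by exact: CN.
have e0 : emb 0 = 0 by have := embB V N0 N0; rewrite !subrr.
move=> e ep; exists 0, 0; split=> //.
  by split=> // x k _ k0 _; rewrite e0 dotp0l nrm0 mulr0.
by move=> x k _ k0 _; rewrite /L2_functional e0 dotp0l subrr nrm0 mulr_ge0// ltW.
Qed.

Lemma approximableZ (k : R[i]) psi : approximable psi -> approximable (fun x => k * psi x).
Proof.
move=> h; apply: approximable_eq (approximableL k h approximable0) => x _.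
by rewrite addr0.
Qed.

Lemma approximableD psi psi' : approximable psi -> approximable psi' ->
  approximable (fun x => psi x + psi' x).
Proof.
move=> h h'; apply: approximable_eq (approximableL 1 h h') => x _.
by rewrite mul1r.
Qed.

Lemma approximable_sum n (psi : 'I_n -> (K -> K) -> R[i]) :
  (forall i, approximable (psi i)) -> approximable (fun x => \sum_i psi i x).
Proof.
elim: n psi => [|n IH] psi h.
  by apply: approximable_eq approximable0 => x _; rewrite big_ord0.
apply: (@approximable_eq (fun x => psi ord0 x + \sum_(i < n) psi (lift ord0 i) x)).
  by move=> x _; rewrite big_ord_recl.
by apply: approximableD => //; apply: IH => i.
Qed.

Lemma approximable_lim psi : (forall e, 0 < e -> exists2 psi', approximable psi' &
    forall x k, C x -> 0 <= k -> obd x k -> nrm (psi x - psi' x) <= k * e) ->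
  approximable psi.
Proof.
move=> h e e0; have e2 : 0 < e / 2 by rewrite divr_gt0.
have [psi' h' hp] := h _ e2; have [z [B [B0 zB hz]]] := h' _ e2.
exists z, B; split=> // x k Cx k0 hx; apply: le_trans (nrmB_le _ _ (psi' x)) _.
by have := hp x k Cx k0 hx; have := hz x k Cx k0 hx; lra.
Qed.

Lemma approximable_bounded psi : approximable psi -> exists2 c, 0 <= c &
  forall x k, C x -> 0 <= k -> obd x k -> nrm (psi x) <= k * c.
Proof.
move=> h; have [z [B [B0 zB hz]]] := h 1 ltr01.
exists (1 + B); first by rewrite addr_ge0.
move=> x k Cx k0 hx; rewrite -(subrK (lf z x) (psi x)); apply: le_trans (nrmD _ _) _.
rewrite mulrDr; apply: lerD; first exact: hz.
by have [_ h'] := (l1_boundP _ _).1 zB; apply: h' => //; exact: CN.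
Qed.

(** tau(a x b z) = tau(x b z a), so z is replaced by b z a. *)
Lemma approximable_mul a b psi : C a -> C b -> approximable psi ->
  approximable (fun x => psi (a \o x \o b)).
Proof.
move=> Ca Cb h e e0.
have Na := CN Ca; have Nb := CN Cb.
have ba := valg_bounded Na.1; have bb := valg_bounded Nb.1.
have [ka ka0 hka] := bounded_op_obd ba; have [kb kb0 hkb] := bounded_op_obd bb.
have kk : 0 < ka * kb + 1 by rewrite ltr_wpDl// mulr_ge0.
have [z [B [B0 zB hz]]] := h (e / (ka * kb + 1)) (divr_gt0 e0 kk).
have Nz := zB.1; have bz := valg_bounded Nz.1.
have obdab x k : 0 <= k -> obd x k -> obd (a \o x \o b) (k * (ka * kb)).
  move=> k0 hx; rewrite mulrA [k * ka]mulrC.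
  by apply: obd_comp => //; [rewrite mulr_ge0|exact: obd_comp].
have e1 x : N x -> lf (b \o z \o a) x = lf z (a \o x \o b).
  move=> Nx; have bx := valg_bounded Nx.1; rewrite /L2_functional.
  rewrite (dotp_emb_compr V Na.1 (L2_bounded_compl Nb.1 Nz) (L2_bounded_adj Nx)).
  rewrite (dotp_emb_compl V Nb.1 Nz
    (L2_bounded_compr (valg_adj Na.1) (L2_bounded_adj Nx))).
  by rewrite (adj_comp (bounded_op_comp ba bx) bb) (adj_comp ba bx).
exists (b \o z \o a), (ka * kb * B); split; first by rewrite !mulr_ge0.
  apply/l1_boundP; split.
    by apply: L2_bounded_compr Na.1 _; exact: L2_bounded_compl Nb.1 Nz.
  move=> x k Nx k0 hx; rewrite e1// mulrA.
  have [_ h'] := (l1_boundP _ _).1 zB; apply: h'.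
  - by apply: L2_bounded_compr Nb.1 _; exact: L2_bounded_compl Na.1 Nx.
  - by rewrite !mulr_ge0.
  - exact: obdab.
move=> x k Cx k0 hx; rewrite e1; last exact: CN.
apply: le_trans (hz _ _ _ _ (obdab x k k0 hx)) _.
- by apply: CM => //; exact: CM.
- by rewrite !mulr_ge0.
rewrite -mulrA ler_wpM2l// mulrA ler_pdivrMr// mulrC ler_wpM2l ?(ltW e0)// lerDl//.
Qed.

Lemma approximable_pairing (y : {y | L1_cauchy M y}) : approximable (fun x => L1_pairing x y).
Proof.
move=> e e0; have [n hn] := L1_pairing_approx y e0.
have [B B0 yB] := L1_bounded_l1_bound ((svalP y).1 n).
by exists (sval y n), B; split=> // x k /CN; exact: hn.
Qed.

(* Kaplansky's density theorem turns the approximating sequence, which is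
   Cauchy in the dual norm of [C], into an L^1-Cauchy one. *)
Lemma approximable_normal psi : approximable psi -> exists y : {y | L1_cauchy M y},
  forall x, C x -> psi x = L1_pairing x y.
Proof.
move=> h; have s0 n : 0 < n.+1%:R^-1 :> R by rewrite invr_gt0.
have /choice[z hz] n := h _ (s0 n).
have /choice[B {}hz] n := hz n.
have dist m n : l1_bound V (z m - z n) (2 * (m.+1%:R^-1 + n.+1%:R^-1)).
  have [Bm zm hm] := hz m; have [Bn zn hn] := hz n.
  apply: (@kaplansky _ _ _ _ C CN CL CM CA Cdense _ _ (B n + B m)).
  - by rewrite addr_ge0// ltW.
  - by rewrite addr_ge0.
  - have := l1_boundL (-1) zn zm.
    by rewrite nrmN nrm1 mul1r scaleN1r [- z n + z m]addrC.
  move=> x k Cx k0 hx.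
  have -> : lf (z m - z n) x = (psi x - lf (z n) x) - (psi x - lf (z m) x).
    rewrite /L2_functional embB ?dotpBl; [|by case: zm|by case: zn].
    by ring.
  apply: le_trans (nrmB _ _) _; rewrite mulrDr [leRHS]addrC.
  by apply: lerD; [exact: hn|exact: hm].
have cz : L1_cauchy M z.
  split=> [n|e e0].
    have [Bn zn _] := hz n; split; first by case: zn => -[].
    exact: le_lt_trans (l1_bound_op_abs zn) (ltry _).
  have e8 : 0 < e / 8 by rewrite divr_gt0.
  have [N0 _ hN] := near_infty_natSinv_lt (PosNum e8).
  exists N0 => m n Nm Nn; apply: le_lt_trans (l1_bound_op_abs (dist m n)) _.
  rewrite lte_fin; have := hN m Nm; have := hN n Nn => /=.
  by move: (m.+1%:R^-1) (n.+1%:R^-1) => p q; lra.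
exists (exist _ z cz) => x Cx; have Nx := CN Cx.
have [k k0 hx] := bounded_op_obd (valg_bounded Nx.1).
rewrite /L1_pairing /=; apply/esym/cvg_lim => //.
have -> : (fun n => trace_lin M (x \o z n)) = (fun n => lf (z n) x).
  by apply/funext => n; apply: trace_lin_functional => //; have [_ []] := hz n.
apply: (@cvg_squeeze _ R[i] _ _ _ _ _ (fun n => k * n.+1%:R^-1)).
  apply: nearW => n; rewrite nrmBC; have [_ _ h'] := hz n; exact: h'.
rewrite -[0](mulr0 k); apply: cvgM; first exact: cvg_cst.
exact: cvg_harmonic.
Qed.

Lemma approximable_continuous psi : approximable psi ->
  @continuous_on (sigma_weak M) R[i] C psi.
Proof.
move=> /approximable_normal[y hy].
apply: (@continuous_on_eq (sigma_weak M) R[i] C (fun x => L1_pairing x y)).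
  by move=> x Cx; rewrite hy.
apply: continuous_subspaceT.
exact: (@weak_top_continuous R _ _ (@L1_pairing R K M) y).
Qed.

(** Basic neighbourhoods of 0 for finitely many pairings. The inequality is not strict, so that e =
    0 describes their common kernel. *)
Fixpoint small (ys : seq {y | L1_cauchy M y}) (e : R) x : Prop :=
  if ys is y :: ys' then nrm (L1_pairing x y) <= e /\ small ys' e x else True.

Lemma small_cat ys ys' e e' x : small (ys ++ ys') (Num.min e e') x ->
  small ys e x /\ small ys' e' x.
Proof.
elim: ys => [|y ys IH] /=; last first.
  by move=> [+ /IH[? ?]]; rewrite le_min => /andP[].
move=> h; split=> //; elim: ys' h => //= y ys' IH [+ /IH ?].
by rewrite le_min => /andP[].
Qed.

(** Inherited from [L2_functional], which comes within any given distance of the pairing in the dual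
    norm. *)
Lemma pairing_linear (y : {y | L1_cauchy M y}) (k : R[i]) x x' : C x -> C x' ->
  L1_pairing (k *: x + x') y = k * L1_pairing x y + L1_pairing x' y.
Proof.
move=> Cx Cx'; apply/eqP; rewrite -subr_eq0; apply/eqP/nrm_le0.
have Nx := CN Cx; have Nx' := CN Cx'.
have [c c0 hc] := bounded_op_obd (valg_bounded Nx.1).
have [c' c'0 hc'] := bounded_op_obd (valg_bounded Nx'.1).
set q := nrm k * c + c'.
have q0 : 0 <= q by rewrite addr_ge0 ?mulr_ge0 ?nrm_ge0.
apply/ler_addgt0Pr => e e0; rewrite add0r.
have q1 : 0 < 2 * q + 1 by rewrite ltr_wpDl// mulr_ge0.
have [n hn] := L1_pairing_approx y (divr_gt0 e0 q1); set f := lf (sval y n) in hn.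
have h1 := hn _ _ (CN (CL k Cx Cx')) q0 (obdD (obdZ k hc) hc').
have h2 := hn _ _ Nx c0 hc; have h3 := hn _ _ Nx' c'0 hc'.
rewrite (_ : _ - _ = (L1_pairing (k *: x + x') y - f (k *: x + x')) -
   (k * (L1_pairing x y - f x) + (L1_pairing x' y - f x'))); last first.
  by rewrite /f L2_functionalL//; ring.
apply: le_trans (nrmB _ _) _.
apply: (@le_trans _ _ (q * (e / (2 * q + 1)) + q * (e / (2 * q + 1)))).
  apply: lerD => //; apply: le_trans (nrmD _ _) _; rewrite nrmM /q mulrDl.
  by apply: lerD => //; rewrite -mulrA ler_wpM2l ?nrm_ge0.
have t0 : 0 < e / (2 * q + 1) by rewrite divr_gt0.
have tq : e / (2 * q + 1) * (2 * q + 1) = e by rewrite divfK// gt_eqF.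
by move: t0 tq; move: (e / _) => t; lra.
Qed.

(** A functional that vanishes on the common kernel of finitely many functionals is a combination of
    them. The induction on ys restricts the subspace S to the kernel of the first pairing, while g
    stays defined and linear on C. *)
Lemma linear_dependence ys (S : set (K -> K)) psi :
  S `<=` C -> (forall (k : R[i]) x y, S x -> S y -> S (k *: x + y)) ->
  (forall (k : R[i]) x y, S x -> S y -> psi (k *: x + y) = k * psi x + psi y) ->
  (forall x, S x -> small ys 0 x -> psi x = 0) ->
  exists g, [/\ approximable g,
    forall (k : R[i]) x y, C x -> C y -> g (k *: x + y) = k * g x + g y &
    forall x, S x -> psi x = g x].
Proof.
elim: ys S psi => [|y ys IH] S psi SC SL psiL ker.
  exists (fun=> 0); split; first exact: approximable0.
    by move=> *; rewrite mulr0 addr0.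
  by move=> x Sx; exact: ker.
pose p x := L1_pairing x y.
have pL k x x' : C x -> C x' -> p (k *: x + x') = k * p x + p x'.
  exact: pairing_linear.
have [|||x [Sx px] sx|g [ag gL hg]] := IH [set x | S x /\ p x = 0] psi.
- by move=> x [/SC].
- move=> k x x' [Sx px] [Sx' px']; split; first exact: SL.
  by rewrite pL ?px ?px' ?mulr0 ?addr0//; exact: SC.
- by move=> k x x' [Sx _] [Sx' _]; exact: psiL.
- by apply: ker => //=; split=> //; rewrite -/(p x) px nrm0.
have [[u [Su pu]]|triv] := pselect (exists u, S u /\ p u <> 0); last first.
  exists g; split=> // x Sx; apply: hg; split=> //; apply: contrapT => px.
  by apply: triv; exists x.
pose c := (psi u - g u) / p u.
exists (fun x => c * p x + g x); split.
- exact: approximableL (approximable_pairing y) ag.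
- by move=> k x x' Cx Cx'; rewrite pL// gL//; ring.
move=> x Sx; have Cx := SC _ Sx; have Cu := SC _ Su.
have pu0 : p u != 0 by exact/eqP.
have := hg (- (p x / p u) *: u + x).
rewrite psiL// gL// => e.
have {}e : - (p x / p u) * psi u + psi x = - (p x / p u) * g u + g x.
  by apply: e; split; [exact: SL|rewrite pL// mulNr divfK// addNr].
have -> : psi x = p x / p u * psi u + (- (p x / p u) * psi u + psi x) by ring.
by rewrite e /c; field.
Qed.

(** Continuity at 0 bounds psi on a basic neighbourhood, hence psi vanishes on the common kernel of
    its pairings; [linear_dependence] then writes psi as a combination of pairings. *)
Lemma continuous_approximable psi :
  (forall (k : R[i]) x y, C x -> C y -> psi (k *: x + y) = k * psi x + psi y) ->
  @continuous_on (sigma_weak M) R[i] C psi -> approximable psi.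
Proof.
move=> psiL /continuous_onP/(_ _ C0) cpsi.
have psi0 : psi 0 = 0.
  have := psiL (-1) 0 0 C0 C0; rewrite scaler0 addr0 mulN1r => ->.
  by rewrite addNr.
have pair0 (s : {y | L1_cauchy M y}) : L1_pairing 0 s = 0 :> R[i].
  have := pairing_linear s (-1) C0 C0; rewrite scaler0 addr0 mulN1r => ->.
  by rewrite addNr.
(* The filter generated by the basic neighbourhoods within C. Its convergence to 0 in the weak
   topology is all that is required of neighbourhoods. *)
pose F : set_system (K -> K) :=
  [set A | exists ys e, 0 < e /\ forall x, C x -> small ys e x -> A x].
have FF : Filter F.
  split.
  - by exists [::], 1.
  - move=> A B [ys [e [e0 hA]]] [ys' [e' [e'0 hB]]].
    exists (ys ++ ys'), (Num.min e e'); split; first by rewrite lt_min e0.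
    by move=> x Cx /small_cat[h1 h2]; split; [exact: hA|exact: hB].
  - move=> A B AB [ys [e [e0 hA]]]; exists ys, e; split=> // x Cx sx.
    by apply: AB; exact: hA.
have F0 : F --> (0 : sigma_weak M).
  apply: (@cvg_weak_top R (K -> K) _ (@L1_pairing R K M) F 0 FF) => y.
  rewrite pair0; apply/(@cvg_nrmP R R[i]^o)/cvgrPdist_lt => e e0.
  exists [:: y], (e / 2); split; first by rewrite divr_gt0.
  move=> x Cx [hx _]; rewrite sub0r normrN ger0_norm ?nrm_ge0// subr0.
  by apply: le_lt_trans hx _; rewrite ltr_pdivrMr// ltr_pMr// ltr1n.
have FC : F C by exists [::], 1.
have small1 : F [set x | nrm (psi x) < 1].
  have one : 0 < 1 :> R by [].
  have nb : nbhs (0 : sigma_weak M) [set x | C x -> `|0 - nrm (psi x - psi 0)| < 1].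
    exact: ((cvgrPdist_lt _ _).1 ((cvg_nrmP _ _).1 cpsi) 1 one).
  have [ys [e [e0 hx]]] := F0 _ nb; exists ys, e; split=> // x Cx sx.
  have := hx x Cx sx Cx; rewrite psi0 subr0 sub0r normrN ger0_norm ?nrm_ge0//.
move: small1 => [ys [e [e0 hx]]].
(* Every real multiple of x in the common kernel is small, so |psi| < 1 along a whole line; the
   multiple 1/|psi x| would give the value 1. *)
have [x Cx sx|g [ag _ hg]] := @linear_dependence ys C psi (@subset_refl _ C) CL psiL.
  have Z t : C (t%:C *: x) by rewrite -[_ *: x]addr0; exact: CL.
  have sZ t : small ys e (t%:C *: x).
    elim: ys {hx} sx => //= y ys IH [h1 /IH h2]; split=> //.
    have -> : L1_pairing (t%:C *: x) y = t%:C * L1_pairing x y.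
      by rewrite -[_ *: x]addr0 pairing_linear// pair0 addr0.
    by rewrite (nrm_le0 h1) mulr0 nrm0 ltW.
  have pt t : nrm (psi (t%:C *: x)) = `|t| * nrm (psi x).
    by rewrite -[_ *: x]addr0 psiL// psi0 addr0 nrmM nrm_real.
  apply/nrm_eq0/eqP; apply: contraT => n0.
  have := hx _ (Z (nrm (psi x))^-1) (sZ _).
  by rewrite /= pt ger0_norm ?invr_ge0 ?nrm_ge0// mulVf// ltxx.
by apply: (approximable_eq _ ag) => x Cx; rewrite hg.
Qed.

End Functionals.

(** * The calculus *)

(** If v 0 > 1, repeated squaring forces v n >= (v 0)^(n+1), which exceeds B. The true growth has
    exponent 2^n, but n + 1 is enough. *)
Lemma sqr_iter_le1 (R : realType) (v : nat -> R) (B : R) :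
  (forall n, v n ^+ 2 <= v n.+1) -> (forall n, v n <= B) -> v 0%N <= 1.
Proof.
move=> vS vB; rewrite leNgt; apply/negP => v1.
have v00 : 0 < v 0%N by apply: lt_trans v1.
have vge n : v 0%N ^+ n.+1 <= v n.
  elim: n => [|n IH]; first by rewrite expr1.
  apply: le_trans (vS n); rewrite exprSr expr2.
  have h0 : 0 <= v 0%N ^+ n.+1 by rewrite exprn_ge0// ltW.
  have vn0 : v 0%N <= v n by apply: le_trans IH; rewrite exprS ler_peMr ?exprn_ege1// ltW.
  by apply: ler_pM => //; exact: ltW.
have i1 : `|(v 0%N)^-1| < 1.
  by rewrite ger0_norm ?invr_ge0 ?(ltW v00)// invf_lt1.
have lim : (fun n => B * (v 0%N)^-1 ^+ n) @ \oo --> B * 0.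
  by apply: cvgM; [exact: cvg_cst|exact: cvg_expr].
suff : (1 : R) <= 0 by rewrite ler10.
rewrite mulr0 in lim; apply: (ler_cvg_to (cvg_cst (1 : R)) lim); apply: nearW => n.
rewrite exprVn ler_pdivlMr ?exprn_gt0// mul1r; apply: le_trans (vB n).
by apply: le_trans (vge n); rewrite exprS ler_peMl ?exprn_ge0// ltW.
Qed.

Section Representations.
Context {R : realType} {K : hilbertType R} {M : tracial_vNa K}.
Context {V : L2_completion M} (E : V -> \bar R) {H : hilbertType R}.
Variables (d : V -> H) (L Rt : (K -> K) -> H -> H) (J : H -> H).
Hypothesis hE : quantum_dirichlet_form E.
Hypothesis hd : first_order_calculus E d L Rt J.
Local Notation C := (dirichlet_algebra E).
Local Notation emb := (L2_emb V).
Local Notation N := (L2_bounded M).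
Local Notation appr := (@approximable R K M V C).
Implicit Types (x y a b : K -> K) (xi eta : H).

Lemma dirichlet_bounded : C `<=` N.
Proof. by move=> x []. Qed.

Lemma dirichlet_linear (k : R[i]) x y : C x -> C y -> C (k *: x + y).
Proof.
move=> [Nx Dx] [Ny Dy]; split; first by apply: L2_boundedD => //; exact: L2_boundedZ.
by rewrite embL//; exact: (form_domainL hE).
Qed.

Lemma dirichlet_comp x y : C x -> C y -> C (x \o y).
Proof. exact: (calc_algebra hd). Qed.

Lemma dirichlet_adj x : C x -> C (adj x).
Proof.
move=> [Nx Dx]; split; first exact: L2_bounded_adj.
by rewrite /form_domain /= -L2_star_emb// (qdf_star hE).
Qed.

Lemma dirichlet0 : C 0.
Proof.
have N0 : N 0.
  split; first exact: valg0.
  have -> : adj 0 \o (0 : K -> K) = 0.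
    by apply/funext => v /=; rewrite (op0 (bounded_op_adj bounded_op0)).
  by rewrite vtrace0 ltry.
split=> //; have -> : emb 0 = 0 by have := embB V N0 N0; rewrite !subrr.
exact: (form_domain0 hE).
Qed.

Lemma dirichletD x y : C x -> C y -> C (x + y).
Proof. by move=> Cx Cy; rewrite -[x]scale1r; exact: dirichlet_linear. Qed.

Lemma dirichletZ (k : R[i]) x : C x -> C (k *: x).
Proof. by move=> Cx; rewrite -[_ *: _]addr0; apply: dirichlet_linear => //; exact: dirichlet0. Qed.

Lemma dirichletB x y : C x -> C y -> C (x - y).
Proof. by move=> Cx Cy; apply: dirichletD => //; rewrite -scaleN1r; exact: dirichletZ. Qed.

Lemma dirichlet_dense x e : N x -> 0 < e -> exists2 c, C c & nrm (emb c - emb x) < e.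
Proof. exact: (dirichlet_algebra_dense hE hd). Qed.

Lemma bounded_L x : C x -> bounded_op (L x).
Proof. exact: (rep_bounded (calc_L hd)). Qed.

Lemma L_linear (k : R[i]) x y v : C x -> C y -> L (k *: x + y) v = k *: L x v + L y v.
Proof. by move=> Cx Cy; rewrite (rep_linear (calc_L hd)). Qed.

Lemma L_mul x y v : C x -> C y -> L (x \o y) v = L x (L y v).
Proof. by move=> Cx Cy; rewrite (rep_mul (calc_L hd)). Qed.

Lemma L_adj x u v : C x -> dotp (L (adj x) u) v = dotp u (L x v).
Proof.
by move=> Cx; rewrite (rep_adj (calc_L hd))// dotp_adjl//; exact: bounded_L.
Qed.

Lemma approximable_polar u v :
  appr (fun x => dotp (L x (u + v)) (u + v)) ->
  appr (fun x => dotp (L x (u - v)) (u - v)) ->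
  appr (fun x => dotp (L x (u + 'i%C *: v)) (u + 'i%C *: v)) ->
  appr (fun x => dotp (L x (u - 'i%C *: v)) (u - 'i%C *: v)) ->
  appr (fun x => dotp (L x u) v).
Proof.
have aL := @approximableL _ _ _ V C.
move=> h1 h2 h3 h4.
have h := approximableZ dirichlet_bounded dirichlet0 4^-1 (aL 1 _ _ h1 (aL (-1) _ _ h2 (aL 'i%C _ _ h3
  (approximableZ dirichlet_bounded dirichlet0 (- 'i%C) h4)))).
apply: approximable_eq h => x Cx; have bL := bounded_L Cx.
rewrite [RHS](polarization (B := fun u v => dotp (L x u) v)); last 2 first.
- by move=> k s t w; rewrite opL// !dotpE.
- by move=> k s t w; rewrite !dotpE.
by congr (_ * _); ring.
Qed.

(* Iterating the Cauchy-Schwarz inequality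
   <L(h) xi, xi>^2 <= |xi|^2 <L(h^2) xi, xi> from h = x^* x removes the
   constant c. *)
Lemma contractive_vector xi c : 0 <= c ->
  (forall x k, C x -> 0 <= k -> obd x k -> nrm (dotp (L x xi) xi) <= k * c) ->
  forall x k, C x -> 0 <= k -> obd x k -> nrm (L x xi) <= k * nrm xi.
Proof.
move=> c0 hc x k0 Cx k00 hx0; have bL := bounded_L Cx.
have [xi0|xi0] := eqVneq (nrm xi) 0.
  by rewrite (nrm_eq0 xi0) (op0 bL) !nrm0 mulr0.
have xip : 0 < nrm xi by rewrite lt0r xi0 nrm_ge0.
(* k0 may be 0, while the normalisation below divides by powers of k; a positive excess is added and
   removed at the end. *)
apply/ler_addgt0Pr => e e0; pose k := k0 + e / nrm xi.
have kp : 0 < k by rewrite ltr_wpDl// divr_gt0.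
have -> : k0 * nrm xi + e = k * nrm xi by rewrite /k mulrDl divfK.
have hx : obd x k by apply: obd_le hx0; rewrite lerDl divr_ge0 ?ltW.
have bx := valg_bounded (dirichlet_bounded Cx).1.
(* g n is the power 2^n of x^* x, and kappa n = k^(2^(n+1)) bounds its norm. *)
pose g := fix g n : K -> K := if n is m.+1 then g m \o g m else adj x \o x.
pose kappa := fix kappa n : R := if n is m.+1 then kappa m * kappa m else k * k.
have Cg n : C (g n).
  by elim: n => [|n IH] /=; apply: dirichlet_comp => //; exact: dirichlet_adj.
have bg n : bounded_op (g n) by exact: valg_bounded (dirichlet_bounded (Cg n)).1.
have ag n : adj (g n) = g n.
  elim: n => [|n IH] /=; rewrite adj_comp ?adjK ?IH//; exact: bounded_op_adj.
have kg n : 0 < kappa n by elim: n => [|n IH] /=; exact: mulr_gt0.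
have og n : obd (g n) (kappa n).
  elim: n => [|n IH] /=; apply: obd_comp => //; [exact: ltW|exact: obd_adj (ltW kp) bx hx|exact: ltW].
pose u n := complex.Re (dotp (L (g n) xi) xi).
have u0 : u 0%N = nrm (L x xi) ^+ 2.
  by rewrite /u /= L_mul//; [rewrite L_adj// dotpxx|exact: dirichlet_adj].
have uS n : u n.+1 = nrm (L (g n) xi) ^+ 2.
  by rewrite /u /= L_mul// -{1}(ag n) L_adj// dotpxx.
have uk n : u n <= kappa n * c.
  by apply: le_trans (Re_le_nrm _) _; apply: hc => //; exact: ltW.
have u2 n : u n ^+ 2 <= u n.+1 * nrm xi ^+ 2.
  rewrite uS -exprMn -real_normK ?num_real// ler_pXn2r ?nnegrE ?mulr_ge0 ?nrm_ge0//.
  by apply: le_trans (normr_Re_le _) _; exact: cauchy_schwarz.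
(* In this normalisation Cauchy-Schwarz reads (v n)^2 <= v (n+1), the bound through c is independent
   of n, and v 0 <= 1 is the claim. *)
pose v n := u n / (kappa n * nrm xi ^+ 2).
have x2 : 0 < nrm xi ^+ 2 by rewrite exprn_gt0.
have := @sqr_iter_le1 R v (c / nrm xi ^+ 2).
rewrite /v u0 /= ler_pdivrMr ?mulr_gt0// mul1r -expr2 -exprMn.
rewrite ler_pXn2r ?nnegrE ?mulr_ge0 ?nrm_ge0 ?(ltW kp)//; apply => n.
  rewrite expr_div_n ler_pdivrMr ?exprn_gt0 ?mulr_gt0//.
  have -> : u n.+1 / (kappa n * kappa n * nrm xi ^+ 2) * (kappa n * nrm xi ^+ 2) ^+ 2 =
     u n.+1 * nrm xi ^+ 2 by field; rewrite gt_eqF ?kg//= gt_eqF.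
  exact: u2.
rewrite ler_pdivrMr ?mulr_gt0//.
have -> : c / nrm xi ^+ 2 * (kappa n * nrm xi ^+ 2) = kappa n * c by field; rewrite gt_eqF.
exact: uk.
Qed.

Lemma approximable_contractive xi : appr (fun x => dotp (L x xi) xi) ->
  forall x k, C x -> 0 <= k -> obd x k -> nrm (L x xi) <= k * nrm xi.
Proof.
move=> /(approximable_bounded dirichlet_bounded)[c c0 hc].
exact: contractive_vector c0 hc.
Qed.

(** L(x) is J R(x)^* J with J antiunitary, so matrix coefficients of R are those of L with the two
    vectors exchanged and conjugated by J. *)
Lemma dotp_Rt x xi eta : C x ->
  dotp (Rt x xi) eta = dotp (L x (J eta)) (J xi).
Proof.
move=> Cx; have bR := rep_bounded (calc_R hd) Cx.
have JD u v : J (u + v) = J u + J v.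
  by rewrite -[u in LHS]scale1r (calc_J_antilinear hd) rmorph1 scale1r.
have J0 : J 0 = 0.
  by apply: (@addrI _ (J 0)); rewrite -JD !addr0.
have JZ (k : R[i]) v : J (k *: v) = conjc k *: J v.
  by rewrite -[_ *: v]addr0 (calc_J_antilinear hd) J0 addr0.
have JN v : nrm (J v) = nrm v by rewrite /nrm (calc_J_isometry hd).
have ci : conjc 'i%C = - 'i%C :> R[i] by simpc.
have Jopp v : J (- v) = - J v.
  by apply: (@addrI _ (J v)); rewrite -JD !subrr.
have JJ u v : dotp (J u) (J v) = dotp v u.
  apply: dotp_antiunitary.
  - by rewrite -JD JN.
  - by rewrite -Jopp -JD JN.
  - by rewrite -[RHS]JN JD Jopp JZ ci scaleNr opprK.
  - by rewrite -[RHS]JN JD JZ ci scaleNr.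
by rewrite (calc_LR hd Cx) /= JJ (calc_J_involution hd) dotp_adjr.
Qed.

End Representations.

(** * From the derivations to all vectors and square summable sequences *)

Section Equivalences.
Context {R : realType} {K : hilbertType R} {M : tracial_vNa K}.
Context {V : L2_completion M} (E : V -> \bar R) {H : hilbertType R}.
Variables (d : V -> H) (L Rt : (K -> K) -> H -> H) (J : H -> H).
Hypothesis hE : quantum_dirichlet_form E.
Hypothesis hd : first_order_calculus E d L Rt J.
Local Notation C := (dirichlet_algebra E).
Local Notation emb := (L2_emb V).
Local Notation appr := (@approximable R K M V C).
Implicit Types (x y a b : K -> K) (xi eta : H).

Let CN := @dirichlet_bounded R K M V E.
Let CL := dirichlet_linear hE.
Let CM := dirichlet_comp hd.
Let CA := dirichlet_adj hE.
Let C0 := dirichlet0 hE.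
Let Cd := dirichlet_dense hE hd.

Lemma dirichlet_approximable_continuous psi : appr psi -> @continuous_on (sigma_weak M) R[i] C psi.
Proof. exact: (approximable_continuous CN CL CM CA Cd). Qed.

Lemma dirichlet_continuous_approximable psi :
  (forall (k : R[i]) x y, C x -> C y -> psi (k *: x + y) = k * psi x + psi y) ->
  @continuous_on (sigma_weak M) R[i] C psi -> appr psi.
Proof. exact: (continuous_approximable CN CL C0). Qed.

Lemma vector_functional_linear xi eta (k : R[i]) x y : C x -> C y ->
  dotp (L (k *: x + y) xi) eta = k * dotp (L x xi) eta + dotp (L y xi) eta.
Proof. by move=> Cx Cy; rewrite (L_linear hd)// !dotpE. Qed.

Lemma approximable_carre_du_champ :
  (forall a, C a -> appr (carre_du_champ d L a)) ->
  forall a b, C a -> C b -> appr (fun x => dotp (L x (d (emb a))) (d (emb b))).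
Proof.
move=> h a b Ca Cb; have [Na Da] := Ca; have [Nb Db] := Cb.
have Cib := dirichletZ hE 'i%C Cb.
have e : d (emb ('i%C *: b)) = 'i%C *: d (emb b).
  by rewrite (embZ V _ Nb) (derivZ hE hd).
have p c : C c -> d (emb (a + c)) = d (emb a) + d (emb c).
  by move=> [Nc Dc]; rewrite (embD V Na Nc) (derivD hd).
have m c : C c -> d (emb (a - c)) = d (emb a) - d (emb c).
  by move=> [Nc Dc]; rewrite (embB V Na Nc) (derivB hE hd).
by apply: (approximable_polar hE hd); rewrite -?e -?p// -?m//; apply: h;
  [exact: dirichletD|exact: dirichletB|exact: dirichletD|exact: dirichletB].
Qed.

Lemma approximable_span :
  (forall a, C a -> appr (carre_du_champ d L a)) ->
  forall xi, lspan [set v | exists x y, [/\ C x, C y & v = L x (d (emb y))]] xi ->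
  appr (fun x => dotp (L x xi) xi).
Proof.
move=> h xi [n [c [s [hs ->]]]].
have /choice[f hf] i : exists p : (K -> K) * (K -> K),
    [/\ C p.1, C p.2 & s i = L p.1 (d (emb p.2))].
  by have [x [y [Cx Cy e]]] := hs i; exists (x, y).
have key i j : appr (fun x => dotp (L x (s i)) (s j)).
  have [Cu Ca ->] := hf i; have [Cv Cb ->] := hf j.
  have := approximable_mul CN CM (CA Cv) Cu (approximable_carre_du_champ h Ca Cb).
  apply: approximable_eq => x Cx.
  by rewrite (L_mul hd _ (CM (CA Cv) Cx) Cu) (L_mul hd _ (CA Cv) Cx) (L_adj hd _ _ Cv).
have apsi := approximable_sum CN C0 (fun i => approximable_sum CN C0 (fun j =>
  approximableZ CN C0 (c i * conjc (c j)) (key i j))).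
apply: approximable_eq apsi => x Cx; have bL := bounded_L hd Cx.
have -> : L x (\sum_i c i *: s i) = \sum_i c i *: L x (s i).
  elim/big_ind2 : _ => [|u v u' v' <- <-|i _]; [exact: op0|exact: opD|exact: opZ].
rewrite dotp_suml; apply: eq_bigr => i _.
rewrite dotp_sumr; apply: eq_bigr => j _.
by rewrite dotpZl dotpZr mulrA.
Qed.

(** Each [L x] is bounded with some constant depending on x. This suffices to pass to the limit from
    D, and the limit keeps the bound valid on D. *)
Lemma contractive_dense (D : set H) : dense D ->
  (forall xi, D xi -> appr (fun x => dotp (L x xi) xi)) ->
  forall x k xi, C x -> 0 <= k -> obd x k -> nrm (L x xi) <= k * nrm xi.
Proof.
move=> dD aD x k xi Cx k0 hx; apply/ler_addgt0Pr => e e0.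
have bL := bounded_L hd Cx; have [c c0 hc] := bounded_op_obd bL.
have ck : 0 < c + k + 1 by rewrite ltr_wpDl// addr_ge0.
have r0 : 0 < (e / (c + k + 1))%:C :> R[i] by rewrite ltcR divr_gt0.
have [||xi' [hxi' Dxi']] := dD (ball xi (e / (c + k + 1))%:C).
- by exists xi; apply: ballxx.
- exact: ball_open.
have {}hxi' : nrm (xi - xi') <= e / (c + k + 1).
  by move: hxi'; rewrite -ball_normE/= normr_nrm ltcR => /ltW.
have h1 := approximable_contractive hE hd (aD _ Dxi') Cx k0 hx.
have h2 := hc (xi - xi').
have -> : L x xi = L x (xi - xi') + L x xi' by rewrite -(opD _ _ bL) subrK.
apply: le_trans (nrmD _ _) _.
have h3 : nrm xi' <= nrm xi + nrm (xi - xi').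
  by rewrite nrmBC; have := nrmD (xi' - xi) xi; rewrite subrK addrC.
have h4 := ler_wpM2l k0 h3; have h5 := ler_wpM2l c0 hxi'; have h6 := ler_wpM2l k0 hxi'.
have h7 : e / (c + k + 1) * (c + k + 1) = e by rewrite divfK// gt_eqF.
have h8 : 0 < e / (c + k + 1) by rewrite divr_gt0.
move: h1 h2 h4 h5 h6 h7 h8; move: (e / _) => r; lra.
Qed.

Lemma approximable_dense (D : set H) : dense D ->
  (forall xi, D xi -> appr (fun x => dotp (L x xi) xi)) ->
  forall xi, appr (fun x => dotp (L x xi) xi).
Proof.
move=> dD aD xi; have ctr := contractive_dense dD aD.
apply: approximable_lim => e e0.
have q0 : 0 < 2 * nrm xi + 2 by rewrite ltr_wpDl// mulr_ge0// nrm_ge0.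
(* If |xi - xi'| < r, then |xi'| <= |xi| + 1, so the two error terms together are at most k |xi -
   xi'| (2 |xi| + 1) <= k e. *)
pose r := Num.min 1 (e / (2 * nrm xi + 2)).
have r0 : 0 < r by rewrite lt_min ltr01 divr_gt0.
have rC : 0 < r%:C :> R[i] by rewrite ltcR.
have [||xi' [hxi' Dxi']] := dD (ball xi r%:C).
- by exists xi; apply: ballxx.
- exact: ball_open.
move: hxi'; rewrite -ball_normE/= normr_nrm ltcR lt_min => /andP[h1 h2].
exists (fun x => dotp (L x xi') xi'); first exact: aD.
move=> x k Cx k0 hx; have bL := bounded_L hd Cx.
have -> : dotp (L x xi) xi - dotp (L x xi') xi' =
    dotp (L x (xi - xi')) xi + dotp (L x xi') (xi - xi').
  by rewrite (opB _ _ bL) !dotpE; ring.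
apply: le_trans (nrmD _ _) _.
have h3 : nrm xi' <= nrm xi + 1.
  by have := nrmD (xi' - xi) xi; rewrite subrK nrmBC; move: h1; lra.
have h4 := ctr x k (xi - xi') Cx k0 hx; have h5 := ctr x k xi' Cx k0 hx.
apply: (@le_trans _ _ (k * nrm (xi - xi') * nrm xi + k * nrm xi' * nrm (xi - xi'))).
  by apply: lerD; apply: le_trans (cauchy_schwarz _ _) _; rewrite ler_wpM2r ?nrm_ge0.
rewrite -!mulrA -mulrDr ler_wpM2l//.
move: h2; rewrite ltr_pdivlMr// => h2; have := nrm_ge0 xi; have := nrm_ge0 (xi - xi').
move: h1 h2 h3; move: (nrm (xi - xi')) (nrm xi) (nrm xi') => p q s; nra.
Qed.

Lemma square_summable_tail (u : nat -> H) : square_summable u ->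
  forall e, 0 < e -> exists n0, forall n m, (n0 <= n)%N -> (n <= m)%N ->
    \sum_(n <= k < m) nrm (u k) ^+ 2 < e.
Proof.
move=> /cvg_ex[l hl] e e0; have e2 : 0 < e / 2 by rewrite divr_gt0.
have /cvg_nrmP/cvgrPdist_lt/(_ _ e2)[n0 _ h] := hl.
exists n0 => n m n0n nm.
have d1 := h n n0n; have d2 := h m (leq_trans n0n nm).
move: d1 d2; rewrite /= !sub0r !normrN !ger0_norm ?nrm_ge0// => d1 d2.
have e1 : (\sum_(n <= k < m) nrm (u k) ^+ 2)%:C =
    series (fun k => `|u k| ^+ 2 : R[i]) m - series (fun k => `|u k| ^+ 2 : R[i]) n.
  rewrite sub_series_geq// (big_morph (real_complex R) (id1 := 0) (op1 := +%R))//=.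
    by apply: eq_bigr => k _; rewrite normr_nrm rmorphXn.
  by move=> p q; rewrite -realCD.
rewrite -[ltLHS]ger0_norm; last by apply: sumr_ge0 => k _; exact: sqr_ge0.
rewrite -nrm_real e1; apply: le_lt_trans (nrmB_le _ _ l) _.
by rewrite [nrm (l - _)]nrmBC; move: d1 d2; lra.
Qed.

(** Contractivity bounds the i-th term by k (|u_i|^2 + |v_i|^2)/2. The tails are therefore small
    uniformly on norm bounded sets of C, and the series is a limit of finite sums in the dual
    norm. *)
Lemma approximable_sw_functional (p : sw_index H) :
  (forall xi, appr (fun x => dotp (L x xi) xi)) ->
  appr (fun x => sw_functional (L x) p).
Proof.
move=> aL; case: p => [[u v] [su sv]].
have dT : dense [set: H] by move=> O [y Oy] _; exists y.
have ctr := contractive_dense dT (fun xi _ => aL xi).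
have auv i : appr (fun x => dotp (L x (u i)) (v i)) by apply: (approximable_polar hE hd).
have tail e : 0 < e -> exists n0, forall n m, (n0 <= n)%N -> (n <= m)%N ->
    forall x k, C x -> 0 <= k -> obd x k ->
    nrm (series (fun k => dotp (L x (u k)) (v k)) m -
         series (fun k => dotp (L x (u k)) (v k)) n) <= k * e.
  move=> e0; have [n1 h1] := square_summable_tail su e0.
  have [n2 h2] := square_summable_tail sv e0.
  exists (maxn n1 n2) => n m; rewrite geq_max => /andP[n1n n2n] nm x k Cx k0 hx.
  rewrite sub_series_geq//.
  have b1 : nrm (\sum_(n <= i < m) dotp (L x (u i)) (v i)) <=
      \sum_(n <= i < m) k * (2^-1 * (nrm (u i) ^+ 2 + nrm (v i) ^+ 2)).
    elim/big_ind2 : _ => [|a b a' b' h h'|i _]; first by rewrite nrm0.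
      by apply: le_trans (nrmD _ _) _; exact: lerD.
    apply: le_trans (cauchy_schwarz _ _) _.
    apply: le_trans (ler_wpM2r (nrm_ge0 _) (ctr x k (u i) Cx k0 hx)) _.
    rewrite -mulrA ler_wpM2l//; have := sqr_ge0 (nrm (u i) - nrm (v i)); nra.
  apply: le_trans b1 _; rewrite -mulr_sumr ler_wpM2l// -mulr_sumr big_split /=.
  by have := h1 n m n1n nm; have := h2 n m n2n nm; lra.
have lim x : C x -> exists l : R[i], series (fun k => dotp (L x (u k)) (v k)) @ \oo --> l.
  move=> Cx; have [k k0 hx] := bounded_op_obd (valg_bounded (CN Cx).1).
  have k1 : 0 < k + 1 by rewrite ltr_wpDl.
  apply: cauchy_complex => e e0.
  have [n0 h] := tail _ (divr_gt0 e0 k1).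
  have small : k * (e / (k + 1)) < e.
    by rewrite mulrCA gtr_pMr// ltr_pdivrMr// mul1r ltrDl.
  exists n0 => n m n0n n0m; case: (leqP m n) => [mn|/ltnW nm].
    exact: le_lt_trans (h m n n0m mn x k Cx k0 hx) small.
  by rewrite nrmBC; exact: le_lt_trans (h n m n0n nm x k Cx k0 hx) small.
apply: approximable_lim => e e0; have [n h] := tail e e0.
exists (fun x => \sum_(i < n) dotp (L x (u i)) (v i)).
  exact: (approximable_sum CN C0).
move=> x k Cx k0 hx; have [l hl] := lim x Cx.
have -> : sw_functional (L x) (exist _ (u, v) (conj su sv)) = l by exact: cvg_lim hl.
rewrite -(big_mkord xpredT (fun i => dotp (L x (u i)) (v i))).
have hl' : (fun m => series (fun k => dotp (L x (u k)) (v k)) m -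
    series (fun k => dotp (L x (u k)) (v k)) n) @ \oo -->
    (l - series (fun k => dotp (L x (u k)) (v k)) n : R[i]).
  by apply: (@cvgB _ R[i]); [exact: hl|exact: cvg_cst].
apply: (cvg_nrm_le _ hl'); exists n => // m /= nm.
exact: h.
Qed.

Lemma sw_functional_vector xi eta : exists p : sw_index H, forall T : H -> H,
  sw_functional T p = dotp (T xi) eta.
Proof.
pose u z n : H := if n is 0%N then z else 0.
have series_first (f : nat -> R[i]) : (forall n, f n.+1 = 0) -> series f @ \oo --> f 0%N.
  move=> f0; apply: cvg_near_cst; exists 1%N => // n /= n0.
  rewrite /series /= -(prednK n0) big_nat_recl//= big1 ?addr0//.
have su z : square_summable (u z).
  apply/cvg_ex; exists (`|u z 0%N| ^+ 2).
  apply: (series_first (fun k => `|u z k| ^+ 2)) => n /=.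
  by rewrite normr0 expr0n.
exists (exist _ (u xi, u eta) (conj (su xi) (su eta))) => T.
(* T need not send 0 to 0; the later terms vanish through the second argument of the inner
   product. *)
apply: cvg_lim => //; apply: (series_first (fun k => dotp (T (u xi k)) (u eta k))) => n /=.
by rewrite dotp0r.
Qed.

Lemma sw_functional_Rt_flip (p : sw_index H) : exists q : sw_index H, forall x, C x ->
  sw_functional (Rt x) p = sw_functional (L x) q.
Proof.
case: p => [[u v] [su sv]].
have sJ w : square_summable w -> square_summable (J \o w).
  rewrite /square_summable (_ : (fun k => `|(J \o w) k| ^+ 2) = (fun k => `|w k| ^+ 2))//.
  by apply/funext => k /=; rewrite (calc_J_isometry hd).
exists (exist _ (J \o v, J \o u) (conj (sJ _ sv) (sJ _ su))) => x Cx.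
rewrite /sw_functional /=; congr (lim (series _ @ \oo)).
by apply/funext => k /=; exact: (dotp_Rt hd).
Qed.

Lemma sw_functional_L_flip (p : sw_index H) : exists q : sw_index H, forall x, C x ->
  sw_functional (L x) p = sw_functional (Rt x) q.
Proof.
case: p => [[u v] [su sv]].
have sJ w : square_summable w -> square_summable (J \o w).
  rewrite /square_summable (_ : (fun k => `|(J \o w) k| ^+ 2) = (fun k => `|w k| ^+ 2))//.
  by apply/funext => k /=; rewrite (calc_J_isometry hd).
exists (exist _ (J \o v, J \o u) (conj (sJ _ sv) (sJ _ su))) => x Cx.
rewrite /sw_functional /=; congr (lim (series _ @ \oo)).
by apply/funext => k /=; rewrite (dotp_Rt hd)// !(calc_J_involution hd).
Qed.

End Equivalences.

Theorem theorem2p4 (R : realType) (K : hilbertType R) (M : tracial_vNa K)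
    (V : L2_completion M) (E : V -> \bar R) (hE : quantum_dirichlet_form E)
    (H : hilbertType R) (d : V -> H) (L Rt : (K -> K) -> (H -> H)) (J : H -> H)
    (hd : first_order_calculus E d L Rt J) :
  let C := dirichlet_algebra E in
  [<-> @continuous_on (sigma_weak M) (sigma_weak_B H) C L;
       @continuous_on (sigma_weak M) (sigma_weak_B H) C Rt;
       forall a, C a ->
         @continuous_on (sigma_weak M) R[i] C (carre_du_champ d L a);
       forall xi : H,
         @continuous_on (sigma_weak M) R[i] C (carre_du_champ_H L xi)].
Proof.
move=> C.
have top (T : (K -> K) -> H -> H) := @continuous_on_weak_top R (sigma_weak M) (H -> H)
  (sw_index H) (@sw_functional R H) C T.
tfae.
- move=> /top h; apply/top => p; have [q hq] := sw_functional_Rt_flip hd p.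
  by apply: continuous_on_eq (h q) => x Cx; rewrite hq.
(* The hypothesis concerns R, so the vector functional of L is first rewritten as a functional of R
   by means of J. *)
- move=> /top h a Ca; have [p hp] := sw_functional_vector (d (L2_emb V a)) (d (L2_emb V a)).
  have [q hq] := sw_functional_L_flip hd p.
  by apply: continuous_on_eq (h q) => x Cx; rewrite -hq// hp.
- move=> h xi; apply: (dirichlet_approximable_continuous hE hd).
  apply: (approximable_dense hE hd (calc_dense hd)).
  apply: (approximable_span hE hd) => a Ca.
  apply: (dirichlet_continuous_approximable hE _ (h a Ca)) => k x y.
  exact: (vector_functional_linear hd).
- move=> h; apply/top => p; apply: (dirichlet_approximable_continuous hE hd).
  apply: (approximable_sw_functional hE hd) => xi.
  apply: (dirichlet_continuous_approximable hE _ (h xi)) => k x y.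
  exact: (vector_functional_linear hd).
Qed.
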